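(* Let $(W_n)_{n\in\mathbf{N}}$, $W_n=(w_{ij})_{i,j=1}^n$, be a Hermitian Wigner ensemble such that $$\frac1n\sum_{i,j=1}^n\bigl|\mathbf{E}[w_{ij};|w_{ij}|\le1]\bigr|^2\to0,$$ $$\frac1n\sum_{i,j=1}^n\mathbf{P}(|w_{ij}|>\epsilon)\to0\quad\text{for all }\epsilon>0,$$ and $$\frac1n\sum_{i\in J_n}\sum_{j=1}^n\mathbf{E}\bigl[|w_{ij}|^2;|w_{ij}|\le1\bigr]\to0\quad\text{for any choice of }J_n\subset\{1,\ldots,n\}\text{ with }|J_n|/n\to0.$$ Then $\mathbf{E}\mu_{W_n}\Rightarrow\mu_{\mathrm{sc}}$ if and only if $$\frac1n\sum_{i=1}^n\Bigl|\sum_{j=1}^n\mathbf{E}\bigl[|w_{ij}|^2;|w_{ij}|\le1\bigr]-1\Bigr|\to0.$$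
   Context: A Hermitian Wigner ensemble is a sequence $(W_n)_{n\in\mathbf{N}}$ where $W_n=(w_{ij})_{i,j=1}^n$ is a random $n\times n$ (complex) Hermitian matrix whose upper triangular entries $w_{ij}$, $1\le i\le j\le n$, are independent. The entries $w_{ij}$ depend on $n$, but this is suppressed in the notation. No moments are assumed finite. For an $n\times n$ Hermitian matrix $A$ with eigenvalues $\lambda_1\ge\cdots\ge\lambda_n$ (with multiplicity), $\mu_A:=\frac1n\sum_{i=1}^n\delta_{\lambda_i}$. For a random probability measure $\mu$ on $\mathbf{R}$, $\mathbf{E}\mu$ is the Borel probability measure with distribution function $x\mapsto\mathbf{E}[\mu((-\infty,x])]$. $\mu_{\mathrm{sc}}$ is the semicircle distribution $\mu_{\mathrm{sc}}(dx)=\frac{1}{2\pi}\sqrt{(4-x^2)_+}\,dx$, where $x_+=\max\{x,0\}$. $\Rightarrow$ denotes weak convergence of probability measures. $\mathbf{E}[X;A]:=\mathbf{E}[X\mathbf{1}_A]$. *)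

(* Defs.v *)
From HB Require Import structures.
From mathcomp Require Import all_boot all_order all_algebra.
From mathcomp Require Import spectral sesquilinear complex.
From mathcomp Require Import all_classical all_reals all_analysis.
From mathcomp Require Import measurable_realfun.

Set Implicit Arguments.
Unset Strict Implicit.
Unset Printing Implicit Defensive.

Import Order.TTheory GRing.Theory Num.Theory.
Import numFieldNormedType.Exports.

Local Open Scope classical_set_scope.
Local Open Scope complex_scope.
Local Open Scope ring_scope.

(* The Borel structure on the complex numbers is that of R * R. *)
Definition complex_pair (R : realType) (z : R[i]) : R * R :=
  (complex.Re z, complex.Im z).

(* Mutual independence of the family (X i), i in D : the product rule holds on
   every finite subfamily. *)
Definition independent_RVs d (T : measurableType d) (R : realType)
    (P : probability T R) d' (U : measurableType d') (I : finType)
    (D : {set I}) (X : I -> T -> U) : Prop :=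
  forall (J : {set I}) (B : I -> set U), J \subset D ->
    (forall i, measurable (B i)) ->
    P (\bigcap_(i in [set` J]) (X i @^-1` B i)) =
    (\prod_(i in J) P (X i @^-1` B i))%E.

(* A random N x N Hermitian matrix with independent upper triangular entries. *)
Definition hermitian_wigner d (T : measurableType d) (R : realType)
    (P : probability T R) N (W : T -> 'M[R[i]]_N) : Prop :=
  [/\ (forall w, W w \is hermsymmx),
      (forall i j, measurable_fun [set: T] (fun w => complex_pair (W w i j))) &
      independent_RVs P [set ij : 'I_N * 'I_N | (ij.1 <= ij.2)%N]
        (fun ij w => complex_pair (W w ij.1 ij.2))].

Section truncated_expectation.
Context d (T : measurableType d) (R : realType) (P : probability T R).

(* E[X; A] for X real valued; [fine] is harmless when X is bounded on A. *)
Definition expectation_on (X : T -> R) (A : set T) : R :=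
  fine 'E_P[fun w => X w * \1_A w].

Definition complex_expectation_on (X : T -> R[i]) (A : set T) : R[i] :=
  expectation_on (fun w => complex.Re (X w)) A +i*
  expectation_on (fun w => complex.Im (X w)) A.

End truncated_expectation.

(* [spectral_diag A] lists the eigenvalues of a normal matrix with
   multiplicity, as complex numbers; they are real when A is Hermitian. *)
Definition eigenvalues (R : realType) N (A : 'M[R[i]]_N) : seq R :=
  sort >=%O [seq complex.Re (spectral_diag A 0 i) | i <- enum 'I_N].

(* Matrices have size N.+1 so that the measure below has total mass 1. *)
Section empirical_spectral_measure.
Context (R : realType) (N : nat) (A : 'M[R[i]]_N.+1).

Definition empirical_spectral_measure : set R -> \bar R :=
  mscale (N.+1%:R^-1)%:nng
    (msum (fun k => \d_(nth 0 (eigenvalues A) k) : {measure set R -> \bar R})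
          N.+1).

HB.instance Definition _ := Measure.on empirical_spectral_measure.

Let empirical_spectral_measure_setT :
  empirical_spectral_measure [set: R] = 1%E.
Proof.
rewrite /empirical_spectral_measure /mscale /= /msum.
rewrite (eq_bigr (fun=> 1%E)); last by move=> k _; exact: diracT.
by rewrite sumEFin sumr_const card_ord -EFinM mulVf.
Qed.

HB.instance Definition _ := Measure_isProbability.Build _ _ R
  empirical_spectral_measure empirical_spectral_measure_setT.

End empirical_spectral_measure.

(* The Borel probability measure on R with distribution function
   x |-> E[mu ]-oo, x]]. It is unique if it exists, and it exists as soon as mu
   is a random measure: see [expected_measureE]. *)
Definition expected_measure d (T : measurableType d) (R : realType)
    (P : probability T R) (mu : T -> probability R R) : probability R R :=
  get [set nu : probability R R |
    forall x : R, nu `]-oo, x]%classic = (\int[P]_w mu w `]-oo, x]%classic)%E].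

Section expected_measureE.
Context d (T : measurableType d) (R : realType) (P : probability T R).
Variable mu : T -> probability R R.
Hypothesis mmu : forall B, measurable B -> measurable_fun [set: T] (mu ^~ B).

Let mean (B : set R) : \bar R := (\int[P]_w mu w B)%E.

Let mean0 : mean set0 = 0%E.
Proof.
by rewrite /mean; under eq_integral do rewrite measure0; exact: integral0.
Qed.

Let mean_ge0 B : (0 <= mean B)%E.
Proof. exact: integral_ge0. Qed.

Let mean_sigma_additive : semi_sigma_additive mean.
Proof.
move=> F mF tF mUF; rewrite /mean.
rewrite [X in _ --> X](_ : _ = (\sum_(n <oo) \int[P]_w mu w (F n))%E).
  by apply: is_cvg_ereal_nneg_natsum => n _; exact: integral_ge0.
rewrite -integral_nneseries//=; last by move=> n; exact: mmu.
by apply: eq_integral => w _; rewrite measure_semi_bigcup.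
Qed.

#[local] HB.instance Definition _ := isMeasure.Build _ _ _ mean
  mean0 mean_ge0 mean_sigma_additive.

Let mean_setT : mean [set: R] = 1%E.
Proof.
rewrite /mean; under eq_integral do rewrite probability_setT.
by rewrite integral_cst//= mul1e probability_setT.
Qed.

#[local] HB.instance Definition _ := Measure_isProbability.Build _ _ R
  mean mean_setT.

Lemma expected_measureE B : measurable B ->
  expected_measure P mu B = (\int[P]_w mu w B)%E.
Proof.
move=> mB; rewrite -/(mean B) /expected_measure.
set nu := get _.
have nuE x : nu `]-oo, x]%classic = mean `]-oo, x]%classic.
  by apply: (@getPex _ [set nu : probability R R | forall x : R,
    nu `]-oo, x]%classic = mean `]-oo, x]%classic]); exists (mean : probability R R).
pose G := [set `]-oo, x]%classic | x in [set: R]].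
apply: (measure_unique G (fun n => `]-oo, n%:R]%classic)) => //=.
- suff: (@ocitv R).-sigma.-measurable = G.-sigma.-measurable by [].
  rewrite eqEsubset; split => A.
    apply: smallest_sub; first exact: smallest_sigma_algebra.
    move=> _ [[a b] _ <-] /=; rewrite set_itv_splitD /=.
    rewrite -[X in X `\` _]setCitvl -[X in _ `\` X]setCitvl.
    have mG x : G.-sigma.-measurable `]-oo, x]%classic.
      by apply: sub_sigma_algebra; exists x.
    by apply: measurableD; apply: measurableC; exact: mG.
  apply: smallest_sub; first exact: smallest_sigma_algebra.
  by move=> _ [x _ <-]; exact: measurable_itv.
- move=> _ _ [x _ <-] [y _ <-]; exists (Num.min x y) => //.
  by apply/seteqP; split=> z /=; rewrite !in_itv /= le_min => /andP.
- by move=> n; exists n%:R.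
- rewrite -subTset => x _; exists (Num.truncn `|x|).+1 => //=.
  rewrite in_itv /= (le_trans (ler_norm _)) // ltW //; exact: truncnS_gt.
- by move=> _ [x _ <-]; exact: nuE.
- move=> n; apply: (@le_lt_trans _ _ 1%E); last exact: ltry.
  exact: probability_le1.
Qed.

End expected_measureE.

Section semicircle.
Context (R : realType).
Local Notation leb := (@lebesgue_measure R).

Definition semicircle_pdf (x : R) : R :=
  (2 * pi)^-1 * Num.sqrt (Num.max (4 - x ^+ 2) 0).

Definition semicircle (B : set R) : \bar R :=
  (\int[leb]_(x in B) (semicircle_pdf x)%:E)%E.

Lemma semicircle_pdf_ge0 x : 0 <= semicircle_pdf x.
Proof. by rewrite mulr_ge0 ?invr_ge0 ?mulr_ge0 ?pi_ge0 ?sqrtr_ge0. Qed.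

Lemma measurable_semicircle_pdf : measurable_fun [set: R] semicircle_pdf.
Proof.
apply: measurable_funM => //.
apply: (measurableT_comp (continuous_measurable_fun (@sqrt_continuous R))).
apply: measurable_maxr => //; apply: measurable_funB => //.
Qed.

Let semicircle0 : semicircle set0 = 0%E.
Proof. by rewrite /semicircle integral_set0. Qed.

Let semicircle_ge0 B : (0 <= semicircle B)%E.
Proof. by apply: integral_ge0 => x _; rewrite lee_fin semicircle_pdf_ge0. Qed.

Let semicircle_sigma_additive : semi_sigma_additive semicircle.
Proof.
move=> /= F mF tF mUF; rewrite /semicircle; apply: cvg_toP.
  apply: ereal_nondecreasing_is_cvgn => m n mn.
  apply: lee_sum_nneg_natr => // k _ _.
  by apply: integral_ge0 => x _; rewrite lee_fin semicircle_pdf_ge0.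
rewrite ge0_integral_bigcup//=.
- apply: measurable_funTS; apply: measurableT_comp => //.
  exact: measurable_semicircle_pdf.
- by move=> x _; rewrite lee_fin semicircle_pdf_ge0.
Qed.

HB.instance Definition _ := isMeasure.Build _ _ _ semicircle
  semicircle0 semicircle_ge0 semicircle_sigma_additive.

End semicircle.

Definition weakly_converges (R : realType) (nu : nat -> probability R R)
    (mu : {measure set R -> \bar R}) : Prop :=
  forall f : R -> R, continuous f -> bounded_fun f ->
    \int[nu n]_x f x @[n --> \oo] --> \int[mu]_x f x.

(* Main.v *)
(* Truncating the entries at a small level changes the expected empirical measure
   negligibly; let s_ij be the truncated second moments. For the resolvent G at
   z = i eta put k_i = - i eta G_ii and e = eta^-2. Expanding G in one independent pair
   of entries w_ij, w_ji at a time (no row is removed, nothing is centered, no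
   concentration is used) gives, on average over i and tested against 1 and conj k_i,
     1 - k_i - e k_i (sum_j s_ij k_j) ~ 0.
   If the row sums of s are close to 1 on average and e < 1, this equation is
   contractive and the k_i are close to the root kappa of 1 - kappa - e kappa^2 = 0,
   which belongs to the semicircle law. It is enough to treat eta >= 2: the Cauchy
   kernels 1 / (x^2 + eta^2) and x / (x^2 + eta^2) with eta >= 2 determine weak limits.
   Conversely, if the limit is the semicircle law, letting eta -> oo yields at first
   order that the row sums s_i have average 1, and at second order that the average
   of s_i^2 is at most 1 + o(1), so that their variance tends to 0; the third
   hypothesis is a uniform integrability that allows ignoring the large s_i. *)

From HB Require Import structures.
Require Import Defs.
From mathcomp Require Import all_boot all_order all_algebra complex spectral sesquilinear.
From mathcomp Require Import all_classical all_reals all_analysis.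
From mathcomp Require Import measurable_realfun giry ring lra.

Set Implicit Arguments.
Unset Strict Implicit.
Unset Printing Implicit Defensive.

Import Order.TTheory GRing.Theory Num.Theory.
Import numFieldNormedType.Exports.

Local Open Scope classical_set_scope.
Local Open Scope complex_scope.
Local Open Scope ring_scope.

(** * Resolvents of Hermitian matrices *)

Section Complex.
Context {R : realType}.
Implicit Types (x y : R[i]) (a b : R).

(** The equation for k_i holds only in the mean; what makes this enough is the choice of test
    functions. The span of 1 and conj k_i contains conj (k_i - kappa), which turns the equation into
    a bound on the mean of |k_i - kappa|^2, and conj (1 - k_i), which yields the mean of |1 -
    k_i|^2. Apart from the means of the entries, a pair (i, j) leaves errors that either are of
    order three in the entry or carry two off-diagonal resolvent entries. Truncation at level t
    supplies a factor t, and the identity Im G_ii = eta sum_j |G_ij|^2 keeps the sum over all pairs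
    of order N instead of N^2. In the converse direction the second order term has size e = eta^-2,
    so the average row sum must already be known with an error small compared with e. That average
    does not depend on eta; it is therefore controlled through a separate choice of eta and then
    inserted. Constants are fixed in this order: the level K beyond which a row sum is large, then
    eta, the precision, the truncation level t, and only at the end n. *)

Lemma normc_sqr x : Normc.normc x ^+ 2 = complex.Re x ^+ 2 + complex.Im x ^+ 2.
Proof. by case: x => a b /=; rewrite sqr_sqrtr// addr_ge0 ?sqr_ge0. Qed.

Lemma normc_ge0 x : 0 <= Normc.normc x.
Proof. by case: x => a b; rewrite sqrtr_ge0. Qed.

Lemma normc_conj x : Normc.normc x^*%C = Normc.normc x.
Proof. by case: x => a b /=; rewrite sqrrN. Qed.

Lemma normcB x y : Normc.normc (x - y) = Normc.normc (y - x).
Proof. by rewrite -normcN opprB. Qed.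

Lemma ge_Re_normc x : `|complex.Re x| <= Normc.normc x.
Proof.
by rewrite -ler_sqr ?nnegrE ?normr_ge0 ?normc_ge0// normc_sqr real_normK ?num_real// lerDl sqr_ge0.
Qed.

Lemma ge_Im_normc x : `|complex.Im x| <= Normc.normc x.
Proof.
by rewrite -ler_sqr ?nnegrE ?normr_ge0 ?normc_ge0// normc_sqr real_normK ?num_real// lerDr sqr_ge0.
Qed.

Lemma normc_real a : Normc.normc a%:C = `|a|.
Proof. by rewrite /= expr0n addr0 sqrtr_sqr. Qed.

Lemma mulcJ_normc x : x * x^*%C = (Normc.normc x ^+ 2)%:C.
Proof. by rewrite normc_sqr; case: x => a b /=; simpc; congr (_ +i* _); ring. Qed.

Lemma normc_sum (I : Type) (r : seq I) (P : pred I) (F : I -> R[i]) :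
  Normc.normc (\sum_(i <- r | P i) F i) <= \sum_(i <- r | P i) Normc.normc (F i).
Proof.
elim/big_rec2: _ => [|i u v _ h]; first by rewrite Normc.normc0.
by apply: le_trans (le_normcD _ _) _; rewrite lerD2l.
Qed.

Lemma Re_sum (I : Type) (r : seq I) (P : pred I) (F : I -> R[i]) :
  complex.Re (\sum_(i <- r | P i) F i) = \sum_(i <- r | P i) complex.Re (F i).
Proof. by elim/big_rec2: _ => [//|i u v _ <-]; case: (F i) => ? ?; case: v. Qed.

Lemma Im_sum (I : Type) (r : seq I) (P : pred I) (F : I -> R[i]) :
  complex.Im (\sum_(i <- r | P i) F i) = \sum_(i <- r | P i) complex.Im (F i).
Proof. by elim/big_rec2: _ => [//|i u v _ <-]; case: (F i) => ? ?; case: v. Qed.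

End Complex.

(** * The resolvent at i eta and Ward's identity *)

Section Resolvent.
Context {R : realType} {N : nat} (eta : R).
Hypothesis eta_gt0 : 0 < eta.
Implicit Types A B : 'M[R[i]]_N.

Definition adjmx m n (A : 'M[R[i]]_(m, n)) : 'M[R[i]]_(n, m) :=
  \matrix_(i, j) (A j i)^*%C.

Lemma adjmxM m n p (A : 'M[R[i]]_(m, n)) (B : 'M[R[i]]_(n, p)) :
  adjmx (A *m B) = adjmx B *m adjmx A.
Proof.
apply/matrixP => i j; rewrite !mxE rmorph_sum; apply: eq_bigr => k _ /=.
by rewrite !mxE rmorphM mulrC.
Qed.

Lemma adjmxB m n (A B : 'M[R[i]]_(m, n)) : adjmx (A - B) = adjmx A - adjmx B.
Proof. by apply/matrixP => i j; rewrite !mxE rmorphB. Qed.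

Lemma adjmxK m n (A : 'M[R[i]]_(m, n)) : adjmx (adjmx A) = A.
Proof. by apply/matrixP => i j; rewrite !mxE conjcK. Qed.

Lemma adjmx_scalar a : adjmx a%:M = (a^*%C)%:M :> 'M[R[i]]_N.
Proof. by apply/matrixP => i j; rewrite !mxE eq_sym; case: eqP => _; rewrite ?rmorph0. Qed.

Definition resolvent A : 'M[R[i]]_N := invmx (A - (0 +i* eta)%:M).

Lemma hermsymmxE A : A \is hermsymmx -> adjmx A = A.
Proof.
move=> /is_hermitianmxP; rewrite expr0 scale1r => hA.
by apply/matrixP => i j; rewrite mxE [in RHS]hA !mxE.
Qed.

Lemma hermsymmxP A : (forall i j, A i j = (A j i)^*%C) -> A \is hermsymmx.
Proof.
move=> hA; apply/is_hermitianmxP; rewrite expr0 scale1r.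
by apply/matrixP => i j; rewrite !mxE.
Qed.

Lemma hermsymmxij A i j : A \is hermsymmx -> A i j = (A j i)^*%C.
Proof. by move=> /hermsymmxE hA; rewrite -[in LHS]hA mxE. Qed.

Lemma spectral_diag_Re A i : A \is hermsymmx ->
  spectral_diag A 0 i = (complex.Re (spectral_diag A 0 i))%:C.
Proof. by move=> /hermitian_spectral_diag_real /mxOverP h; rewrite RRe_real. Qed.

Lemma shift_neq0 (a : R) : a%:C - (0 +i* eta) != 0.
Proof. by rewrite eq_complex /= sub0r oppr_eq0 [_ && (eta == 0)]andbC gt_eqF. Qed.

Lemma resolvent_spectral A : A \is hermsymmx ->
  A - (0 +i* eta)%:M =
  invmx (spectralmx A) *m diag_mx (spectral_diag A - const_mx (0 +i* eta)) *m
  spectralmx A.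
Proof.
move=> /hermitian_normalmx /orthomx_spectralP {1}->.
rewrite linearB /= mulmxBr mulmxBl; congr (_ - _).
rewrite diag_const_mx -mulmxA mul_scalar_mx -scalemxAr mulVmx ?spectral_unit//.
by rewrite scalemx1.
Qed.

Lemma resolvent_unit A : A \is hermsymmx -> A - (0 +i* eta)%:M \in unitmx.
Proof.
move=> hA; rewrite (resolvent_spectral hA) !unitmx_mul unitmx_inv spectral_unit.
rewrite andbT /= unitmxE det_diag unitfE; apply/prodf_neq0 => i _.
by rewrite !mxE (spectral_diag_Re _ hA) shift_neq0.
Qed.

Lemma mul_resolvent A : A \is hermsymmx ->
  (A - (0 +i* eta)%:M) *m resolvent A = 1%:M.
Proof. by move=> hA; rewrite mulmxV// resolvent_unit. Qed.

Lemma resolvent_mul A : A \is hermsymmx ->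
  resolvent A *m (A - (0 +i* eta)%:M) = 1%:M.
Proof. by move=> hA; rewrite mulVmx// resolvent_unit. Qed.

Lemma tr_resolvent A : A \is hermsymmx ->
  \tr (resolvent A) =
  \sum_i ((complex.Re (spectral_diag A 0 i))%:C - (0 +i* eta))^-1.
Proof.
move=> hA.
pose D : 'M[R[i]]_N := diag_mx (\row_i (spectral_diag A 0 i - (0 +i* eta))^-1).
have -> : resolvent A = invmx (spectralmx A) *m D *m spectralmx A.
  apply: (can_inj (mulKmx (resolvent_unit hA))); rewrite mul_resolvent//.
  rewrite (resolvent_spectral hA) !mulmxA mulmxK ?spectral_unit//.
  rewrite -[X in _ = X *m _]mulmxA mulmx_diag.
  rewrite [X in diag_mx X](_ : _ = const_mx 1) ?diag_const_mx ?mulmx1 ?mulVmx ?spectral_unit//.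
  apply/rowP => i; rewrite !mxE divff//.
  by rewrite (spectral_diag_Re _ hA) shift_neq0.
rewrite mxtrace_mulC mulmxA mulmxV ?spectral_unit// mul1mx mxtrace_diag.
by apply: eq_bigr => i _; rewrite mxE -spectral_diag_Re.
Qed.

Lemma resolventB A B : A \is hermsymmx -> B \is hermsymmx ->
  resolvent A - resolvent B = resolvent A *m (B - A) *m resolvent B.
Proof.
move=> hA hB; have -> : B - A = (B - (0 +i* eta)%:M) - (A - (0 +i* eta)%:M).
  by rewrite opprB addrA subrK.
by rewrite mulmxBr mulmxBl resolvent_mul// -mulmxA mul_resolvent// mulmx1 mul1mx.
Qed.

Lemma adj_resolvent_mul A : A \is hermsymmx ->
  adjmx (resolvent A) *m (A - (0 +i* - eta)%:M) = 1%:M.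
Proof.
move=> hA; have := congr1 (@adjmx N N) (mul_resolvent hA).
rewrite adjmxM adjmxB (hermsymmxE hA) adjmx_scalar.
have -> : (0 +i* eta)^*%C = 0 +i* - eta by [].
by move=> ->; apply/matrixP => i j; rewrite !mxE eq_sym conjc_nat.
Qed.

Lemma mul_adj_resolvent A : A \is hermsymmx ->
  (A - (0 +i* - eta)%:M) *m adjmx (resolvent A) = 1%:M.
Proof.
move=> hA; have := congr1 (@adjmx N N) (resolvent_mul hA).
rewrite adjmxM adjmxB (hermsymmxE hA) adjmx_scalar.
have -> : (0 +i* eta)^*%C = 0 +i* - eta by [].
by move=> ->; apply/matrixP => i j; rewrite !mxE eq_sym conjc_nat.
Qed.

(** The adjoint of the resolvent at i eta is the resolvent at - i eta, so this is the resolvent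
    identity between these two points. The version below has the factors in the other order;
    [quad_resolvent] needs both. *)
Lemma resolvent_ward A : A \is hermsymmx ->
  resolvent A - adjmx (resolvent A) =
  (0 +i* (2 * eta)) *: (resolvent A *m adjmx (resolvent A)).
Proof.
move=> hA.
rewrite -[X in X - _]mulmx1 -(mul_adj_resolvent hA).
rewrite -[X in _ - X]mul1mx -(resolvent_mul hA).
rewrite mulmxA -mulmxBl -mulmxBr.
have -> : A - (0 +i* - eta)%:M - (A - (0 +i* eta)%:M) =
          (0 +i* (2 * eta))%:M :> 'M[R[i]]_N.
  rewrite opprB addrC addrA subrK -raddfB /=; congr _%:M.
  by simpc; congr (_ +i* _); ring.
by rewrite mul_mx_scalar -scalemxAl.
Qed.

Lemma resolvent_ward' A : A \is hermsymmx ->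
  resolvent A - adjmx (resolvent A) =
  (0 +i* (2 * eta)) *: (adjmx (resolvent A) *m resolvent A).
Proof.
move=> hA.
rewrite -[X in X - _]mul1mx -(adj_resolvent_mul hA).
rewrite -[X in _ - X]mulmx1 -(mul_resolvent hA).
rewrite [in X in _ - X]mulmxA -mulmxBl -mulmxBr.
have -> : A - (0 +i* - eta)%:M - (A - (0 +i* eta)%:M) =
          (0 +i* (2 * eta))%:M :> 'M[R[i]]_N.
  rewrite opprB addrC addrA subrK -raddfB /=; congr _%:M.
  by simpc; congr (_ +i* _); ring.
by rewrite mul_mx_scalar -scalemxAl.
Qed.

Lemma Im_resolvent A i : A \is hermsymmx ->
  complex.Im (resolvent A i i) = eta * \sum_j Normc.normc (resolvent A i j) ^+ 2.
Proof.
move=> hA; have /matrixP/(_ i i)/(congr1 (@complex.Im R)) := resolvent_ward hA.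
rewrite !mxE.
have -> : \sum_j resolvent A i j * adjmx (resolvent A) j i =
          (\sum_j Normc.normc (resolvent A i j) ^+ 2)%:C.
  by rewrite rmorph_sum /=; apply: eq_bigr => j _; rewrite mxE mulcJ_normc.
by case: (resolvent A i i) => a b; simpc => /= h; lra.
Qed.

(** No operator norm enters. Ward's identity gives eta |G_ii|^2 <= Im G_ii <= |G_ii|, hence |G_ii|
    <= 1/eta, and then the whole row satisfies eta sum_j |G_ij|^2 = Im G_ii <= 1/eta. *)
Lemma normc_resolvent_le A i j : A \is hermsymmx ->
  Normc.normc (resolvent A i j) <= eta^-1.
Proof.
move=> hA; have := Im_resolvent i hA.
set S := \sum_j _ => hS.
have le_S k : Normc.normc (resolvent A i k) ^+ 2 <= S.
  by rewrite /S (bigD1 k)//= lerDl sumr_ge0// => l _; rewrite sqr_ge0.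
have g0 := normc_ge0 (resolvent A i i).
have gi : eta * Normc.normc (resolvent A i i) ^+ 2 <= Normc.normc (resolvent A i i).
  apply: (@le_trans _ _ (eta * S)); first by rewrite ler_pM2l.
  by rewrite -hS (le_trans (ler_norm _)) ?ge_Im_normc.
have gi1 : Normc.normc (resolvent A i i) <= eta^-1.
  rewrite -[_^-1]mulr1 -ler_pdivrMl ?invr_gt0// invrK.
  have [->|gn0] := eqVneq (Normc.normc (resolvent A i i)) 0; first by rewrite mulr0.
  have gp : 0 < Normc.normc (resolvent A i i) by rewrite lt_def gn0 g0.
  by rewrite -(ler_pM2r gp) mul1r -mulrA -expr2.
have : Normc.normc (resolvent A i j) ^+ 2 <= (eta^-1) ^+ 2.
  apply: le_trans (le_S j) _; rewrite -(ler_pM2l eta_gt0) expr2 mulrA divff ?gt_eqF// mul1r.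
  by rewrite -hS (le_trans _ gi1)// (le_trans (ler_norm _)) ?ge_Im_normc.
by rewrite ler_sqr ?nnegrE ?normc_ge0 ?invr_ge0 ?(ltW eta_gt0).
Qed.

Lemma sum_normc_resolvent_le A i : A \is hermsymmx ->
  \sum_j Normc.normc (resolvent A i j) ^+ 2 <= (eta^-1) ^+ 2.
Proof.
move=> hA; rewrite -(ler_pM2l eta_gt0) expr2 mulrA divff ?gt_eqF// mul1r.
rewrite -Im_resolvent// (le_trans _ (normc_resolvent_le i i hA))//.
by rewrite (le_trans (ler_norm _)) ?ge_Im_normc.
Qed.

(* The normalised diagonal resolvent entry -i eta G_ii takes its values in the disc |k|^2 <= Re k. *)
Definition diag_resolvent A i : R[i] := (0 +i* - eta) * resolvent A i i.

Lemma normc_diag_resolvent_sqr_le A i : A \is hermsymmx ->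
  Normc.normc (diag_resolvent A i) ^+ 2 <= complex.Re (diag_resolvent A i).
Proof.
move=> hA; rewrite /diag_resolvent Normc.normcM.
have -> : complex.Re ((0 +i* - eta) * resolvent A i i) = eta * complex.Im (resolvent A i i).
  by case: (resolvent A i i) => a b; simpc => /=; ring.
rewrite Im_resolvent// exprMn normc_sqr /= expr0n add0r sqrrN mulrA -expr2.
rewrite ler_pM2l ?exprn_gt0// (bigD1 i)//= lerDl sumr_ge0// => l _.
by rewrite sqr_ge0.
Qed.

End Resolvent.

(** * Rank one and single pair perturbations of the resolvent *)

Section Perturbation.
Context {R : realType} {N : nat} (eta : R).
Hypothesis eta_gt0 : 0 < eta.
Implicit Types A B : 'M[R[i]]_N.

Definition rank_one (c : R) (v : 'cV[R[i]]_N) : 'M[R[i]]_N :=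
  c%:C *: (v *m adjmx v).

Lemma hermsymmx_rank_one A c v : A \is hermsymmx ->
  A + rank_one c v \is hermsymmx.
Proof.
move=> hA; apply: hermsymmxP => i j; rewrite !mxE !big_ord1 !mxE.
rewrite rmorphD /= -(hermsymmxij i j hA); congr (_ + _).
by case: (v i ord0) => a b; case: (v j ord0) => a' b'; simpc; congr (_ +i* _); ring.
Qed.

Lemma quad_resolvent A (v : 'cV[R[i]]_N) : A \is hermsymmx ->
  complex.Im ((adjmx v *m resolvent eta A *m v) 0 0) =
    eta * \sum_i Normc.normc ((resolvent eta A *m v) i 0) ^+ 2 /\
  complex.Im ((adjmx v *m resolvent eta A *m v) 0 0) =
    eta * \sum_i Normc.normc ((adjmx v *m resolvent eta A) 0 i) ^+ 2.
Proof.
move=> hA; set G := resolvent eta A; set q := (adjmx v *m G *m v) 0 0.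
have qJ : (adjmx v *m adjmx G *m v) 0 0 = q^*%C.
  have -> : adjmx v *m adjmx G *m v = adjmx (adjmx v *m G *m v).
    by rewrite !adjmxM adjmxK mulmxA.
  by rewrite mxE.
have BE (X Y : 'M[R[i]]_1) : (X - Y) 0 0 = X 0 0 - Y 0 0 by rewrite !mxE.
have ZE a (X : 'M[R[i]]_1) : (a *: X) 0 0 = a * X 0 0 by rewrite mxE.
have E1 : q - q^*%C = (0 +i* (2 * eta)) *
    (\sum_i Normc.normc ((G *m v) i 0) ^+ 2)%:C.
  have /(congr1 (fun X => (adjmx v *m X *m v) 0 0)) := resolvent_ward' eta_gt0 hA.
  rewrite mulmxBr mulmxBl -scalemxAr -scalemxAl BE ZE qJ => ->.
  congr (_ * _).
  rewrite (_ : _ *m _ *m v = adjmx (G *m v) *m (G *m v)) ?mxE ?rmorph_sum; last by rewrite adjmxM !mulmxA.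
  apply: eq_bigr => i _.
  by rewrite [adjmx _ _ _]mxE mulrC /= -mulcJ_normc.
have E2 : q - q^*%C = (0 +i* (2 * eta)) *
    (\sum_i Normc.normc ((adjmx v *m G) 0 i) ^+ 2)%:C.
  have /(congr1 (fun X => (adjmx v *m X *m v) 0 0)) := resolvent_ward eta_gt0 hA.
  rewrite mulmxBr mulmxBl -scalemxAr -scalemxAl BE ZE qJ => ->.
  congr (_ * _).
  rewrite (_ : _ *m _ *m v = (adjmx v *m G) *m adjmx (adjmx v *m G)) ?mxE ?rmorph_sum; last by rewrite adjmxM adjmxK !mulmxA.
  apply: eq_bigr => i _.
  by rewrite [adjmx _ _ _]mxE /= -mulcJ_normc.
move: (congr1 (@complex.Im R) E1) (congr1 (@complex.Im R) E2).
by case: (q) => a b; simpc => /= h1 h2; split; lra.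
Qed.

(** By the Sherman-Morrison formula the trace changes by - c (v^* G G v) / (1 + c q), where q = v^*
    G v. The numerator is at most |c| Im q / eta by [quad_resolvent], and the denominator is at
    least |c| Im q in modulus, so neither c nor v survives in the bound. *)
Lemma tr_resolvent_rank_one A c v : A \is hermsymmx ->
  Normc.normc (\tr (resolvent eta (A + rank_one c v)) - \tr (resolvent eta A))
  <= eta^-1.
Proof.
move=> hA; have hB := hermsymmx_rank_one c v hA.
set B := A + rank_one c v; set G := resolvent eta A; set G' := resolvent eta B.
have [hq1 hq2] := quad_resolvent v hA; rewrite -/G in hq1 hq2.
set q := (adjmx v *m G *m v) 0 0 in hq1 hq2.
pose q' := (adjmx v *m G' *m v) 0 0.
have G'v : G' *m v = (1 - c%:C * q') *: (G *m v).
  have := resolventB eta_gt0 hA hB; rewrite -/G -/G' addrAC subrr add0r.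
  move=> /(congr1 (fun X => X *m v)); rewrite mulmxBl /rank_one.
  rewrite -scalemxAr -!scalemxAl !mulmxA.
  have -> : G *m v *m adjmx v *m G' *m v = G *m v *m (adjmx v *m G' *m v) by rewrite !mulmxA.
  rewrite [adjmx v *m G' *m v]mx11_scalar -/q' mul_mx_scalar => h.
  rewrite scalerBl scale1r -scalerA -h.
  by rewrite opprB addrC subrK.
(* The factor 1 - c q' is the inverse of 1 + c q; stated as a product, this requires no prior proof
   that 1 + c q is nonzero. *)
have qq' : (1 + c%:C * q) * (1 - c%:C * q') = 1.
  have : q' = (1 - c%:C * q') * q.
    by rewrite {1}/q' -mulmxA G'v -scalemxAr mxE mulmxA.
  by move=> h; rewrite mulrDl mul1r -mulrA [q * _]mulrC -h subrK.
have trE : \tr G' - \tr G = - (c%:C * (1 - c%:C * q')) *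
    \sum_i (adjmx v *m G) 0 i * (G *m v) i 0.
  rewrite -raddfB /= (resolventB eta_gt0 hB hA) -/G -/G' opprD addrA subrr add0r.
  rewrite /rank_one mulmxN mulNmx -scalemxAr -scalemxAl raddfN /= linearZ /=.
  have -> : G' *m (v *m adjmx v) *m G = (1 - c%:C * q') *: (G *m v *m (adjmx v *m G)).
    by rewrite mulmxA G'v -!scalemxAl -!mulmxA.
  by rewrite mxtraceZ mxtrace_mulC trace_mx11 mxE !mulNr mulrA.
set S := \sum_i _ in trE.
have leS : eta * Normc.normc S <= complex.Im q.
  have : Normc.normc S <= \sum_i (Normc.normc ((adjmx v *m G) 0 i) ^+ 2 / 2 +
      Normc.normc ((G *m v) i 0) ^+ 2 / 2).
    apply: le_trans (normc_sum _ _ _) _; apply: ler_sum => i _.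
    rewrite Normc.normcM; set a := Normc.normc _; set b := Normc.normc _.
    by have := sqr_ge0 (a - b); rewrite sqrrB; lra.
  rewrite big_split /= -!mulr_suml => h.
  have := ler_wpM2l (ltW eta_gt0) h.
  by rewrite mulrDr !mulrA -hq2 -hq1 -splitr.
have c1q : `|c| * complex.Im q <= Normc.normc (1 + c%:C * q).
  apply: le_trans (ge_Im_normc _); case: (q) => a b; simpc => /=.
  by rewrite normrM ler_wpM2l// ler_norm.
have n1 : Normc.normc (1 + c%:C * q) * Normc.normc (1 - c%:C * q') = 1.
  by rewrite -Normc.normcM qq' Normc.normc1.
rewrite trE Normc.normcM normcN Normc.normcM normc_real.
rewrite -(ler_pM2l eta_gt0) divff ?gt_eqF//.
apply: (@le_trans _ _ (`|c| * complex.Im q * Normc.normc (1 - c%:C * q'))).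
  rewrite [leLHS](_ : _ = `|c| * (eta * Normc.normc S) * Normc.normc (1 - c%:C * q')); last by ring.
  by rewrite ler_wpM2r ?normc_ge0// ler_wpM2l.
by rewrite -n1 ler_wpM2r ?normc_ge0.
Qed.

Definition set_pair A i j (x : R[i]) : 'M[R[i]]_N :=
  \matrix_(k, l) if (k == i) && (l == j) then x
                 else if (k == j) && (l == i) then x^*%C else A k l.

Lemma hermsymmx_set_pair A i j x : A \is hermsymmx -> i != j ->
  set_pair A i j x \is hermsymmx.
Proof.
move=> hA ij; apply: hermsymmxP => k l; rewrite !mxE.
rewrite [(l == i) && _]andbC [(l == j) && _]andbC.
case: (boolP ((k == i) && (l == j))) => [/andP[/eqP-> /eqP->]|_].
  by rewrite (negPf ij) /= conjcK.
by case: ifP => // _; exact: hermsymmxij.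
Qed.

Lemma set_pairE A i j x : A \is hermsymmx -> i != j ->
  set_pair A i j x = A + ((x - A i j) *: delta_mx i j + (x - A i j)^*%C *: delta_mx j i).
Proof.
move=> hA ij; apply/matrixP => k l; rewrite !mxE.
case: (boolP ((k == i) && (l == j))) => [/andP[/eqP-> /eqP->]|_].
  by rewrite (negPf ij) /= mulr1 mulr0 addr0 addrC subrK.
case: ifP => [/andP[/eqP-> /eqP->]|_] /=; last by rewrite !mulr0 !addr0.
by rewrite mulr0 mulr1 add0r rmorphB /= -(hermsymmxij j i hA) addrC subrK.
Qed.

(** Polarisation: with y the change of the entry, the squares of y e_i + e_j and y e_i - e_j have
    the same diagonal part, and half their difference is the Hermitian cross term. *)
Lemma set_pair_rank_one A i j x : A \is hermsymmx -> i != j ->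
  set_pair A i j x =
  A + rank_one 2^-1 ((x - A i j) *: delta_mx i 0 + delta_mx j 0)
    + rank_one (- 2^-1) ((x - A i j) *: delta_mx i 0 - delta_mx j 0).
Proof.
move=> hA ij; rewrite set_pairE// -addrA; congr (_ + _).
set y := x - A i j; apply/matrixP => k l; rewrite !mxE !big_ord1 !mxE !eqxx !andbT.
have two : (2 : R)^-1 * 2 = 1 by rewrite mulVf.
case: (k == i); case: (k == j); case: (l == i); case: (l == j) => /=;
  case: (y) => a b; simpc => /=; rewrite /= ?(mulr1, mulr0, mul1r, mul0r, addr0, add0r, subr0, oppr0);
  congr (_ +i* _); lra.
Qed.

Lemma tr_resolvent_set_pair A i j x : A \is hermsymmx -> i != j ->
  Normc.normc (\tr (resolvent eta (set_pair A i j x)) - \tr (resolvent eta A))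
  <= eta^-1 * 2.
Proof.
move=> hA ij; rewrite set_pair_rank_one//.
set A1 := A + _; rewrite -(subrKA (\tr (resolvent eta A1))).
rewrite mulrDr mulr1; apply: le_trans (le_normcD _ _) _; apply: lerD.
  by apply: tr_resolvent_rank_one; exact: hermsymmx_rank_one.
exact: tr_resolvent_rank_one.
Qed.

(** A diagonal entry is corrected by one rank one perturbation and an off-diagonal pair by two. As
    the pair counts for two entries, each changed entry costs 1/eta. Counting entries instead of the
    rank suffices, because the mean number of entries changed by truncation is o(N). *)
Lemma tr_resolvent_diff A B : A \is hermsymmx -> B \is hermsymmx ->
  Normc.normc (\tr (resolvent eta A) - \tr (resolvent eta B)) <=
  eta^-1 * #|[set ij : 'I_N * 'I_N | A ij.1 ij.2 != B ij.1 ij.2]%SET|%:R.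
Proof.
move=> + hB; set D := fun A => [set ij : 'I_N * 'I_N | A ij.1 ij.2 != B ij.1 ij.2]%SET.
rewrite -/(D A); move: {2}#|D A|.+1 (ltnSn #|D A|) => m.
elim: m A => // m IH A; rewrite ltnS => Dm hA.
have [D0|[[i j] ij]] := set_0Vmem (D A).
  have -> : A = B.
    apply/matrixP => i j; apply/eqP; apply: contraT => ij.
    have : (i, j) \in D A by rewrite inE.
    by rewrite D0 inE.
  by rewrite subrr Normc.normc0 mulr_ge0// invr_ge0 ltW.
have step A1 (k : nat) : A1 \is hermsymmx -> (0 < k)%N -> (#|D A1| + k <= #|D A|)%N ->
    Normc.normc (\tr (resolvent eta A1) - \tr (resolvent eta A)) <= eta^-1 * k%:R ->
    Normc.normc (\tr (resolvent eta A) - \tr (resolvent eta B)) <= eta^-1 * #|D A|%:R.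
  move=> hA1 k0 cA h; rewrite -(subrKA (\tr (resolvent eta A1))).
  apply: le_trans (le_normcD _ _) _.
  apply: (@le_trans _ _ (eta^-1 * (#|D A1| + k)%:R)); last first.
    by rewrite ler_pM2l ?invr_gt0// ler_nat.
  rewrite natrD mulrDr addrC lerD//; last by rewrite normcB.
  apply: IH => //; apply: leq_trans Dm; apply: leq_trans cA.
  by rewrite -addn1 leq_add2l.
have [eij|nij] := eqVneq i j.
  subst j; pose c := complex.Re (B i i - A i i).
  have cE : c%:C = B i i - A i i.
    have := hermsymmxij i i hA; have := hermsymmxij i i hB; rewrite /c.
    case: (A i i) => a b; case: (B i i) => a' b' [h1] [h2]; simpc.
    by congr (_ +i* _); lra.
  apply: (step (A + rank_one c (delta_mx i 0)) 1%N) => //.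
  - exact: hermsymmx_rank_one.
  - rewrite addn1; apply: proper_card; apply/properP; split.
      apply/fintype.subsetP => -[k l]; rewrite !inE !mxE big_ord1 !mxE !eqxx !andbT /=.
      case: (k == i) / eqP => [->|]; last by rewrite mul0r mulr0 addr0.
      case: (l == i) / eqP => [->|]; last by rewrite conjc0 !mulr0 addr0.
      by rewrite conjc1 !mulr1 cE addrC subrK eqxx.
    exists (i, i) => //; rewrite !inE !mxE big_ord1 !mxE !eqxx !andbT /=.
    by rewrite oppr0 mul1r (mulr1 c%:C) cE addrC subrK eqxx.
  - by rewrite mulr1; exact: tr_resolvent_rank_one.
have Bij k l : set_pair A i j (B i j) k l =
    if ((k == i) && (l == j)) || ((k == j) && (l == i)) then B k l else A k l.
  rewrite mxE; case: (boolP ((k == i) && (l == j))) => [/andP[/eqP-> /eqP->]//|_ /=].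
  by case: ifP => // /andP[/eqP-> /eqP->]; rewrite [RHS]hermsymmxij.
have ji : (j, i) \in D A.
  move: ij; rewrite !inE /= (hermsymmxij j i hA) (hermsymmxij j i hB).
  by apply: contraNneq => /(congr1 (@conjc R)); rewrite !conjcK => ->.
apply: (step (set_pair A i j (B i j)) 2%N) => //.
- exact: hermsymmx_set_pair.
- have sub : D (set_pair A i j (B i j)) \subset D A :\ (i, j) :\ (j, i).
    apply/fintype.subsetP => -[k l] h; rewrite !finset.in_setD1; move: h.
    rewrite !inE Bij /= !xpair_eqE.
    by case: ifP => [_|/norP[-> ->]//]; rewrite ?eqxx// ?inE.
  apply: leq_trans (leq_add (subset_leq_card sub) (leqnn _)) _.
  rewrite (cardsD1 (i, j) (D A)) ij (cardsD1 (j, i) (D A :\ (i, j))).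
  have -> : (j, i) \in D A :\ (i, j).
    by rewrite in_setD1 ji andbT xpair_eqE negb_and eq_sym nij.
  by rewrite addnA addnC.
- exact: tr_resolvent_set_pair.
Qed.

(* Zeroing one pair of entries gives the matrix whose resolvent is independent of that pair. *)
Lemma resolvent_set_pair A i j k l : A \is hermsymmx -> i != j ->
  let G := resolvent eta A in let G0 := resolvent eta (set_pair A i j 0) in
  G k l = G0 k l - (G0 k i * A i j * G j l + G0 k j * A j i * G i l).
Proof.
move=> hA ij G G0; have h0 := hermsymmx_set_pair 0 hA ij.
have := resolventB eta_gt0 h0 hA; rewrite -/G -/G0 (set_pairE 0 hA ij).
rewrite sub0r opprD addrA subrr add0r.
move=> /matrixP/(_ k l); rewrite mulmxN mulNmx.
rewrite mulmxDr mulmxDl.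
rewrite -!scalemxAr -!scalemxAl !mxE => E.
have dE a b : \sum_c (G0 *m delta_mx a b) k c * G c l = G0 k a * G b l.
  rewrite (bigD1 b)//= big1 ?addr0 => [|c cb].
    rewrite mxE (bigD1 a)//= big1 ?addr0 => [|c ca]; rewrite !mxE ?eqxx ?mulr1//.
    by rewrite (negPf ca) mulr0.
  by rewrite mxE big1 ?mul0r// => d _; rewrite mxE (negPf cb) andbF mulr0.
have {}E : G0 k l - G k l = A i j * (G0 k i * G j l) + A j i * (G0 k j * G i l).
  rewrite E !dE rmorphN /= -(hermsymmxij j i hA) !mulNr.
  by rewrite -opprD opprK.
have -> : G k l = G0 k l - (G0 k l - G k l) by rewrite opprB addrC subrK.
by rewrite E; congr (_ - (_ + _)); ring.
Qed.

End Perturbation.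

(** * Bounded random variables *)

Section BoundedMean.
Context d (T : measurableType d) (R : realType) (P : probability T R).
Implicit Types f g : T -> R.

(** The bound holds at every point, so that f is integrable for all probability measures at once:
    test functions on the line are later integrated against random measures, their expectation and
    the semicircle law. *)
Definition bounded_measurable f :=
  measurable_fun [set: T] f /\ exists M, forall w, `|f w| <= M.

Definition mean f : R := \int[P]_w f w.

Lemma bmeas_integrable f : bounded_measurable f -> P.-integrable [set: T] (EFin \o f).
Proof.
move=> [mf [M hM]]; apply: measurable_bounded_integrable => //.
  by rewrite -ge0_fin_numE// fin_num_measure.
exists M; split; first exact: num_real.
by move=> x Mx w _ /=; rewrite (le_trans (hM w))// ltW.
Qed.

Lemma bmeas_cst c : bounded_measurable (fun=> c).
Proof. by split; [exact: measurable_cst|exists `|c|]. Qed.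

Lemma bmeasD f g : bounded_measurable f -> bounded_measurable g ->
  bounded_measurable (fun w => f w + g w).
Proof.
move=> [mf [M hM]] [mg [L hL]]; split; first exact: measurable_funD.
by exists (M + L) => w; apply: le_trans (ler_normD _ _) _; apply: lerD.
Qed.

Lemma bmeasM f g : bounded_measurable f -> bounded_measurable g ->
  bounded_measurable (fun w => f w * g w).
Proof.
move=> [mf [M hM]] [mg [L hL]]; split; first exact: measurable_funM.
by exists (M * L) => w; rewrite normrM; apply: ler_pM.
Qed.

Lemma bmeasN f : bounded_measurable f -> bounded_measurable (fun w => - f w).
Proof.
move=> [mf [M hM]]; split; first exact: measurableT_comp.
by exists M => w; rewrite normrN.
Qed.

Lemma bmeasB f g : bounded_measurable f -> bounded_measurable g ->
  bounded_measurable (fun w => f w - g w).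
Proof. by move=> bf bg; apply: bmeasD => //; exact: bmeasN. Qed.

Lemma bmeasX f n : bounded_measurable f -> bounded_measurable (fun w => f w ^+ n).
Proof.
move=> bf; elim: n => [|n IH]; first exact: bmeas_cst.
by under eq_fun do rewrite exprS; exact: bmeasM.
Qed.

Lemma bmeas_norm f : bounded_measurable f -> bounded_measurable (fun w => `|f w|).
Proof.
move=> [mf [M hM]]; split; first exact: measurableT_comp.
by exists M => w; rewrite normr_id.
Qed.

Lemma bmeas_sum (I : Type) (r : seq I) (Q : pred I) (F : I -> T -> R) :
  (forall i, Q i -> bounded_measurable (F i)) ->
  bounded_measurable (fun w => \sum_(i <- r | Q i) F i w).
Proof.
move=> h; elim: r => [|i r IH].
  by under eq_fun do rewrite big_nil; exact: bmeas_cst.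
have [Qi|Qi] := boolP (Q i); last by under eq_fun do rewrite big_cons (negPf Qi).
under eq_fun do rewrite big_cons Qi.
by apply: bmeasD => //; exact: h.
Qed.

Lemma bmeas_indic (A : set T) : measurable A -> bounded_measurable (\1_A : T -> R).
Proof.
move=> mA; split; first exact: measurable_indic.
by exists 1 => w; rewrite indicE; case: (_ \in _); rewrite ?normr1 ?normr0.
Qed.

Lemma mean_cst c : mean (fun=> c) = c.
Proof.
by rewrite /mean Rintegral_cst// [X in fine X](_ : _ = 1%E) ?mulr1//; exact: probability_setT.
Qed.

Lemma meanD f g : bounded_measurable f -> bounded_measurable g ->
  mean (fun w => f w + g w) = mean f + mean g.
Proof. by move=> bf bg; rewrite /mean RintegralD//; exact: bmeas_integrable. Qed.

Lemma meanB f g : bounded_measurable f -> bounded_measurable g ->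
  mean (fun w => f w - g w) = mean f - mean g.
Proof. by move=> bf bg; rewrite /mean RintegralB//; exact: bmeas_integrable. Qed.

Lemma meanZ c f : bounded_measurable f -> mean (fun w => c * f w) = c * mean f.
Proof. by move=> bf; rewrite /mean RintegralZl//; exact: bmeas_integrable. Qed.

Lemma meanN f : bounded_measurable f -> mean (fun w => - f w) = - mean f.
Proof.
by move=> bf; under [LHS]eq_Rintegral do rewrite -mulN1r; rewrite -/(mean _) meanZ// mulN1r.
Qed.

Lemma mean_sum (I : Type) (r : seq I) (Q : pred I) (F : I -> T -> R) :
  (forall i, Q i -> bounded_measurable (F i)) ->
  mean (fun w => \sum_(i <- r | Q i) F i w) = \sum_(i <- r | Q i) mean (F i).
Proof.
move=> h; elim: r => [|i r IH].
  rewrite big_nil -[RHS](mean_cst 0); congr mean.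
  by apply/funext => w; rewrite big_nil.
rewrite big_cons; have [Qi|Qi] := ifPn; last first.
  by rewrite -IH; congr mean; apply/funext => w; rewrite big_cons (negPf Qi).
rewrite -IH -meanD; [|exact: h|exact: bmeas_sum].
by congr mean; apply/funext => w; rewrite big_cons Qi.
Qed.

Lemma le_mean f g : bounded_measurable f -> bounded_measurable g ->
  (forall w, f w <= g w) -> mean f <= mean g.
Proof.
by move=> bf bg fg; apply: le_Rintegral => //; exact: bmeas_integrable.
Qed.

Lemma mean_ge0 f : (forall w, 0 <= f w) -> 0 <= mean f.
Proof. by move=> f0; apply: Rintegral_ge0. Qed.

Lemma ler_norm_mean f : bounded_measurable f -> `|mean f| <= mean (fun w => `|f w|).
Proof. by move=> bf; apply: le_normr_Rintegral => //; exact: bmeas_integrable. Qed.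

Lemma mean_le f c : bounded_measurable f -> (forall w, f w <= c) -> mean f <= c.
Proof. by move=> bf h; rewrite -(mean_cst c) le_mean//; exact: bmeas_cst. Qed.

Lemma mean_indic (A : set T) : measurable A -> mean (\1_A) = fine (P A).
Proof. by move=> mA; rewrite /mean /Rintegral integral_indic// setIT. Qed.

(* Expanding (|f| - mean|f|)^2 avoids Hoelder's inequality. *)
Lemma sqr_mean_le f : bounded_measurable f -> mean f ^+ 2 <= mean (fun w => f w ^+ 2).
Proof.
move=> bf; have b2 := bmeasX 2 bf.
have : 0 <= mean (fun w => (f w - mean f) ^+ 2) by apply: mean_ge0 => w; exact: sqr_ge0.
have -> : mean (fun w => (f w - mean f) ^+ 2) =
    mean (fun w => (f w ^+ 2 - (2 * mean f) * f w) + mean f ^+ 2).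
  by congr mean; apply/funext => w; ring.
rewrite meanD; [|by apply: bmeasB => //; apply: bmeasM => //; exact: bmeas_cst|exact: bmeas_cst].
rewrite meanB//; last by apply: bmeasM => //; exact: bmeas_cst.
by rewrite meanZ// mean_cst; lra.
Qed.

(** The law of (f, g) and the product of the two laws agree on rectangles, hence everywhere, and
    Fubini's theorem splits the integral. *)
Lemma mean_indep f g : bounded_measurable f -> bounded_measurable g ->
  (forall A B : set R, measurable A -> measurable B ->
    P (f @^-1` A `&` g @^-1` B) = (P (f @^-1` A) * P (g @^-1` B))%E) ->
  mean (fun w => f w * g w) = mean f * mean g.
Proof.
move=> bf bg fg; have [mf _] := bf; have [mg _] := bg.
pose F : {mfun T >-> R} := HB.pack f (isMeasurableFun.Build _ _ _ _ f mf).
pose G : {mfun T >-> R} := HB.pack g (isMeasurableFun.Build _ _ _ _ g mg).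
pose h w := (f w, g w).
have mh : measurable_fun [set: T] h by exact: measurable_fun_pair.
pose H : {mfun T >-> _} := HB.pack h (isMeasurableFun.Build _ _ _ _ h mh).
pose m1 := distribution P F; pose m2 := distribution P G.
have m12 X : measurable X -> (m1 \x m2)%E X = distribution P H X.
  by move=> mX; apply: product_measure_unique => // A B mA mB; exact: fg.
have mz : measurable_fun [set: R * R] (fun z : R * R => (z.1 * z.2)%:E).
  apply/measurable_EFinP; apply: measurable_funM; [exact: measurable_fst|exact: measurable_snd].
have iH : P.-integrable [set: T] ((fun z : R * R => (z.1 * z.2)%:E) \o H).
  exact: (bmeas_integrable (bmeasM bf bg)).
have iHz : (distribution P H).-integrable [set: R * R] (fun z : R * R => (z.1 * z.2)%:E).
  by apply: integrable_pushforward => //; rewrite preimage_setT.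
have imz : (m1 \x m2)%E.-integrable [set: R * R] (fun z : R * R => (z.1 * z.2)%:E).
  apply/integrableP; split => //; have /integrableP[_] := iHz.
  by rewrite (@eq_measure_integral _ _ _ _ (m1 \x m2)%E)// => A mA _; exact/esym/m12.
have mfE : (\int[m1]_x x%:E)%E = (mean f)%:E.
  rewrite /m1 integral_distribution//; last exact: bmeas_integrable.
  by rewrite /mean /Rintegral fineK//; apply: integrable_fin_num => //; exact: bmeas_integrable.
have mgE : (\int[m2]_x x%:E)%E = (mean g)%:E.
  rewrite /m2 integral_distribution//; last exact: bmeas_integrable.
  by rewrite /mean /Rintegral fineK//; apply: integrable_fin_num => //; exact: bmeas_integrable.
have i2 : m2.-integrable [set: R] (EFin : R -> \bar R).
  apply: integrable_pushforward => //; rewrite preimage_setT; exact: bmeas_integrable.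
have i1 : m1.-integrable [set: R] (EFin : R -> \bar R).
  apply: integrable_pushforward => //; rewrite preimage_setT; exact: bmeas_integrable.
rewrite {1}/mean /Rintegral.
have -> : (\int[P]_x (f x * g x)%:E)%E = (mean f * mean g)%:E => //.
transitivity (\int[distribution P H]_z (z.1 * z.2)%:E)%E.
  by rewrite integral_distribution.
rewrite (@eq_measure_integral _ _ _ _ (m1 \x m2)%E); last by move=> A mA _; exact/esym/m12.
rewrite -integral12_prod_meas1//=.
transitivity (\int[m1]_x ((mean g)%:E * x%:E))%E; last by rewrite integralZl// mfE muleC.
apply: eq_integral => x _.
transitivity (\int[m2]_y (x%:E * y%:E))%E; last by rewrite integralZl// mgE muleC.
by apply: eq_integral => y _; rewrite EFinM.
Qed.

End BoundedMean.

(** * Measurability of complex functions and of the resolvent *)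

Section ComplexMeasurable.
Context d (T : measurableType d) (R : realType).
Implicit Types f g : T -> R[i].

Definition cmeas f := measurable_fun [set: T] (fun w => complex.Re (f w)) /\
                      measurable_fun [set: T] (fun w => complex.Im (f w)).

Lemma cmeas_cst c : cmeas (fun=> c).
Proof. by split; exact: measurable_cst. Qed.

Lemma cmeasD f g : cmeas f -> cmeas g -> cmeas (fun w => f w + g w).
Proof.
move=> [f1 f2] [g1 g2]; split.
  rewrite (_ : (fun w => _) = (fun w => complex.Re (f w) + complex.Re (g w))); first exact: measurable_funD.
  by apply/funext => w; case: (f w); case: (g w).
rewrite (_ : (fun w => _) = (fun w => complex.Im (f w) + complex.Im (g w))); first exact: measurable_funD.
by apply/funext => w; case: (f w); case: (g w).
Qed.

Lemma cmeasN f : cmeas f -> cmeas (fun w => - f w).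
Proof.
move=> [f1 f2]; split.
  rewrite (_ : (fun w => _) = (fun w => - complex.Re (f w))); first exact: measurableT_comp.
  by apply/funext => w; case: (f w).
rewrite (_ : (fun w => _) = (fun w => - complex.Im (f w))); first exact: measurableT_comp.
by apply/funext => w; case: (f w).
Qed.

Lemma cmeasB f g : cmeas f -> cmeas g -> cmeas (fun w => f w - g w).
Proof. by move=> mf mg; apply: cmeasD => //; exact: cmeasN. Qed.

Lemma cmeasM f g : cmeas f -> cmeas g -> cmeas (fun w => f w * g w).
Proof.
move=> [f1 f2] [g1 g2]; split.
  rewrite (_ : (fun w => _) = (fun w => complex.Re (f w) * complex.Re (g w) -
      complex.Im (f w) * complex.Im (g w))).
    by apply: measurable_funB; exact: measurable_funM.
  by apply/funext => w; case: (f w); case: (g w).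
rewrite (_ : (fun w => _) = (fun w => complex.Re (f w) * complex.Im (g w) +
    complex.Im (f w) * complex.Re (g w))).
  by apply: measurable_funD; exact: measurable_funM.
by apply/funext => w; case: (f w); case: (g w).
Qed.

Lemma cmeas_conj f : cmeas f -> cmeas (fun w => (f w)^*%C).
Proof.
move=> [f1 f2]; split.
  rewrite (_ : (fun w => _) = (fun w => complex.Re (f w)))//.
  by apply/funext => w; case: (f w).
rewrite (_ : (fun w => _) = (fun w => - complex.Im (f w))); first exact: measurableT_comp.
by apply/funext => w; case: (f w).
Qed.

Lemma cmeas_sum (I : Type) (r : seq I) (Q : pred I) (F : I -> T -> R[i]) :
  (forall i, cmeas (F i)) -> cmeas (fun w => \sum_(i <- r | Q i) F i w).
Proof.
move=> h; elim: r => [|i r IH].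
  by under eq_fun do rewrite big_nil; exact: cmeas_cst.
have [Qi|Qi] := boolP (Q i); last by under eq_fun do rewrite big_cons (negPf Qi).
under eq_fun do rewrite big_cons Qi.
exact: cmeasD.
Qed.

Lemma cmeas_prod (I : Type) (r : seq I) (Q : pred I) (F : I -> T -> R[i]) :
  (forall i, cmeas (F i)) -> cmeas (fun w => \prod_(i <- r | Q i) F i w).
Proof.
move=> h; elim: r => [|i r IH].
  by under eq_fun do rewrite big_nil; exact: cmeas_cst.
have [Qi|Qi] := boolP (Q i); last by under eq_fun do rewrite big_cons (negPf Qi).
under eq_fun do rewrite big_cons Qi.
exact: cmeasM.
Qed.

Lemma measurable_invr : measurable_fun [set: R] (fun x : R => x^-1).
Proof.
rewrite -(setvU [set (0 : R)]); apply/measurable_funU => //.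
  exact: measurableC.
split; last exact: measurable_fun_set1.
apply: open_continuous_measurable_fun.
  by apply: closed_openC; exact: closed_eq.
by move=> x; rewrite inE /= => x0; apply: inv_continuous; apply/eqP.
Qed.

Lemma measurable_invr_comp (h : T -> R) : measurable_fun [set: T] h ->
  measurable_fun [set: T] (fun w => (h w)^-1).
Proof. by move=> mh; exact: (measurableT_comp measurable_invr). Qed.

Lemma cmeas_inv f : cmeas f -> cmeas (fun w => (f w)^-1).
Proof.
move=> [f1 f2].
have mn : measurable_fun [set: T]
    (fun w => (complex.Re (f w) ^+ 2 + complex.Im (f w) ^+ 2)^-1).
  by apply: measurable_invr_comp; apply: measurable_funD; exact: measurable_funX.
split.
  rewrite (_ : (fun w => _) = (fun w => complex.Re (f w) *
    (complex.Re (f w) ^+ 2 + complex.Im (f w) ^+ 2)^-1)); first exact: measurable_funM.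
  by apply/funext => w; case: (f w).
rewrite (_ : (fun w => _) = (fun w => - (complex.Im (f w) *
  (complex.Re (f w) ^+ 2 + complex.Im (f w) ^+ 2)^-1))).
  by apply: measurableT_comp => //; exact: measurable_funM.
by apply/funext => w; case: (f w).
Qed.

Lemma measurable_normc f : cmeas f -> measurable_fun [set: T] (fun w => Normc.normc (f w)).
Proof.
move=> [f1 f2].
rewrite (_ : (fun w => _) = (fun w => Num.sqrt (complex.Re (f w) ^+ 2 + complex.Im (f w) ^+ 2))).
  apply: (measurableT_comp (continuous_measurable_fun (@sqrt_continuous R))).
  by apply: measurable_funD; exact: measurable_funX.
by apply/funext => w; case: (f w).
Qed.

Lemma cmeas_if f g (b : T -> bool) : measurable_fun [set: T] b ->
  cmeas f -> cmeas g -> cmeas (fun w => if b w then f w else g w).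
Proof.
move=> mb [f1 f2] [g1 g2]; split.
  rewrite (_ : (fun w => _) = (fun w => if b w then complex.Re (f w) else complex.Re (g w))).
    exact: measurable_fun_ifT.
  by apply/funext => w; case: (b w).
rewrite (_ : (fun w => _) = (fun w => if b w then complex.Im (f w) else complex.Im (g w))).
  exact: measurable_fun_ifT.
by apply/funext => w; case: (b w).
Qed.

Lemma cmeas_det n (A : T -> 'M[R[i]]_n) : (forall i j, cmeas (fun w => A w i j)) ->
  cmeas (fun w => \det (A w)).
Proof.
move=> mA; apply: cmeas_sum => s; apply: cmeasM; first exact: cmeas_cst.
exact: cmeas_prod.
Qed.

Lemma cmeas_adj n (A : T -> 'M[R[i]]_n) i j : (forall i j, cmeas (fun w => A w i j)) ->
  cmeas (fun w => (\adj (A w)) i j).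
Proof.
move=> mA; under eq_fun do rewrite mxE.
apply: cmeasM; first exact: cmeas_cst.
by apply: cmeas_det => k l; under eq_fun do rewrite !mxE; exact: mA.
Qed.

(** By Cramer's rule the entries of the inverse are rational functions of the entries of the
    matrix. *)
Lemma cmeas_resolvent n (eta : R) (A : T -> 'M[R[i]]_n) i j : 0 < eta ->
  (forall w, A w \is hermsymmx) ->
  (forall i j, cmeas (fun w => A w i j)) ->
  cmeas (fun w => resolvent eta (A w) i j).
Proof.
move=> eta0 hA mA.
under eq_fun do rewrite /resolvent /invmx resolvent_unit// mxE.
have mB k l : cmeas (fun w => (A w - (0 +i* eta)%:M) k l).
  by under eq_fun do rewrite !mxE; apply: cmeasB => //; exact: cmeas_cst.
by apply: cmeasM; [apply: cmeas_inv; exact: cmeas_det|exact: cmeas_adj].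
Qed.

End ComplexMeasurable.

(** * Independence of one entry from all the others *)

Section IndependenceFromOthers.
Context d (T : measurableType d) (R : realType) (P : probability T R).
Context d' (U : measurableType d') (I : finType) (D : {set I}) (X : I -> T -> U).
Hypothesis indepX : independent_RVs P D X.
Hypothesis measX : forall i, measurable_fun [set: T] (X i).
Variable e : I.
Hypothesis eD : e \in D.

(** A generating family, closed under intersection, of the sigma-algebra of all variables with index
    in [D] other than [e]. Independence is checked here and extended by uniqueness of measures. *)
Definition others : set (set T) :=
  [set S | exists (J : {set I}) (B : I -> set U),
    [/\ J \subset (D :\ e)%SET, (forall i, measurable (B i)) &
     S = \bigcap_(i in [set` J]) (X i @^-1` B i)]].

Lemma measurable_preX i (B : set U) : measurable B -> measurable (X i @^-1` B).
Proof. by move=> mB; rewrite -[X in measurable X]setTI; exact: measX. Qed.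

Lemma others_measurable : others `<=` (@measurable _ T).
Proof.
move=> _ [J [B [JD mB ->]]]; apply: fin_bigcap_measurable => //.
by move=> i _; exact: measurable_preX.
Qed.

Lemma sigma_others_measurable : <<s others >> `<=` (@measurable _ T).
Proof. by apply: smallest_sub; [exact: sigma_algebra_measurable|exact: others_measurable]. Qed.

Lemma others_setI : setI_closed others.
Proof.
move=> _ _ [J1 [B1 [JD1 mB1 ->]]] [J2 [B2 [JD2 mB2 ->]]].
exists (J1 :|: J2)%SET, (fun i => (if i \in J1 then B1 i else setT) `&`
  (if i \in J2 then B2 i else setT)); split.
- by rewrite finset.subUset JD1.
- by move=> i; apply: measurableI; case: ifP.
apply/seteqP; split => [w [h1 h2] i /= _|w h].
  by split; case: ifPn => // iJ; [exact: h1|exact: h2].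
split => i /= iJ.
  by have /= := h i; rewrite finset.in_setU iJ => /(_ isT) [].
by have /= := h i; rewrite finset.in_setU iJ orbT => /(_ isT) [].
Qed.

Lemma others_indep_gen A S : measurable A -> others S ->
  P (S `&` X e @^-1` A) = (P (X e @^-1` A) * P S)%E.
Proof.
move=> mA [J [B [JD mB ->]]].
have eJ : e \notin J.
  by apply/negP => /(fintype.subsetP JD); rewrite finset.in_setD1 eqxx.
have JD' : J \subset D by apply: fintype.subset_trans JD _; rewrite finset.subD1set.
have mB' i : measurable (if i == e then A else B i) by case: ifP.
have JeD : (e |: J)%SET \subset D by rewrite finset.subUset finset.sub1set eD.
have := indepX JeD mB'; rewrite finset.big_setU1//= eqxx.
rewrite (eq_bigr (fun i => P (X i @^-1` B i))); last first.
  by move=> i iJ; case: eqP iJ => // ->; rewrite (negPf eJ).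
rewrite -(indepX JD' mB) => <-; congr (P _); apply/seteqP; split => [w [h1 h2] i /=|w h].
  by rewrite finset.in_setU1; case: eqP => [->//|_ /= iJ]; exact: h1.
split; last by have /= := h e; rewrite finset.setU11 eqxx => /(_ isT).
move=> i /= iJ; have /= := h i; rewrite finset.setU1r// => /(_ isT).
by case: eqP iJ => // ->; rewrite (negPf eJ).
Qed.

(** As functions of S, both sides are finite measures, a restriction and a multiple of [P], and they
    agree on the pi-system [others]. *)
Lemma others_indep A S : measurable A -> <<s others >> S ->
  P (X e @^-1` A `&` S) = (P (X e @^-1` A) * P S)%E.
Proof.
move=> mA sS; have mXA := measurable_preX e mA.
pose p : {nonneg R} := NngNum (fine_ge0 (measure_ge0 P (X e @^-1` A))).
have pE : (p%:num)%:E = P (X e @^-1` A) by rewrite fineK// fin_num_measure.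
rewrite setIC -[LHS]/(mrestr P mXA S) -pE -[RHS]/(mscale p P S).
apply: (g_sigma_algebra_measure_unique others others_measurable (fun=> setT)) => //.
- move=> _; exists finset.set0, (fun=> setT); split=> //; first exact: finset.sub0set.
  by apply/esym/seteqP; split=> // w _ i /=; rewrite finset.in_set0.
- by apply/seteqP; split=> // w _; exists 0%N.
- exact: others_setI.
- by move=> B oB; rewrite -[LHS]/(P (B `&` X e @^-1` A)) -[RHS]/(p%:num%:E * P B)%E others_indep_gen// pE.
- by move=> _; rewrite /= /mrestr setTI -ge0_fin_numE// fin_num_measure.
Qed.

Lemma mean_indep_others (f : U -> R) (g : T -> R) :
  measurable_fun [set: U] f -> (exists M, forall w, `|f (X e w)| <= M) ->
  @measurable_fun _ _ (g_sigma_algebraType others) R [set: T] g ->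
  (exists M, forall w, `|g w| <= M) ->
  mean P (fun w => f (X e w) * g w) = mean P (fun w => f (X e w)) * mean P g.
Proof.
move=> mf bf mg bg.
have mgT : measurable_fun [set: T] g.
  move=> _ B mB; apply: sigma_others_measurable; exact: mg.
apply: mean_indep.
- by split => //; exact: measurableT_comp.
- by split.
move=> A B mA mB; rewrite -[(fun w => f (X e w)) @^-1` A]/(X e @^-1` (f @^-1` A)).
apply: others_indep; first by rewrite -[X in measurable X]setTI; exact: mf.
by rewrite -[X in _ X]setTI; exact: mg.
Qed.

Lemma measurable_others i : i \in D -> i != e ->
  @measurable_fun _ _ (g_sigma_algebraType others) U [set: T] (X i).
Proof.
move=> iD ie _ B mB; rewrite setTI; apply: sub_sigma_algebra.
exists [set i]%SET, (fun=> B); split => //.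
  by rewrite finset.sub1set finset.in_setD1 ie.
apply/seteqP; split => [w h j /=|w h]; first by rewrite finset.in_set1 => /eqP ->.
by apply: h => /=; rewrite finset.set11.
Qed.

End IndependenceFromOthers.

(** * The pair estimate *)

Section PairRemainder.
Context {R : realType}.
Implicit Types (L M B t s x u v : R).

Lemma small_sqr_le L t x p : 0 <= x -> x <= t -> t <= 1 -> 0 <= p ->
  x ^+ 2 * (p + 4 * L ^+ 4 * x ^+ 2) <= t * p + 4 * L ^+ 4 * (t * x ^+ 2).
Proof.
move=> x0 xt t1 p0; have t0 : 0 <= t by apply: le_trans xt.
have x2 : x ^+ 2 <= t.
  by rewrite expr2 -[leRHS]mulr1; apply: ler_pM => //; apply: le_trans t1.
have L4 : 0 <= L ^+ 4 by rewrite (exprM _ 2 2) sqr_ge0.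
rewrite mulrDr; apply: lerD; first by rewrite ler_wpM2r.
rewrite mulrCA; apply: ler_wpM2l; first by rewrite mulr_ge0.
by rewrite ler_wpM2r ?sqr_ge0.
Qed.

(** The first two summands bound [T2] and [T3] in the proof of [pair_remainder], the last one bounds
    [T4] and [T5] together. *)
Definition pair_cst L M B : R :=
  3 * (B * L) * (1 + 4 * L ^+ 4) + 2 * M * (1 + 4 * L ^+ 4) +
  (6 * L ^+ 3 * M + 4 * L ^+ 4 * B).

Lemma pair_cst_ge0 L M B : 0 <= L -> 0 <= M -> 0 <= B -> 0 <= pair_cst L M B.
Proof. by move=> L0 M0 B0; rewrite /pair_cst !(addr_ge0, mulr_ge0, exprn_ge0). Qed.

(** Inserting the expansion of [gji] into h gji produces h g0ji and - |h|^2 g0jj gii. The two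
    subtracted terms are those that independence treats afterwards: the first sees only the mean of
    h, the second has mean zero. Everything else must carry a factor t. For the terms of second
    order in h this comes from two off-diagonal factors, and this is why the change of [gii], hence
    of f, is also bounded by off-diagonal entries; the remaining terms have a spare factor |h| <=
    t. *)
Lemma pair_remainder L M B t s (h gji g0ji gij g0ij gii g0ii gjj g0jj f f0 : R[i]) :
  let x := Normc.normc h in
  0 <= L -> 0 <= M -> 0 <= B -> 0 <= s -> x <= t -> t <= 1 ->
  gji = g0ji - (g0ji * h * gji + g0jj * h^*%C * gii) ->
  Normc.normc gii <= L -> Normc.normc g0ii <= L ->
  Normc.normc gjj <= L -> Normc.normc g0jj <= L ->
  Normc.normc f <= M -> Normc.normc f0 <= M ->
  Normc.normc (gii - g0ii) <= L * x * (Normc.normc gji + Normc.normc g0ij) ->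
  Normc.normc (gji - g0ji) <= 2 * L ^+ 2 * x ->
  Normc.normc (gij - g0ij) <= 2 * L ^+ 2 * x ->
  Normc.normc (gii - g0ii) <= 2 * L ^+ 2 * x ->
  Normc.normc (gjj - g0jj) <= 2 * L ^+ 2 * x ->
  Normc.normc (f - f0) <= B * Normc.normc (gii - g0ii) ->
  Normc.normc ((h * gji + s%:C * gii * gjj) * f - h * (g0ji * f0) -
    (s - x ^+ 2)%:C * (g0ii * g0jj * f0)) <=
  pair_cst L M B * (t * (Normc.normc gji ^+ 2 + Normc.normc gij ^+ 2) +
                    t * x ^+ 2 + t * s).
Proof.
move=> x L0 M0 B0 s0 xt t1 gE bii b0ii bjj b0jj bf bf0 diiS dji dij dii djj df.
have x0 : 0 <= x by exact: normc_ge0.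
have t0 : 0 <= t by apply: le_trans xt.
set u := Normc.normc gji in diiS *; set v := Normc.normc gij.
have u0 : 0 <= u by exact: normc_ge0.
have v0 : 0 <= v by exact: normc_ge0.
(* The cost of exchanging an entry of the full resolvent for one of the resolvent with the pair
   removed; [e] is itself of order |h|. *)
pose e := 2 * L ^+ 2 * x.
have e0 : 0 <= e by rewrite !mulr_ge0// sqr_ge0.
have b0ji : Normc.normc g0ji <= u + e.
  by rewrite -[g0ji](subrK gji) addrC; apply: le_trans (le_normcD _ _) _; rewrite lerD2l normcB.
have b0ij : Normc.normc g0ij <= v + e.
  by rewrite -[g0ij](subrK gij) addrC; apply: le_trans (le_normcD _ _) _; rewrite lerD2l normcB.
have hh : h * h^*%C = (x ^+ 2)%:C by rewrite mulcJ_normc.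
pose T2 := h * g0ji * (f - f0).
pose T3 := h * h * (g0ji * gji * f).
pose T4 := (x ^+ 2)%:C * (g0jj * (g0ii * (f0 - f) - (gii - g0ii) * f)).
pose T5 := s%:C * ((gii - g0ii) * gjj * f + g0ii * (gjj - g0jj) * f + g0ii * g0jj * (f - f0)).
have -> : (h * gji + s%:C * gii * gjj) * f - h * (g0ji * f0) -
    (s - x ^+ 2)%:C * (g0ii * g0jj * f0) = T2 - T3 + T4 + T5.
  rewrite /T4 /T5 /T2 /T3 rmorphB /= -hh.
  have -> : h * gji = h * g0ji - h * (g0ji * h * gji) - h * h^*%C * g0jj * gii.
    by rewrite {1}gE; ring.
  by ring.
have dfe : Normc.normc (f - f0) <= B * e by apply: le_trans df _; rewrite ler_wpM2l.
have dfS : Normc.normc (f - f0) <= B * (L * x * (u + v + e)).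
  apply: le_trans df _; apply: ler_wpM2l => //; apply: le_trans diiS _.
  by apply: ler_wpM2l; [rewrite mulr_ge0|rewrite -addrA lerD2l].
have x2x2 : e ^+ 2 = 4 * L ^+ 4 * x ^+ 2 by rewrite /e; ring.
have uve : (u + e) * (u + v + e) <= 3 * (u ^+ 2 + v ^+ 2 + e ^+ 2).
  apply: (@le_trans _ _ ((u + v + e) ^+ 2)).
    by rewrite expr2; apply: ler_wpM2r; [rewrite !addr_ge0|rewrite lerD2r lerDl].
  have := sqr_ge0 (u - v); have := sqr_ge0 (u - e); have := sqr_ge0 (v - e).
  by rewrite !sqrrB !sqrrD; lra.
have ue : (u + e) * u <= 2 * (u ^+ 2 + v ^+ 2 + e ^+ 2).
  by have := sqr_ge0 (u - e); have := sqr_ge0 v; have := sqr_ge0 u; have := sqr_ge0 e; rewrite sqrrB; lra.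
have p0 : 0 <= u ^+ 2 + v ^+ 2 by rewrite addr_ge0 ?sqr_ge0.
have small := small_sqr_le L x0 xt t1 p0.
have xS : x ^+ 2 * (u ^+ 2 + v ^+ 2 + e ^+ 2) <=
    (1 + 4 * L ^+ 4) * (t * (u ^+ 2 + v ^+ 2) + t * x ^+ 2 + t * s).
  have L4 : 0 <= L ^+ 4 by rewrite exprn_ge0.
  rewrite x2x2; apply: le_trans small _.
  have a1 : 0 <= t * (u ^+ 2 + v ^+ 2) by rewrite mulr_ge0.
  have a2 : 0 <= t * x ^+ 2 by rewrite mulr_ge0// sqr_ge0.
  have a3 : 0 <= t * s by rewrite mulr_ge0.
  have := mulr_ge0 L4 a1; have := mulr_ge0 L4 a3; lra.
have n2 : Normc.normc T2 <= 3 * (B * L) * (1 + 4 * L ^+ 4) *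
    (t * (u ^+ 2 + v ^+ 2) + t * x ^+ 2 + t * s).
  rewrite /T2 !Normc.normcM -/x.
  apply: (@le_trans _ _ (x * (u + e) * (B * (L * x * (u + v + e))))).
    by apply: ler_pM; rewrite ?mulr_ge0 ?normc_ge0//; apply: ler_wpM2l.
  rewrite [leLHS](_ : _ = B * L * (x ^+ 2 * ((u + e) * (u + v + e)))); last by ring.
  rewrite -[leRHS]mulrA [3 * _]mulrC -!(mulrA (B * L)).
  apply: ler_wpM2l; first by rewrite mulr_ge0.
  apply: (@le_trans _ _ (3 * (x ^+ 2 * (u ^+ 2 + v ^+ 2 + e ^+ 2)))); last by rewrite ler_wpM2l.
  by rewrite [leRHS]mulrCA; apply: ler_wpM2l; rewrite ?sqr_ge0.
have n3 : Normc.normc T3 <= 2 * M * (1 + 4 * L ^+ 4) *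
    (t * (u ^+ 2 + v ^+ 2) + t * x ^+ 2 + t * s).
  rewrite /T3 !Normc.normcM -/x -/u -expr2.
  apply: (@le_trans _ _ (x ^+ 2 * ((u + e) * u * M))).
    apply: ler_wpM2l; first by rewrite sqr_ge0.
    by apply: ler_pM; rewrite ?mulr_ge0 ?normc_ge0//; apply: ler_wpM2r.
  rewrite [leLHS](_ : _ = M * (x ^+ 2 * ((u + e) * u))); last by ring.
  rewrite -[leRHS]mulrA [2 * _]mulrC -!(mulrA M).
  apply: ler_wpM2l => //.
  apply: (@le_trans _ _ (2 * (x ^+ 2 * (u ^+ 2 + v ^+ 2 + e ^+ 2)))); last by rewrite ler_wpM2l.
  by rewrite [leRHS]mulrCA; apply: ler_wpM2l; rewrite ?sqr_ge0.
have n4 : Normc.normc T4 <= t * x ^+ 2 * (2 * L ^+ 3 * M + 2 * L ^+ 4 * B).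
  rewrite /T4 !Normc.normcM normc_real ger0_norm ?sqr_ge0//.
  have : Normc.normc (g0ii * (f0 - f) - (gii - g0ii) * f) <= L * (B * e) + e * M.
    apply: le_trans (le_normcD _ _) _; rewrite normcN !Normc.normcM.
    by apply: lerD; apply: ler_pM; rewrite ?normc_ge0// normcB.
  move=> h1.
  apply: (@le_trans _ _ (x ^+ 2 * (L * (L * (B * e) + e * M)))).
    apply: ler_wpM2l; first by rewrite sqr_ge0.
    by apply: ler_pM; rewrite ?normc_ge0.
  rewrite [leLHS](_ : _ = x * x ^+ 2 * (2 * L ^+ 3 * M + 2 * L ^+ 4 * B)); last by rewrite /e; ring.
  apply: ler_wpM2r; first by rewrite addr_ge0// !mulr_ge0// exprn_ge0.
  by rewrite ler_wpM2r ?sqr_ge0.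
have n5 : Normc.normc T5 <= t * s * (4 * L ^+ 3 * M + 2 * L ^+ 4 * B).
  rewrite /T5 Normc.normcM normc_real ger0_norm//.
  have h1 : Normc.normc ((gii - g0ii) * gjj * f + g0ii * (gjj - g0jj) * f +
     g0ii * g0jj * (f - f0)) <= e * L * M + L * e * M + L * L * (B * e).
    apply: le_trans (le_normcD _ _) _; apply: lerD.
      apply: le_trans (le_normcD _ _) _; rewrite !Normc.normcM.
      by apply: lerD; apply: ler_pM; rewrite ?mulr_ge0 ?normc_ge0//; apply: ler_pM; rewrite ?normc_ge0.
    by rewrite !Normc.normcM; apply: ler_pM; rewrite ?mulr_ge0 ?normc_ge0//; apply: ler_pM; rewrite ?normc_ge0.
  apply: le_trans (ler_wpM2l s0 h1) _.
  rewrite [leLHS](_ : _ = x * s * (4 * L ^+ 3 * M + 2 * L ^+ 4 * B)); last by rewrite /e; ring.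
  apply: ler_wpM2r; first by rewrite addr_ge0// !mulr_ge0// exprn_ge0.
  by rewrite ler_wpM2r.
set S := _ + _ + _ in n2 n3 *.
apply: (@le_trans _ _ (Normc.normc T2 + Normc.normc T3 + Normc.normc T4 + Normc.normc T5)).
  rewrite -(normcN T3).
  apply: le_trans (le_normcD _ _) _; rewrite lerD2r.
  by apply: le_trans (le_normcD _ _) _; rewrite lerD2r le_normcD.
have K0 : 0 <= 2 * L ^+ 3 * M + 2 * L ^+ 4 * B by rewrite addr_ge0// !mulr_ge0// exprn_ge0.
have K1 : 0 <= 4 * L ^+ 3 * M + 2 * L ^+ 4 * B by rewrite addr_ge0// !mulr_ge0// exprn_ge0.
have a1 : 0 <= t * (u ^+ 2 + v ^+ 2) by rewrite mulr_ge0.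
have a2 : 0 <= t * x ^+ 2 by rewrite mulr_ge0// sqr_ge0.
have a3 : 0 <= t * s by rewrite mulr_ge0.
have n4' : Normc.normc T4 <= S * (2 * L ^+ 3 * M + 2 * L ^+ 4 * B).
  by apply: le_trans n4 _; rewrite ler_wpM2r// /S; lra.
have n5' : Normc.normc T5 <= S * (4 * L ^+ 3 * M + 2 * L ^+ 4 * B).
  by apply: le_trans n5 _; rewrite ler_wpM2r// /S; lra.
apply: le_trans (lerD (lerD (lerD n2 n3) n4') n5') _.
by rewrite le_eqVlt; apply/orP; left; apply/eqP; rewrite /pair_cst; ring.
Qed.

End PairRemainder.

(** * Truncated entries *)

Section Truncation.
Context {R : realType}.
Implicit Types (t : R) (x : R[i]).

(** Large values are set to 0, not clipped to modulus t, so the moments of the truncated entry are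
    exactly the restricted moments E[ . ; |w| <= t]. *)
Definition truncc t x : R[i] := if Normc.normc x <= t then x else 0.

Lemma normc_truncc t x : 0 <= t -> Normc.normc (truncc t x) <= t.
Proof. by rewrite /truncc => t0; case: ifP => //; rewrite Normc.normc0. Qed.

Lemma truncc_conj t x : truncc t x^*%C = (truncc t x)^*%C.
Proof. by rewrite /truncc normc_conj; case: ifP => // _; rewrite conjc0. Qed.

Lemma cmeas_truncc d (T : measurableType d) t (f : T -> R[i]) : cmeas f ->
  cmeas (fun w => truncc t (f w)).
Proof.
move=> mf; have m0 : cmeas (fun _ : T => 0 : R[i]) by exact: cmeas_cst.
apply: (cmeas_if _ mf m0).
by apply: measurable_fun_ler => //; exact: measurable_normc.
Qed.

Definition truncmx N t (A : 'M[R[i]]_N) : 'M[R[i]]_N := \matrix_(i, j) truncc t (A i j).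

Lemma hermsymmx_truncmx N t (A : 'M[R[i]]_N) : A \is hermsymmx ->
  truncmx t A \is hermsymmx.
Proof.
move=> hA; apply: hermsymmxP => i j; rewrite !mxE.
by rewrite -truncc_conj -(hermsymmxij i j hA).
Qed.

End Truncation.

Section BoundedComplex.
Context d (T : measurableType d) (R : realType).
Implicit Types f g : T -> R[i].

Definition bcmeas f := cmeas f /\ exists M, forall w, Normc.normc (f w) <= M.

Lemma bcmeas_cst c : bcmeas (fun=> c).
Proof. by split; [exact: cmeas_cst|exists (Normc.normc c)]. Qed.

Lemma bcmeasD f g : bcmeas f -> bcmeas g -> bcmeas (fun w => f w + g w).
Proof.
move=> [mf [M hM]] [mg [L hL]]; split; first exact: cmeasD.
by exists (M + L) => w; apply: le_trans (le_normcD _ _) _; apply: lerD.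
Qed.

Lemma bcmeasN f : bcmeas f -> bcmeas (fun w => - f w).
Proof.
move=> [mf [M hM]]; split; first exact: cmeasN.
by exists M => w; rewrite normcN.
Qed.

Lemma bcmeasB f g : bcmeas f -> bcmeas g -> bcmeas (fun w => f w - g w).
Proof. by move=> bf bg; apply: bcmeasD => //; exact: bcmeasN. Qed.

Lemma bcmeasM f g : bcmeas f -> bcmeas g -> bcmeas (fun w => f w * g w).
Proof.
move=> [mf [M hM]] [mg [L hL]]; split; first exact: cmeasM.
by exists (M * L) => w; rewrite Normc.normcM; apply: ler_pM; rewrite ?normc_ge0.
Qed.

Lemma bcmeas_conj f : bcmeas f -> bcmeas (fun w => (f w)^*%C).
Proof.
move=> [mf [M hM]]; split; first exact: cmeas_conj.
by exists M => w; rewrite normc_conj.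
Qed.

Lemma bcmeas_sum (I : Type) (r : seq I) (Q : pred I) (F : I -> T -> R[i]) :
  (forall i, bcmeas (F i)) -> bcmeas (fun w => \sum_(i <- r | Q i) F i w).
Proof.
move=> h; elim: r => [|i r IH].
  by under eq_fun do rewrite big_nil; exact: bcmeas_cst.
have [Qi|Qi] := boolP (Q i); last by under eq_fun do rewrite big_cons (negPf Qi).
by under eq_fun do rewrite big_cons Qi; exact: bcmeasD.
Qed.

Lemma bmeas_Re f : bcmeas f -> bounded_measurable (fun w => complex.Re (f w)).
Proof.
move=> [[m1 m2] [M hM]]; split => //; exists M => w.
by apply: le_trans (hM w); exact: ge_Re_normc.
Qed.

Lemma bmeas_Im f : bcmeas f -> bounded_measurable (fun w => complex.Im (f w)).
Proof.
move=> [[m1 m2] [M hM]]; split => //; exists M => w.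
by apply: le_trans (hM w); exact: ge_Im_normc.
Qed.

Lemma bmeas_normc f : bcmeas f -> bounded_measurable (fun w => Normc.normc (f w)).
Proof.
move=> [mf [M hM]]; split; first exact: measurable_normc.
by exists M => w; rewrite ger0_norm ?normc_ge0.
Qed.

Lemma bmeas_normc2 f : bcmeas f -> bounded_measurable (fun w => Normc.normc (f w) ^+ 2).
Proof. by move=> bf; apply: bmeasX; exact: bmeas_normc. Qed.

End BoundedComplex.

Section PairEstimate.
Context d (T : measurableType d) (R : realType) (P : probability T R).
Context (N : nat) (W : T -> 'M[R[i]]_N) (eta t : R).
Hypothesis wignerW : hermitian_wigner P W.
Hypothesis eta_gt0 : 0 < eta.
Hypothesis t_gt0 : 0 < t.
Hypothesis t_le1 : t <= 1.

Let H w := truncmx t (W w).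
Let G w := resolvent eta (H w).

(** A second moment about 0: the mean is not subtracted and is accounted for separately through
    [trunc_mean]. *)
Definition trunc_var i j := mean P (fun w => Normc.normc (truncmx t (W w) i j) ^+ 2).

Definition trunc_mean i j := Normc.normc
  (mean P (fun w => complex.Re (truncmx t (W w) i j)) +i*
   mean P (fun w => complex.Im (truncmx t (W w) i j))).

Lemma cmeas_wigner i j : cmeas (fun w => W w i j).
Proof.
case: wignerW => _ mW _; split.
  exact: (measurableT_comp measurable_fst (mW i j)).
exact: (measurableT_comp measurable_snd (mW i j)).
Qed.

Lemma hermH w : H w \is hermsymmx.
Proof. by case: wignerW => hW _ _; exact: hermsymmx_truncmx. Qed.

Lemma bcmeas_H i j : bcmeas (fun w => H w i j).
Proof.
split; first by under eq_fun do rewrite mxE; apply: cmeas_truncc; exact: cmeas_wigner.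
by exists t => w; rewrite mxE normc_truncc// ltW.
Qed.

Lemma normc_H w i j : Normc.normc (H w i j) <= t.
Proof. by rewrite mxE normc_truncc// ltW. Qed.

Lemma bcmeas_G i j : bcmeas (fun w => G w i j).
Proof.
split; last by exists eta^-1 => w; apply: normc_resolvent_le => //; exact: hermH.
apply: cmeas_resolvent => //; first exact: hermH.
by move=> k l; case: (bcmeas_H k l).
Qed.

Lemma trunc_var_ge0 i j : 0 <= trunc_var i j.
Proof. by apply: mean_ge0 => w; rewrite sqr_ge0. Qed.

Lemma trunc_var_le i j : trunc_var i j <= t ^+ 2.
Proof.
apply: mean_le; first exact/bmeas_normc2/bcmeas_H.
by move=> w; rewrite ler_sqr ?nnegrE ?normc_ge0 ?normc_H// ltW.
Qed.

Section OffDiagonal.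
Variables i j : 'I_N.
Hypothesis ij : i != j.

Let H0 w := set_pair (H w) i j 0.
Let G0 w := resolvent eta (H0 w).
Let X (kl : 'I_N * 'I_N) w := complex_pair (W w kl.1 kl.2).
Let D := [set kl : 'I_N * 'I_N | (kl.1 <= kl.2)%N]%SET.
(** The member of the pair on or above the diagonal; it is the one listed in [D], and the other is
    its conjugate. *)
Let e := if (i <= j)%N then (i, j) else (j, i).
Let TF := g_sigma_algebraType (others D X e).

Let eD : e \in D.
Proof. by rewrite inE /e; case: (leqP i j) => [//|/ltnW]. Qed.

Let measX kl : measurable_fun [set: T] (X kl).
Proof. by case: wignerW => _ mW _; exact: mW. Qed.

Let cmeas_pair : cmeas (fun p : R * R => truncc t (p.1 +i* p.2)).
Proof. by apply: cmeas_truncc; split; [exact: measurable_fst|exact: measurable_snd]. Qed.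

Let cmeasF_upper (k l : 'I_N) : (k <= l)%N -> (k, l) != e -> @cmeas _ TF R (fun w => H w k l).
Proof.
move=> kl kle.
have mX : @measurable_fun _ _ TF _ [set: T] (X (k, l)).
  by apply: measurable_others => //; rewrite inE.
have E w : H w k l = truncc t ((X (k, l) w).1 +i* (X (k, l) w).2).
  by rewrite mxE /X /complex_pair /=; case: (W w k l).
have [m1 m2] := cmeas_pair; split; under eq_fun do rewrite E.
  exact: (measurableT_comp m1 mX).
exact: (measurableT_comp m2 mX).
Qed.

Let cmeasF_H0 k l : @cmeas _ TF R (fun w => H0 w k l).
Proof.
under eq_fun do rewrite mxE.
have [_|kl1] := boolP ((k == i) && (l == j)); first exact: cmeas_cst.
have [_|kl2] := boolP ((k == j) && (l == i)); first exact: cmeas_cst.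
have ne1 : (k, l) != e by rewrite /e; case: ifP => _; rewrite xpair_eqE.
have ne2 : (l, k) != e by rewrite /e; case: ifP => _; rewrite xpair_eqE andbC.
have [kl|/ltnW lk] := leqP k l; first exact: cmeasF_upper.
under eq_fun do rewrite (hermsymmxij k l (hermH _)).
by apply: cmeas_conj; exact: cmeasF_upper.
Qed.

Let hermH0 w : H0 w \is hermsymmx.
Proof. exact: hermsymmx_set_pair (hermH w) ij. Qed.

Let cmeasF_G0 k l : @cmeas _ TF R (fun w => G0 w k l).
Proof. exact: (@cmeas_resolvent _ TF R N eta H0). Qed.

Let normc_G0 w k l : Normc.normc (G0 w k l) <= eta^-1.
Proof. exact: normc_resolvent_le. Qed.

Let cmeas_sub (f : T -> R[i]) : @cmeas _ TF R f -> cmeas f.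
Proof.
move=> [m1 m2]; split.
  move=> _ B mB; apply: (sigma_others_measurable measX); exact: m1.
move=> _ B mB; apply: (sigma_others_measurable measX); exact: m2.
Qed.

(** The flag tells whether H_ij is the independent coordinate itself or its conjugate. *)
Let entryX w : exists b : bool, True /\
  H w i j = (if b then truncc t ((X e w).1 +i* (X e w).2)
             else (truncc t ((X e w).1 +i* (X e w).2))^*%C) /\ b = (i <= j)%N.
Proof.
exists (i <= j)%N; split=> //; split=> //; rewrite /X /e /complex_pair.
case: (i <= j)%N => /=.
  by rewrite mxE; case: (W w i j).
by rewrite (hermsymmxij i j (hermH w)) mxE; case: (W w j i).
Qed.

Let indep_mean (f : R * R -> R) (g : T -> R) : measurable_fun [set: R * R] f ->
  (exists M, forall w, `|f (X e w)| <= M) ->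
  @measurable_fun _ _ TF R [set: T] g -> (exists M, forall w, `|g w| <= M) ->
  mean P (fun w => f (X e w) * g w) = mean P (fun w => f (X e w)) * mean P g.
Proof.
by case: wignerW => _ _ indepW; exact: (mean_indep_others indepW measX eD).
Qed.

Let ReX : exists2 f : R * R -> R, measurable_fun [set: R * R] f &
  forall w, complex.Re (H w i j) = f (X e w).
Proof.
have [m1 m2] := cmeas_pair.
exists (fun p => complex.Re (truncc t (p.1 +i* p.2))) => // w.
by have [b [_ [-> _]]] := entryX w; case: b => //; case: (truncc _ _).
Qed.

Let ImX : exists2 f : R * R -> R, measurable_fun [set: R * R] f &
  forall w, complex.Im (H w i j) = f (X e w).
Proof.
have [m1 m2] := cmeas_pair.
exists (fun p => (if (i <= j)%N then 1 else -1) * complex.Im (truncc t (p.1 +i* p.2))).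
  exact: measurable_funM.
move=> w; have [b [_ [-> ->]]] := entryX w; case: ifP => _; first by rewrite mul1r.
by rewrite mulN1r; case: (truncc _ _).
Qed.

Lemma mean_Re_indep (g : T -> R[i]) : @cmeas _ TF R g ->
  (exists M, forall w, Normc.normc (g w) <= M) ->
  mean P (fun w => complex.Re (H w i j * g w)) =
  mean P (fun w => complex.Re (H w i j)) * mean P (fun w => complex.Re (g w)) -
  mean P (fun w => complex.Im (H w i j)) * mean P (fun w => complex.Im (g w)).
Proof.
move=> mg bg; have bcg : bcmeas g by split => //; exact: cmeas_sub.
have [m1 m2] := mg.
have bH := bcmeas_H i j.
have -> : mean P (fun w => complex.Re (H w i j * g w)) =
  mean P (fun w => complex.Re (H w i j) * complex.Re (g w) -
                   complex.Im (H w i j) * complex.Im (g w)).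
  by congr mean; apply/funext => w; case: (H w i j); case: (g w).
rewrite meanB; [|by apply: bmeasM; exact: bmeas_Re|by apply: bmeasM; exact: bmeas_Im].
have [f1 mf1 E1] := ReX; have [f2 mf2 E2] := ImX.
have bf1 : exists M, forall w, `|f1 (X e w)| <= M.
  by have [_ [M hM]] := bmeas_Re bH; exists M => w; rewrite -E1.
have bf2 : exists M, forall w, `|f2 (X e w)| <= M.
  by have [_ [M hM]] := bmeas_Im bH; exists M => w; rewrite -E2.
have [_ bg1] := bmeas_Re bcg; have [_ bg2] := bmeas_Im bcg.
congr (_ - _).
  under [LHS]eq_Rintegral do rewrite E1; under [X in _ = X * _]eq_Rintegral do rewrite E1.
  exact: indep_mean.
under [LHS]eq_Rintegral do rewrite E2; under [X in _ = X * _]eq_Rintegral do rewrite E2.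
exact: indep_mean.
Qed.

Lemma mean_centered_var (g : T -> R[i]) : @cmeas _ TF R g ->
  (exists M, forall w, Normc.normc (g w) <= M) ->
  mean P (fun w => complex.Re ((trunc_var i j - Normc.normc (H w i j) ^+ 2)%:C * g w)) = 0.
Proof.
move=> mg bg; have bcg : bcmeas g by split => //; exact: cmeas_sub.
have [m1 m2] := mg; have bH := bcmeas_H i j.
have [f1 mf1 E1] := ReX; have [f2 mf2 E2] := ImX.
pose f p := trunc_var i j - (f1 p ^+ 2 + f2 p ^+ 2).
have fE w : trunc_var i j - Normc.normc (H w i j) ^+ 2 = f (X e w).
  by rewrite normc_sqr E1 E2.
have mf : measurable_fun [set: R * R] f.
  by apply: measurable_funB => //; apply: measurable_funD; exact: measurable_funX.
have bf : bounded_measurable (fun w => trunc_var i j - Normc.normc (H w i j) ^+ 2).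
  by apply: bmeasB; [exact: bmeas_cst|exact: bmeas_normc2].
have bf' : exists M, forall w, `|f (X e w)| <= M.
  by have [_ [M hM]] := bf; exists M => w; rewrite -fE.
have [_ bg1] := bmeas_Re bcg.
transitivity (mean P (fun w => f (X e w) * complex.Re (g w))).
  by congr mean; apply/funext => w; rewrite fE; case: (g w) => a b /=; rewrite mul0r subr0.
rewrite indep_mean// (_ : mean P _ = 0) ?mul0r//.
transitivity (mean P (fun w => trunc_var i j - Normc.normc (H w i j) ^+ 2)).
  by congr mean; apply/funext => w; rewrite fE.
rewrite meanB; [|exact: bmeas_cst|exact: bmeas_normc2].
by rewrite mean_cst subrr.
Qed.

Variables a b : R[i].
Let f w := a + b * (G w i i)^*%C.
Let f0 w := a + b * (G0 w i i)^*%C.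
Let L := eta^-1.
Let M := Normc.normc a + Normc.normc b * L.

Let L_ge0 : 0 <= L. Proof. by rewrite invr_ge0 ltW. Qed.
Let M_ge0 : 0 <= M. Proof. by rewrite addr_ge0 ?mulr_ge0 ?normc_ge0. Qed.

Let normc_G w k l : Normc.normc (G w k l) <= L.
Proof. by apply: normc_resolvent_le => //; exact: hermH. Qed.

Let diffG w k l : Normc.normc (G w k l - G0 w k l) <=
  Normc.normc (H w i j) * (Normc.normc (G0 w k i) * Normc.normc (G w j l) +
                           Normc.normc (G0 w k j) * Normc.normc (G w i l)).
Proof.
have /= -> := resolvent_set_pair eta_gt0 k l (hermH w) ij; rewrite -/(G0 w) -/(G w).
rewrite addrAC subrr add0r normcN; apply: le_trans (le_normcD _ _) _.
rewrite !Normc.normcM (hermsymmxij j i (hermH w)) normc_conj.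
by rewrite le_eqVlt; apply/orP; left; apply/eqP; ring.
Qed.

Let diffG2 w k l : Normc.normc (G w k l - G0 w k l) <= 2 * L ^+ 2 * Normc.normc (H w i j).
Proof.
apply: le_trans (diffG w k l) _; rewrite [leRHS]mulrC ler_wpM2l ?normc_ge0//.
rewrite mulrDl mul1r expr2; apply: lerD; apply: ler_pM; rewrite ?normc_ge0 ?normc_G0//.
Qed.

(** After [pair_remainder], the term with s - |H_ij|^2 has mean zero, since its cofactor involves
    only the other entries, and the term linear in H_ij factors through the mean of H_ij. All
    quantities on the right can be summed over i and j: the resolvent entries by Ward's identity,
    the others by the hypotheses on the moments. *)
Lemma pair_estimate :
  `|mean P (fun w => complex.Re ((H w i j * G w j i +
      (trunc_var i j)%:C * G w i i * G w j j) * f w))| <=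
  (3 * pair_cst L M (Normc.normc b) + 4 * M + 8 * M * L ^+ 2) *
  (t * (mean P (fun w => Normc.normc (G w j i) ^+ 2) +
        mean P (fun w => Normc.normc (G w i j) ^+ 2)) +
   t * trunc_var i j + t^-1 * trunc_mean i j ^+ 2).
Proof.
pose s := trunc_var i j.
pose Z w := (H w i j * G w j i + s%:C * G w i i * G w j j) * f w.
pose A1 w := H w i j * (G0 w j i * f0 w).
pose A2 w := (s - Normc.normc (H w i j) ^+ 2)%:C * (G0 w i i * G0 w j j * f0 w).
pose u w := Normc.normc (G w j i); pose v w := Normc.normc (G w i j).
pose x w := Normc.normc (H w i j).
have nf w : Normc.normc (f w) <= M.
  apply: le_trans (le_normcD _ _) _; rewrite lerD2l Normc.normcM normc_conj.
  by rewrite ler_wpM2l ?normc_ge0.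
have nf0 w : Normc.normc (f0 w) <= M.
  apply: le_trans (le_normcD _ _) _; rewrite lerD2l Normc.normcM normc_conj.
  by rewrite ler_wpM2l ?normc_ge0 ?normc_G0.
have mf0 : @cmeas _ TF R f0.
  apply: cmeasD; first exact: cmeas_cst.
  by apply: cmeasM; [exact: cmeas_cst|apply: cmeas_conj; exact: cmeasF_G0].
have bcf0 : bcmeas f0 by split; [exact: cmeas_sub|exists M].
have bcG0 k l : bcmeas (fun w => G0 w k l).
  by split; [exact/cmeas_sub/cmeasF_G0|exists L => w; exact: normc_G0].
have bcf : bcmeas f.
  apply: bcmeasD; first exact: bcmeas_cst.
  by apply: bcmeasM; [exact: bcmeas_cst|apply: bcmeas_conj; exact: bcmeas_G].
have bcZ : bcmeas Z.
  apply: bcmeasM => //; apply: bcmeasD.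
    by apply: bcmeasM; [exact: bcmeas_H|exact: bcmeas_G].
  by apply: bcmeasM; [apply: bcmeasM; [exact: bcmeas_cst|exact: bcmeas_G]|exact: bcmeas_G].
have bcA1 : bcmeas A1.
  by apply: bcmeasM; [exact: bcmeas_H|exact: bcmeasM].
have bcs : bcmeas (fun w => (s - Normc.normc (H w i j) ^+ 2)%:C).
  split.
    split => /=; last exact: measurable_cst.
    by have [] := bmeasB (bmeas_cst _ s) (bmeas_normc2 (bcmeas_H i j)).
  have [_ [C hC]] := bmeasB (bmeas_cst _ s) (bmeas_normc2 (bcmeas_H i j)).
  by exists C => w; rewrite normc_real.
have bcA2 : bcmeas A2.
  by apply: bcmeasM => //; apply: bcmeasM => //; exact: bcmeasM.
pose C1 := pair_cst L M (Normc.normc b).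
have C1_ge0 : 0 <= C1.
  by apply: pair_cst_ge0 => //; exact: normc_ge0.
have bu := bmeas_normc2 (bcmeas_G j i); have bv := bmeas_normc2 (bcmeas_G i j).
have bx := bmeas_normc2 (bcmeas_H i j).
have remP w : Normc.normc (Z w - A1 w - A2 w) <=
    C1 * (t * (u w ^+ 2 + v w ^+ 2) + t * x w ^+ 2 + t * s).
  rewrite /Z /A1 /A2; apply: pair_remainder => //.
  - exact: normc_ge0.
  - exact: trunc_var_ge0.
  - exact: normc_H.
  - by rewrite -(hermsymmxij j i (hermH w)); exact: (resolvent_set_pair eta_gt0 j i (hermH w) ij).
  - apply: le_trans (diffG w i i) _.
    rewrite [L * _]mulrC -mulrA ler_wpM2l ?normc_ge0// mulrDr.
    apply: lerD; first by rewrite ler_wpM2r ?normc_ge0 ?normc_G0.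
    by rewrite mulrC ler_wpM2r ?normc_ge0.
  - rewrite /f /f0 opprD addrACA subrr add0r -mulrBr Normc.normcM -rmorphB.
    by rewrite ler_wpM2l ?normc_ge0// normc_conj.
have meanZA : mean P (fun w => complex.Re (Z w)) =
    mean P (fun w => complex.Re (Z w - A1 w - A2 w)) + mean P (fun w => complex.Re (A1 w)).
  have bcR := bcmeasB (bcmeasB bcZ bcA1) bcA2.
  rewrite -[RHS]meanD; [|exact: bmeas_Re bcR|exact: bmeas_Re bcA1].
  rewrite -[RHS]addr0 -(mean_centered_var (g := fun w => G0 w i i * G0 w j j * f0 w)).
  - rewrite -meanD; [|exact/bmeasD/bmeas_Re/bcA1/bmeas_Re|exact: bmeas_Re bcA2].
    congr mean; apply/funext => w; rewrite -/(A2 w).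
    by case: (Z w) => ? ?; case: (A1 w) => ? ?; case: (A2 w) => ? ? /=; ring.
  - by apply: cmeasM => //; exact: cmeasM.
  - by have [_] := bcmeasM (bcmeasM (bcG0 i i) (bcG0 j j)) bcf0.
have remB : `|mean P (fun w => complex.Re (Z w - A1 w - A2 w))| <=
    C1 * (t * (mean P (fun w => u w ^+ 2) + mean P (fun w => v w ^+ 2)) + 2 * (t * s)).
  have bcR := bcmeasB (bcmeasB bcZ bcA1) bcA2.
  apply: le_trans (ler_norm_mean P (bmeas_Re bcR)) _.
  apply: (@le_trans _ _ (mean P (fun w => C1 * (t * (u w ^+ 2 + v w ^+ 2) + t * x w ^+ 2 + t * s)))).
    apply: le_mean; first exact/bmeas_norm/bmeas_Re.
      apply: bmeasM; first exact: bmeas_cst.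
      apply: bmeasD; last exact: bmeas_cst.
      by apply: bmeasD; (apply: bmeasM; [exact: bmeas_cst|]) => //; exact: bmeasD.
    by move=> w; apply: le_trans (ge_Re_normc _) _; exact: remP.
  rewrite meanZ; last first.
    apply: bmeasD; last exact: bmeas_cst.
    by apply: bmeasD; (apply: bmeasM; [exact: bmeas_cst|]) => //; exact: bmeasD.
  rewrite meanD ?mean_cst; [|by apply: bmeasD; (apply: bmeasM; [exact: bmeas_cst|]) => //; exact: bmeasD|exact: bmeas_cst].
  rewrite meanD; [|by apply: bmeasM; [exact: bmeas_cst|exact: bmeasD]|by apply: bmeasM => //; exact: bmeas_cst].
  rewrite !meanZ// ?meanD//; last exact: bmeasD.
  by rewrite -/(trunc_var i j) -/s -addrA [2 * _]mulrDl mul1r.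
have meanA1 : `|mean P (fun w => complex.Re (A1 w))| <=
    2 * trunc_mean i j * (M * (mean P u + 2 * L ^+ 2 * mean P x)).
  have bcg := bcmeasM (bcG0 j i) bcf0.
  rewrite mean_Re_indep; [|exact: cmeasM|by case: bcg].
  (* The resolvent without the pair depends on (i, j), so Ward's identity cannot be summed over j
     with it; its entry is exchanged for one of the full resolvent. *)
  have ng w : Normc.normc (G0 w j i * f0 w) <= M * (u w + 2 * L ^+ 2 * x w).
    rewrite Normc.normcM mulrC; apply: ler_pM; rewrite ?normc_ge0//.
    rewrite -[G0 w j i](subrK (G w j i)) addrC; apply: le_trans (le_normcD _ _) _.
    by rewrite lerD2l normcB.
  have bb : bounded_measurable (fun w => M * (u w + 2 * L ^+ 2 * x w)).
    apply: bmeasM; first exact: bmeas_cst.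
    apply: bmeasD; first exact/bmeas_normc/bcmeas_G.
    by apply: bmeasM; [exact: bmeas_cst|exact/bmeas_normc/bcmeas_H].
  have bE : mean P (fun w => M * (u w + 2 * L ^+ 2 * x w)) =
      M * (mean P u + 2 * L ^+ 2 * mean P x).
    have bx1 := bmeas_normc (bcmeas_H i j); have bu1 := bmeas_normc (bcmeas_G j i).
    have bx2 : bounded_measurable (fun w => 2 * L ^+ 2 * x w).
      by apply: bmeasM => //; exact: bmeas_cst.
    rewrite meanZ; last exact: bmeasD.
    by rewrite meanD// meanZ.
  have r1 : `|mean P (fun w => complex.Re (G0 w j i * f0 w))| <= M * (mean P u + 2 * L ^+ 2 * mean P x).
    rewrite -bE; apply: le_trans (ler_norm_mean P (bmeas_Re bcg)) _.
    apply: le_mean => //; first exact/bmeas_norm/bmeas_Re.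
    by move=> w; apply: le_trans (ge_Re_normc _) _.
  have r2 : `|mean P (fun w => complex.Im (G0 w j i * f0 w))| <= M * (mean P u + 2 * L ^+ 2 * mean P x).
    rewrite -bE; apply: le_trans (ler_norm_mean P (bmeas_Im bcg)) _.
    apply: le_mean => //; first exact/bmeas_norm/bmeas_Im.
    by move=> w; apply: le_trans (ge_Im_normc _) _.
  apply: le_trans (ler_normB _ _) _; rewrite !normrM -mulrA [2 * _]mulrDl mul1r.
  apply: lerD; apply: ler_pM => //.
    exact: (ge_Re_normc (_ +i* _)).
  exact: (ge_Im_normc (_ +i* _)).
rewrite -/s -[X in `|X|]/(mean P (fun w => complex.Re (Z w))) meanZA; apply: le_trans (ler_normD _ _) _.
apply: le_trans (lerD remB meanA1) _.
have tm0 : 0 <= trunc_mean i j by exact: normc_ge0.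
(* The weight t gives the resolvent part the small factor t and puts 1/t on the squared means, whose
   average tends to 0 for fixed t. *)
have amgm (y : R) : trunc_mean i j * y <= t^-1 * trunc_mean i j ^+ 2 + t * y ^+ 2.
  set m := trunc_mean i j.
  have t2 : t^-1 * m ^+ 2 + t * y ^+ 2 - m * y = t^-1 * ((m - t * y / 2) ^+ 2 + 3 / 4 * (t * y) ^+ 2).
    by field; rewrite gt_eqF.
  rewrite -subr_ge0 t2 mulr_ge0 ?invr_ge0 ?(ltW t_gt0)// addr_ge0 ?sqr_ge0//.
  by rewrite mulr_ge0 ?sqr_ge0.
have au := amgm (mean P u); have ax := amgm (mean P x).
have eu : mean P u ^+ 2 <= mean P (fun w => u w ^+ 2) by exact/sqr_mean_le/bmeas_normc/bcmeas_G.
have ex : mean P x ^+ 2 <= s by exact/sqr_mean_le/bmeas_normc/bcmeas_H.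
have {}eu := ler_wpM2l (ltW t_gt0) eu; have {}ex := ler_wpM2l (ltW t_gt0) ex.
set eU := mean P (fun w => u w ^+ 2) in eu *; set eV := mean P (fun w => v w ^+ 2).
have eV0 : 0 <= eV by apply: mean_ge0 => w; rewrite sqr_ge0.
have eU0 : 0 <= eU by apply: mean_ge0 => w; rewrite sqr_ge0.
have s0 : 0 <= s by exact: trunc_var_ge0.
set S := t * (eU + eV) + t * s + _.
have tU : 0 <= t * eU by rewrite mulr_ge0// ltW.
have tV : 0 <= t * eV by rewrite mulr_ge0// ltW.
have ts : 0 <= t * s by rewrite mulr_ge0// ltW.
have tm : 0 <= t^-1 * trunc_mean i j ^+ 2 by rewrite mulr_ge0 ?invr_ge0 ?sqr_ge0// ltW.
have h1 : t * (eU + eV) + 2 * (t * s) <= 3 * S by rewrite /S; lra.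
have h2 : trunc_mean i j * mean P u <= 2 * S by rewrite /S; lra.
have h3 : trunc_mean i j * mean P x <= 2 * S by rewrite /S; lra.
have L20 : 0 <= L ^+ 2 by exact: sqr_ge0.
rewrite [X in _ + X <= _](_ : _ = 2 * M * (trunc_mean i j * mean P u) +
  4 * M * L ^+ 2 * (trunc_mean i j * mean P x)); last by ring.
have k1 := ler_wpM2l C1_ge0 h1.
have k2 : 2 * M * (trunc_mean i j * mean P u) <= 2 * M * (2 * S) by rewrite ler_wpM2l// mulr_ge0.
have k3 : 4 * M * L ^+ 2 * (trunc_mean i j * mean P x) <= 4 * M * L ^+ 2 * (2 * S).
  by rewrite ler_wpM2l// !mulr_ge0.
apply: le_trans (lerD k1 (lerD k2 k3)) _.
by rewrite le_eqVlt; apply/orP; left; apply/eqP; rewrite /C1; ring.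
Qed.

End OffDiagonal.

End PairEstimate.

(** * The self-consistent equation *)

Section Defect.
Context d (T : measurableType d) (R : realType) (P : probability T R).
Context (N : nat) (W : T -> 'M[R[i]]_N) (eta t : R).
Hypothesis wignerW : hermitian_wigner P W.
Hypothesis eta_gt0 : 0 < eta.
Hypothesis t_gt0 : 0 < t.
Hypothesis t_le1 : t <= 1.

Let H w := truncmx t (W w).
Let G w := resolvent eta (H w).
Let k w i := diag_resolvent eta (H w) i.
Let s2 i j := trunc_var P W t i j.
Let eps := eta^-1 ^+ 2.

Let hermH w : H w \is hermsymmx.
Proof. by apply: hermH wignerW _. Qed.

Let bcG i j : bcmeas (fun w => G w i j).
Proof. exact: (bcmeas_G wignerW eta_gt0 t_gt0). Qed.

Lemma trunc_varC i j : s2 i j = s2 j i.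
Proof.
congr mean; apply/funext => w.
by rewrite (hermsymmxij i j (hermH w)) normc_conj.
Qed.

Lemma bcmeas_diag i : bcmeas (fun w => k w i).
Proof. by apply: bcmeasM; [exact: bcmeas_cst|exact: bcG]. Qed.

Definition defect w i : R[i] :=
  1 - k w i - eps%:C * k w i * \sum_j (s2 i j)%:C * k w j.

(** The (i, i) entry of (H - i eta) G = 1 reads sum_j H_ij G_ji = 1 - k_i, while k_i k_j = - eta^2
    G_ii G_jj. The defect thus becomes a sum over pairs to which [pair_estimate] applies. *)
Lemma defectE w i :
  defect w i = \sum_j (H w i j * G w j i + (s2 i j)%:C * G w i i * G w j j).
Proof.
have /matrixP/(_ i i) := mul_resolvent eta_gt0 (hermH w).
rewrite mulmxBl mul_scalar_mx !mxE eqxx /= -/(G w) => E.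
rewrite big_split /= (_ : \sum_j H w i j * G w j i = 1 - k w i); last first.
  have -> : \sum_j H w i j * G w j i = 1 + (0 +i* eta) * G w i i.
    by apply/eqP; rewrite -subr_eq; apply/eqP; exact: E.
  rewrite /k /diag_resolvent -/(G w) -mulNr; congr (_ + _ * _).
  by apply/eqP; rewrite eq_complex /= oppr0 opprK !eqxx.
rewrite /defect; congr (_ + _).
rewrite mulr_sumr -sumrN; apply: eq_bigr => j _.
have e1 : eps * eta * eta = 1 by rewrite /eps; field; rewrite gt_eqF.
have kk : k w i * k w j = - (eta * eta)%:C * (G w i i * G w j j).
  rewrite /k /diag_resolvent -/(G w) mulrACA; congr (_ * _).
  by simpc; congr (_ +i* _); ring.
have E1 : eps%:C * (eta * eta)%:C = 1 :> R[i] by rewrite -rmorphM /= mulrA e1.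
have -> : eps%:C * k w i * ((s2 i j)%:C * k w j) =
    eps%:C * (k w i * k w j) * (s2 i j)%:C by ring.
rewrite kk [LHS](_ : _ = eps%:C * (eta * eta)%:C * ((s2 i j)%:C * G w i i * G w j j)).
  by rewrite E1 mul1r.
by ring.
Qed.

Lemma bcmeas_defect i : bcmeas (fun w => defect w i).
Proof.
apply: bcmeasB; first by apply: bcmeasB; [exact: bcmeas_cst|exact: bcmeas_diag].
apply: bcmeasM; first by apply: bcmeasM; [exact: bcmeas_cst|exact: bcmeas_diag].
by apply: bcmeas_sum => j; apply: bcmeasM; [exact: bcmeas_cst|exact: bcmeas_diag].
Qed.

(** The factor eta in [B] comes from conj k_i = i eta conj G_ii. The factor 1 + 2 L^2 absorbs the
    sum of all |G_ij|^2, and the last summand pays for the diagonal terms j = i, where the bound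
    |H_ii| <= t is enough. *)
Definition defect_cst (a b : R[i]) : R :=
  let L := eta^-1 in let B := Normc.normc b * eta in
  let M := Normc.normc a + B * L in
  (3 * pair_cst L M B + 4 * M + 8 * M * L ^+ 2) * (1 + 2 * L ^+ 2) + (L + L ^+ 2) * M.

Lemma defect_cst_ge0 a b : 0 <= defect_cst a b.
Proof.
have e0 := ltW eta_gt0; have L0 : 0 <= eta^-1 by rewrite invr_ge0.
have B0 : 0 <= Normc.normc b * eta by rewrite mulr_ge0 ?normc_ge0// ltW.
have M0 : 0 <= Normc.normc a + Normc.normc b * eta * eta^-1.
  by rewrite addr_ge0 ?normc_ge0// mulr_ge0.
by rewrite /defect_cst /= !(pair_cst_ge0, addr_ge0, mulr_ge0, exprn_ge0, normc_ge0).
Qed.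

Lemma defect_bound a b :
  \sum_i `|mean P (fun w => complex.Re (defect w i * (a + b * (k w i)^*%C)))| <=
  defect_cst a b * (t * N%:R + t * (\sum_i \sum_j s2 i j) +
    t^-1 * (\sum_i \sum_j trunc_mean P W t i j ^+ 2)).
Proof.
pose b' := b * (0 +i* eta); pose L := eta^-1; pose B := Normc.normc b'.
pose M := Normc.normc a + B * L.
have BE : B = Normc.normc b * eta.
  by rewrite /B Normc.normcM /= expr0n add0r sqrtr_sqr ger0_norm// ltW.
have L0 : 0 <= L by rewrite invr_ge0 ltW.
have B0 : 0 <= B by exact: normc_ge0.
have M0 : 0 <= M by rewrite addr_ge0 ?normc_ge0// mulr_ge0.
pose f w i := a + b' * (G w i i)^*%C.
have fE w i : a + b * (k w i)^*%C = f w i.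
  rewrite /f /b' -mulrA; congr (_ + _ * _).
  rewrite /k /diag_resolvent -/(G w); case: (G w i i) => x y; simpc => /=.
  by congr (_ +i* _); ring.
pose C0 := 3 * pair_cst L M B + 4 * M + 8 * M * L ^+ 2.
have C00 : 0 <= C0 by rewrite /C0 !(pair_cst_ge0, addr_ge0, mulr_ge0, exprn_ge0, normc_ge0).
pose Z i j w := (H w i j * G w j i + (s2 i j)%:C * G w i i * G w j j) * f w i.
have nG w i j : Normc.normc (G w i j) <= L by exact: normc_resolvent_le.
have nf w i : Normc.normc (f w i) <= M.
  apply: le_trans (le_normcD _ _) _; rewrite lerD2l Normc.normcM normc_conj.
  by rewrite ler_wpM2l.
have bcf i : bcmeas (fun w => f w i).
  apply: bcmeasD; first exact: bcmeas_cst.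
  by apply: bcmeasM; [exact: bcmeas_cst|apply: bcmeas_conj; exact: bcG].
have bcZ i j : bcmeas (Z i j).
  apply: bcmeasM => //; apply: bcmeasD.
    by apply: bcmeasM => //; exact: (bcmeas_H wignerW t_gt0).
  by apply: bcmeasM => //; apply: bcmeasM => //; exact: bcmeas_cst.
pose u i j := mean P (fun w => Normc.normc (G w i j) ^+ 2).
have u0 i j : 0 <= u i j by apply: mean_ge0 => w; rewrite sqr_ge0.
have s0 i j : 0 <= s2 i j by exact: trunc_var_ge0.
pose V i j := t * (u j i + u i j) + t * s2 i j + t^-1 * trunc_mean P W t i j ^+ 2.
have V0 i j : 0 <= V i j.
  have t0 := ltW t_gt0; have ti0 : 0 <= t^-1 by rewrite invr_ge0.
  apply: addr_ge0; first by apply: addr_ge0; apply: mulr_ge0 => //; exact: addr_ge0.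
  by rewrite mulr_ge0 ?sqr_ge0.
have offd i j : i != j -> `|mean P (fun w => complex.Re (Z i j w))| <= C0 * V i j.
  by move=> ij; exact: pair_estimate.
have diag i : `|mean P (fun w => complex.Re (Z i i w))| <= t * ((L + L ^+ 2) * M).
  apply: le_trans (ler_norm_mean P (bmeas_Re (bcZ i i))) _.
  apply: mean_le; first exact/bmeas_norm/bmeas_Re.
  move=> w; apply: le_trans (ge_Re_normc _) _; rewrite Normc.normcM mulrA.
  apply: ler_pM => //; rewrite ?normc_ge0// mulrDr; apply: le_trans (le_normcD _ _) _.
  rewrite !Normc.normcM normc_real ger0_norm// expr2 mulrA -mulrA.
  apply: lerD; first by apply: ler_pM; rewrite ?normc_ge0 ?normc_H.
  rewrite -mulrA; apply: ler_pM; rewrite ?mulr_ge0 ?normc_ge0//.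
    apply: le_trans (trunc_var_le wignerW t_gt0 i i) _.
    by rewrite expr2 ger_pMl.
  by apply: ler_pM; rewrite ?normc_ge0.
have row i : `|mean P (fun w => complex.Re (defect w i * (a + b * (k w i)^*%C)))| <=
    t * ((L + L ^+ 2) * M) + \sum_j C0 * V i j.
  have -> : mean P (fun w => complex.Re (defect w i * (a + b * (k w i)^*%C))) =
      \sum_j mean P (fun w => complex.Re (Z i j w)).
    rewrite -mean_sum => [|j _]; last exact: bmeas_Re.
    by congr mean; apply/funext => w; rewrite fE defectE mulr_suml Re_sum.
  apply: le_trans (ler_norm_sum _ _ _) _.
  rewrite (bigD1 i)//= [X in _ <= _ + X](bigD1 i)//=.
  have h : \sum_(j | j != i) `|mean P (fun w => complex.Re (Z i j w))| <=
      \sum_(j | j != i) C0 * V i j.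
    by apply: ler_sum => j ji; apply: offd; rewrite eq_sym.
  have := diag i; have := mulr_ge0 C00 (V0 i i); lra.
have sumu : \sum_i \sum_j u i j <= L ^+ 2 * N%:R.
  apply: (@le_trans _ _ (\sum_(i < N) L ^+ 2)); last first.
    by rewrite sumr_const card_ord mulr_natr.
  apply: ler_sum => i _; rewrite -mean_sum => [|j _]; last exact: bmeas_normc2.
  apply: mean_le; first by apply: bmeas_sum => j _; exact: bmeas_normc2.
  by move=> w; exact: sum_normc_resolvent_le.
apply: le_trans (ler_sum _ (fun i _ => row i)) _.
rewrite big_split /= sumr_const card_ord.
have -> : \sum_i \sum_j C0 * V i j = C0 * (t * (2 * \sum_i \sum_j u i j) +
    t * (\sum_i \sum_j s2 i j) + t^-1 * (\sum_i \sum_j trunc_mean P W t i j ^+ 2)).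
  under eq_bigr do rewrite -mulr_sumr; rewrite -mulr_sumr; congr (_ * _).
  rewrite /V; under eq_bigr do rewrite !big_split /= -!mulr_sumr big_split /=.
  rewrite !big_split /= -!mulr_sumr big_split /= [X in t * (X + _)]exchange_big /=.
  by rewrite [2 * _]mulrDl mul1r.
set S := \sum_i \sum_j s2 i j; set Q := \sum_i \sum_j trunc_mean P W t i j ^+ 2.
have S0 : 0 <= S by apply: sumr_ge0 => i _; apply: sumr_ge0 => j _.
have Q0 : 0 <= Q by apply: sumr_ge0 => i _; apply: sumr_ge0 => j _; rewrite sqr_ge0.
have cE : defect_cst a b = C0 * (1 + 2 * L ^+ 2) + (L + L ^+ 2) * M.
  by rewrite /defect_cst /= -BE.
have t0 := ltW t_gt0; have ti0 : 0 <= t^-1 by rewrite invr_ge0.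
have tN : 0 <= t * N%:R by rewrite mulr_ge0.
have tS : 0 <= t * S by rewrite mulr_ge0.
have tQ : 0 <= t^-1 * Q by rewrite mulr_ge0.
rewrite cE -[_ *+ N]mulr_natr [leLHS]addrC [leRHS]mulrDl; apply: lerD.
  rewrite -[leRHS]mulrA; apply: ler_wpM2l => //.
  have L20 : 0 <= 2 * L ^+ 2 by rewrite mulr_ge0// sqr_ge0.
  have h1 := ler_wpM2l t0 sumu.
  have h3 : 0 <= 2 * L ^+ 2 * (t * S + t^-1 * Q) by rewrite mulr_ge0// addr_ge0.
  rewrite [leRHS](_ : _ = (t * N%:R + 2 * (t * (L ^+ 2 * N%:R))) + (t * S + t^-1 * Q) +
    2 * L ^+ 2 * (t * S + t^-1 * Q)); last by ring.
  rewrite [leLHS](_ : _ = 2 * (t * \sum_i \sum_j u i j) + (t * S + t^-1 * Q)); last by ring.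
  by lra.
rewrite [leLHS](_ : _ = (L + L ^+ 2) * M * (t * N%:R)); last by ring.
apply: ler_wpM2l; first by rewrite mulr_ge0// addr_ge0// sqr_ge0.
by lra.
Qed.

Let normc_k2 w i : Normc.normc (k w i) ^+ 2 <= complex.Re (k w i).
Proof. exact: normc_diag_resolvent_sqr_le. Qed.

Let Re_k_le1 w i : complex.Re (k w i) <= 1.
Proof.
have := normc_k2 w i; rewrite normc_sqr; set x := complex.Re _; set y := complex.Im _.
by have := sqr_ge0 y; have := sqr_ge0 (x - 1); rewrite sqrrB expr1n; lra.
Qed.

Let normc_k_le1 w i : Normc.normc (k w i) <= 1.
Proof.
rewrite -(expr_le1 (n := 2)) ?normc_ge0//.
exact: le_trans (normc_k2 w i) (Re_k_le1 w i).
Qed.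

Let eps_gt0 : 0 < eps.
Proof. by rewrite exprn_gt0// invr_gt0. Qed.

Let s2_ge0 i j : 0 <= s2 i j.
Proof. exact: trunc_var_ge0. Qed.

(** Put x_i = k_i - kappa. Against the test function conj x_i the defect contains - |x_i|^2, a term
    of the same sign proportional to s_i, and the coupling eps k_i sum_j s_ij x_j conj x_i. By |k_i|
    <= 1, the inequality between means and the symmetry of s, the coupling is at most eps sum_i s_i
    |x_i|^2 in total, hence eps sum_i |x_i|^2 up to the deviation of the row sums from 1. *)
Lemma deviation_bound kappa : 0 <= kappa -> kappa <= 1 -> kappa = 1 - eps * kappa ^+ 2 ->
  (1 - eps) * \sum_i mean P (fun w => Normc.normc (k w i - kappa%:C) ^+ 2) <=
  \sum_i `|mean P (fun w => complex.Re (defect w i * (- kappa%:C + 1 * (k w i)^*%C)))| +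
  6 * eps * \sum_i `|\sum_j s2 i j - 1|.
Proof.
move=> kap0 kap1 kapE; pose x w i := k w i - kappa%:C.
pose s i := \sum_j s2 i j.
have bcx i : bcmeas (fun w => x w i).
  by apply: bcmeasB; [exact: bcmeas_diag|exact: bcmeas_cst].
pose p i := mean P (fun w => Normc.normc (x w i) ^+ 2).
have nx w i : Normc.normc (x w i) <= 2.
  apply: le_trans (le_normcD _ _) _; rewrite normcN normc_real ger0_norm//.
  by rewrite [leRHS](_ : _ = 1 + 1)// lerD.
have p4 i : p i <= 4.
  apply: mean_le; first exact: bmeas_normc2.
  move=> w; rewrite (_ : 4 = 2 ^+ 2); last by ring.
  by rewrite ler_sqr ?nnegrE ?normc_ge0.
have p0 i : 0 <= p i by apply: mean_ge0 => w; rewrite sqr_ge0.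
have s_ge0 i : 0 <= s i by apply: sumr_ge0 => j _.
pose de w i := complex.Re (defect w i * (- kappa%:C + 1 * (k w i)^*%C)).
have pt w i : Normc.normc (x w i) ^+ 2 <= - de w i + 2 * eps * `|s i - 1| +
    eps / 2 * (s i * Normc.normc (x w i) ^+ 2 + \sum_j s2 i j * Normc.normc (x w j) ^+ 2).
  have sumx : \sum_j (s2 i j)%:C * k w j = (s i * kappa)%:C + \sum_j (s2 i j)%:C * x w j.
    rewrite rmorphM /s rmorph_sum mulr_suml -big_split /=; apply: eq_bigr => j _.
    by rewrite /x mulrBr addrC subrK.
  have xc : - kappa%:C + 1 * (k w i)^*%C = (x w i)^*%C.
    by rewrite mul1r addrC /x rmorphB /= oppr0.
  (* The equation satisfied by [kappa] removes the constant part, except where the row sum differs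
     from 1. *)
  have defE : defect w i = (eps * kappa ^+ 2 * (1 - s i))%:C -
      (1 + eps * kappa * s i)%:C * x w i - eps%:C * (k w i * \sum_j (s2 i j)%:C * x w j).
    rewrite /defect sumx.
    have -> : k w i = kappa%:C + x w i by rewrite /x addrC subrK.
    have k2 : (kappa%:C : R[i]) = 1 - eps%:C * kappa%:C ^+ 2.
      have -> : 1 - eps%:C * kappa%:C ^+ 2 = (1 - eps * kappa ^+ 2)%:C by rewrite !expr2; simpc.
      by rewrite -kapE.
    rewrite {1}k2 !(rmorphM, rmorphD, rmorphB, rmorphN, rmorphXn, rmorph1) /=.
    by ring.
  have deE : de w i = eps * kappa ^+ 2 * (1 - s i) * complex.Re (x w i) -
      (1 + eps * kappa * s i) * Normc.normc (x w i) ^+ 2 -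
      eps * \sum_j s2 i j * complex.Re (k w i * x w j * (x w i)^*%C).
    rewrite /de xc defE !mulrBl -[_ * x w i * _]mulrA mulcJ_normc.
    have -> : eps%:C * (k w i * \sum_j (s2 i j)%:C * x w j) * (x w i)^*%C =
        eps%:C * \sum_j (s2 i j)%:C * (k w i * x w j * (x w i)^*%C).
      rewrite -mulrA; congr (_ * _); rewrite mulr_sumr mulr_suml; apply: eq_bigr => j _.
      by ring.
    have ReM (a : R) (z : R[i]) : complex.Re (a%:C * z) = a * complex.Re z.
      by case: z => z1 z2 /=; rewrite mul0r subr0.
    have ReB (y z : R[i]) : complex.Re (y - z) = complex.Re y - complex.Re z.
      by case: y; case: z.
    have ReJ (z : R[i]) : complex.Re z^*%C = complex.Re z by case: z.
    rewrite !ReB !ReM ReJ Re_sum; congr (_ - _ - _ * _); first by rewrite /x ReB.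
    by apply: eq_bigr => j _; rewrite ReM.
  have h1 : `|eps * kappa ^+ 2 * (1 - s i) * complex.Re (x w i)| <= 2 * eps * `|s i - 1|.
    have gen (c y z : R) : 0 <= c -> c <= eps -> `|z| <= 2 ->
        `|c * (1 - y) * z| <= 2 * eps * `|y - 1|.
      move=> c0 ce z2; rewrite !normrM (ger0_norm c0) (distrC 1).
      rewrite [leRHS](_ : _ = eps * `|y - 1| * 2); last by ring.
      by apply: ler_pM => //; [rewrite mulr_ge0|rewrite ler_wpM2r].
    apply: gen; first by rewrite mulr_ge0 ?sqr_ge0// ltW.
      by rewrite ger_pMr// expr_le1.
    exact: le_trans (ge_Re_normc _) _.
  have h2 : `|\sum_j s2 i j * complex.Re (k w i * x w j * (x w i)^*%C)| <=
      2^-1 * (s i * Normc.normc (x w i) ^+ 2 + \sum_j s2 i j * Normc.normc (x w j) ^+ 2).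
    apply: le_trans (ler_norm_sum _ _ _) _.
    rewrite /s mulr_suml -big_split mulr_sumr /=; apply: ler_sum => j _.
    rewrite normrM ger0_norm// -mulrDr mulrCA; apply: ler_wpM2l => //.
    apply: le_trans (ge_Re_normc _) _; rewrite Normc.normcM normc_conj Normc.normcM.
    set y := Normc.normc (x w j); set z := Normc.normc (x w i).
    apply: (@le_trans _ _ (1 * y * z)).
      by rewrite ler_wpM2r ?normc_ge0// ler_wpM2r ?normc_ge0.
    by have := sqr_ge0 (y - z); rewrite sqrrB; lra.
  have h3 : 0 <= eps * kappa * s i * Normc.normc (x w i) ^+ 2.
    apply: mulr_ge0; last exact: sqr_ge0.
    by apply: mulr_ge0 => //; apply: mulr_ge0 => //; exact: ltW.
  move: h1 h2; rewrite deE !ler_norml => /andP[h1 h1'] /andP[h2 h2'].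
  set q := Normc.normc (x w i) ^+ 2 in h3 *; set S := \sum_j _ in h2 h2' *.
  have h4 := ler_wpM2l (ltW eps_gt0) h2.
  by move: h1 h1' h3 h4; rewrite -/q; lra.
have pi i : p i <= `|mean P (de ^~ i)| + 2 * eps * `|s i - 1| +
    eps / 2 * (s i * p i + \sum_j s2 i j * p j).
  have bde : bounded_measurable (de ^~ i).
    apply: bmeas_Re; apply: bcmeasM; first exact: bcmeas_defect.
    apply: bcmeasD; first exact: bcmeas_cst.
    by apply: bcmeasM; [exact: bcmeas_cst|apply: bcmeas_conj; exact: bcmeas_diag].
  have bM c f : bounded_measurable f -> bounded_measurable (fun w : T => c * f w).
    by move=> bf; apply: bmeasM => //; exact: bmeas_cst.
  have bp j := bmeas_normc2 (bcx j).
  have bs : bounded_measurable (fun w => \sum_j s2 i j * Normc.normc (x w j) ^+ 2).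
    by apply: bmeas_sum => j _; exact: bM.
  apply: (@le_trans _ _ (mean P (fun w => - de w i + 2 * eps * `|s i - 1| +
    eps / 2 * (s i * Normc.normc (x w i) ^+ 2 + \sum_j s2 i j * Normc.normc (x w j) ^+ 2)))).
    apply: le_mean; [exact: bp| |by move=> w; exact: pt].
    apply: bmeasD; first by apply: bmeasD; [exact: bmeasN|exact: bmeas_cst].
    by apply: (bM _); apply: bmeasD => //; exact: bM.
  rewrite meanD; [|by apply: bmeasD; [exact: bmeasN|exact: bmeas_cst]|by apply: (bM _); apply: bmeasD => //; exact: bM].
  rewrite meanD; [|exact: bmeasN|exact: bmeas_cst].
  rewrite mean_cst meanN// meanZ; last by apply: bmeasD => //; exact: bM.
  rewrite meanD//; last exact: bM.
  rewrite meanZ// mean_sum => [|j _]; last exact: bM.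
  under eq_bigr do rewrite meanZ//.
  by rewrite lerD2r lerD2r -normrN ler_norm.
have sum_p : \sum_i p i <= \sum_i `|mean P (de ^~ i)| + 2 * eps * (\sum_i `|s i - 1|) +
    eps * \sum_i s i * p i.
  apply: (@le_trans _ _ (\sum_i (`|mean P (de ^~ i)| + 2 * eps * `|s i - 1| +
      eps / 2 * (s i * p i + \sum_j s2 i j * p j)))).
    by apply: ler_sum => i _; exact: pi.
  rewrite !big_split /= -!mulr_sumr big_split /= [X in _ + eps / 2 * (_ + X)]exchange_big /=.
  have -> : \sum_j \sum_i s2 i j * p j = \sum_i s i * p i.
    by apply: eq_bigr => j _; rewrite /s mulr_suml; apply: eq_bigr => i _; rewrite trunc_varC.
  by set B := \sum_i s i * p i; rewrite -[eps / 2 * _]mulrA [2^-1 * _](_ : _ = B)//; field.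
(* Replacing s_i by 1 costs |s_i - 1| p_i with p_i <= 4; with the earlier coefficient 2 this makes
   the 6 of the statement. *)
have sum_sp : \sum_i s i * p i <= \sum_i p i + 4 * \sum_i `|s i - 1|.
  rewrite mulr_sumr -big_split /=; apply: ler_sum => i _.
  have : (s i - 1) * p i <= 4 * `|s i - 1|.
    rewrite mulrC; apply: (@le_trans _ _ (p i * `|s i - 1|)).
      by rewrite ler_wpM2l// ler_norm.
    by rewrite ler_wpM2r.
  by rewrite mulrBl mul1r; lra.
have := ler_wpM2l (ltW eps_gt0) sum_sp.
rewrite -/(\sum_i p i) -/(\sum_i `|s i - 1|).
move: sum_p; set A := \sum_i `|mean _ _|; set B := \sum_i `|_ - 1|.
by set C := \sum_i s i * p i; set D := \sum_i p i; lra.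
Qed.

Lemma mean_theta i :
  mean P (fun w => complex.Re (1 - k w i)) =
  eps * (\sum_j s2 i j * mean P (fun w => complex.Re (k w i * k w j))) +
  mean P (fun w => complex.Re (defect w i * (1 + 0 * (k w i)^*%C))).
Proof.
have bk j := bcmeas_diag j.
have bM c f : bounded_measurable f -> bounded_measurable (fun w : T => c * f w).
  by move=> bf; apply: bmeasM => //; exact: bmeas_cst.
have bkk j : bounded_measurable (fun w => complex.Re (k w i * k w j)).
  by apply: bmeas_Re; exact: bcmeasM.
have bs : bounded_measurable (fun w => \sum_j s2 i j * complex.Re (k w i * k w j)).
  by apply: bmeas_sum => j _; exact: bM.
have bd : bounded_measurable (fun w => complex.Re (defect w i * (1 + 0 * (k w i)^*%C))).
  apply: bmeas_Re; apply: bcmeasM; first exact: bcmeas_defect.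
  apply: bcmeasD; first exact: bcmeas_cst.
  by apply: bcmeasM; [exact: bcmeas_cst|exact: bcmeas_conj].
have -> : \sum_j s2 i j * mean P (fun w => complex.Re (k w i * k w j)) =
    mean P (fun w => \sum_j s2 i j * complex.Re (k w i * k w j)).
  by rewrite mean_sum => [|j _]; [apply: eq_bigr => j _; rewrite meanZ|exact: bM].
rewrite -meanZ// -meanD//; last exact: bM.
congr mean; apply/funext => w.
have ReM (a : R) (z : R[i]) : complex.Re (a%:C * z) = a * complex.Re z.
  by case: z => z1 z2 /=; rewrite mul0r subr0.
rewrite mul0r addr0 mulr1 /defect.
have -> : eps%:C * k w i * (\sum_j (s2 i j)%:C * k w j) =
    eps%:C * \sum_j (s2 i j)%:C * (k w i * k w j).
  by rewrite -mulrA mulr_sumr; congr (_ * _); apply: eq_bigr => j _; rewrite mulrCA.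
have ReB (y z : R[i]) : complex.Re (y - z) = complex.Re y - complex.Re z.
  by case: y; case: z.
rewrite [in RHS]ReB ReM Re_sum; under [X in _ = _ + (_ - _ * X)]eq_bigr do rewrite ReM.
by rewrite [RHS]addrC subrK.
Qed.

(** The test function is conj (1 - k_i). As 1 - k_i is eps k_i sum_j s_ij k_j plus the defect and
    all |k_j| <= 1, the main term is at most eps s_i |1 - k_i|, half of whose square bound is
    absorbed on the left. *)
Lemma mean_theta_sqr i :
  mean P (fun w => Normc.normc (1 - k w i) ^+ 2) <=
  eps ^+ 2 * (\sum_j s2 i j) ^+ 2 +
  2 * `|mean P (fun w => complex.Re (defect w i * (1 + - 1 * (k w i)^*%C)))|.
Proof.
pose s := \sum_j s2 i j; pose x w := Normc.normc (1 - k w i).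
pose de w := complex.Re (defect w i * (1 + - 1 * (k w i)^*%C)).
have s_ge0 : 0 <= s by apply: sumr_ge0 => j _.
have pt w : x w ^+ 2 <= eps ^+ 2 * s ^+ 2 + 2 * de w.
  have c1 : 1 + - 1 * (k w i)^*%C = (1 - k w i)^*%C.
    by rewrite mulN1r rmorphB /= oppr0.
  have E : 1 - k w i = eps%:C * k w i * (\sum_j (s2 i j)%:C * k w j) + defect w i.
    by rewrite /defect [RHS]addrC subrK.
  have E2 : x w ^+ 2 = complex.Re (eps%:C * k w i * (\sum_j (s2 i j)%:C * k w j) * (1 - k w i)^*%C) + de w.
    have -> : x w ^+ 2 = complex.Re ((1 - k w i) * (1 - k w i)^*%C) by rewrite mulcJ_normc.
    rewrite {1}E mulrDl /de c1.
    by case: (_ * (1 - k w i)^*%C) => ? ?; case: (_ * (1 - k w i)^*%C) => ? ?.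
  have nsum : Normc.normc (\sum_j (s2 i j)%:C * k w j) <= s.
    apply: le_trans (normc_sum _ _ _) _; apply: ler_sum => j _.
    by rewrite Normc.normcM normc_real ger0_norm// ler_piMr.
  have h : complex.Re (eps%:C * k w i * (\sum_j (s2 i j)%:C * k w j) * (1 - k w i)^*%C) <= eps * s * x w.
    apply: le_trans (ler_norm _) _; apply: le_trans (ge_Re_normc _) _.
    rewrite /x; move: (k w i) (normc_k_le1 w i) => kk kn.
    rewrite !Normc.normcM normc_conj normc_real ger0_norm ?(ltW eps_gt0)//.
    apply: ler_wpM2r; first exact: normc_ge0.
    rewrite -mulrA; apply: ler_wpM2l; first exact: ltW.
    by rewrite -[s]mul1r; apply: ler_pM; rewrite ?normc_ge0.
  have := sqr_ge0 (eps * s - x w); rewrite sqrrB exprMn; lra.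
have bde : bounded_measurable de.
  apply: bmeas_Re; apply: bcmeasM; first exact: bcmeas_defect.
  apply: bcmeasD; first exact: bcmeas_cst.
  by apply: bcmeasM; [exact: bcmeas_cst|apply: bcmeas_conj; exact: bcmeas_diag].
have bde2 : bounded_measurable (fun w => 2 * de w).
  by apply: bmeasM => //; exact: bmeas_cst.
apply: (@le_trans _ _ (mean P (fun w => eps ^+ 2 * s ^+ 2 + 2 * de w))).
  apply: le_mean => //; last by apply: bmeasD => //; exact: bmeas_cst.
  by apply: bmeas_normc2; apply: bcmeasB; [exact: bcmeas_cst|exact: bcmeas_diag].
rewrite meanD//; last exact: bmeas_cst.
by rewrite mean_cst meanZ// lerD2l ler_wpM2l// ler_norm.
Qed.

(** The disc |k|^2 <= Re k is invariant under k |-> 1 - k, which gives |1 - k|^2 <= Re (1 - k). *)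
Lemma theta_range i :
  let r := mean P (fun w => complex.Re (1 - k w i)) in
  let q := mean P (fun w => Normc.normc (1 - k w i) ^+ 2) in
  0 <= q /\ q <= r /\ r <= 1.
Proof.
move=> r q.
have bx : bcmeas (fun w => 1 - k w i).
  by apply: bcmeasB; [exact: bcmeas_cst|exact: bcmeas_diag].
have E w : complex.Re (1 - k w i) = 1 - complex.Re (k w i) by case: (k w i).
have Re0 w : 0 <= complex.Re (k w i) by apply: le_trans (normc_k2 w i); rewrite sqr_ge0.
split; first by apply: mean_ge0 => w; rewrite sqr_ge0.
split; last first.
  by apply: mean_le; [exact: bmeas_Re|move=> w; rewrite E gerBl].
apply: le_mean; [exact: bmeas_normc2|exact: bmeas_Re|move=> w].
have := normc_k2 w i; rewrite !normc_sqr E.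
by case: (k w i) => a b /=; rewrite sub0r sqrrN sqrrB expr1n; lra.
Qed.

(** With theta = 1 - k, the product k_i k_j is 1 - theta_i - theta_j + theta_i theta_j. The last
    bound involves only theta_i, by Re (k_i k_j) >= - |theta_i|; it serves when column j has a large
    sum and nothing is known about theta_j. *)
Lemma mean_kk_bounds i j :
  let r i := mean P (fun w => complex.Re (1 - k w i)) in
  let q i := mean P (fun w => Normc.normc (1 - k w i) ^+ 2) in
  let e := mean P (fun w => complex.Re (k w i * k w j)) in
  [/\ 1 - r i - r j - (q i + q j) / 2 <= e,
      e <= 1 - r i - r j + (q i + q j) / 2, e <= 1 &
      forall b, 0 < b -> - (b + q i / b) <= e].
Proof.
move=> r q e.
have bk l := bcmeas_diag l.
have bx l : bcmeas (fun w => 1 - k w l) by apply: bcmeasB => //; exact: bcmeas_cst.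
have be : bounded_measurable (fun w => complex.Re (k w i * k w j)).
  by apply: bmeas_Re; exact: bcmeasM.
have bM c f : bounded_measurable f -> bounded_measurable (fun w : T => c * f w).
  by move=> bf; apply: bmeasM => //; exact: bmeas_cst.
have br l := bmeas_Re (bx l); have bq l := bmeas_normc2 (bx l).
have bb c : bounded_measurable (fun w => (1 - complex.Re (1 - k w i)) - complex.Re (1 - k w j) +
    c * (Normc.normc (1 - k w i) ^+ 2 + Normc.normc (1 - k w j) ^+ 2)).
  apply: bmeasD; last by apply: bM; exact: bmeasD.
  by apply: bmeasB => //; apply: bmeasB => //; exact: bmeas_cst.
have bbE c : mean P (fun w => (1 - complex.Re (1 - k w i)) - complex.Re (1 - k w j) +
    c * (Normc.normc (1 - k w i) ^+ 2 + Normc.normc (1 - k w j) ^+ 2)) =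
    1 - r i - r j + c * (q i + q j).
  rewrite meanD; [|by apply: bmeasB => //; apply: bmeasB => //; exact: bmeas_cst|by apply: bM; exact: bmeasD].
  rewrite meanB//; last by apply: bmeasB => //; exact: bmeas_cst.
  rewrite meanB//; last exact: bmeas_cst.
  by rewrite mean_cst meanZ ?meanD//; exact: bmeasD.
have pt w : `|complex.Re (k w i * k w j) - ((1 - complex.Re (1 - k w i)) - complex.Re (1 - k w j))| <=
    2^-1 * (Normc.normc (1 - k w i) ^+ 2 + Normc.normc (1 - k w j) ^+ 2).
  have -> : complex.Re (k w i * k w j) - ((1 - complex.Re (1 - k w i)) - complex.Re (1 - k w j)) =
      complex.Re ((1 - k w i) * (1 - k w j)).
    by case: (k w i) => ? ?; case: (k w j) => ? ? /=; ring.
  apply: le_trans (ge_Re_normc _) _; rewrite Normc.normcM.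
  set y := Normc.normc _; set z := Normc.normc _.
  by have := sqr_ge0 (y - z); rewrite sqrrB; lra.
split.
- rewrite (_ : _ - _ / 2 = 1 - r i - r j + (- 2^-1) * (q i + q j)); last by ring.
  rewrite -bbE; apply: le_mean => // w.
  by have := pt w; rewrite ler_norml => /andP[h _]; lra.
- rewrite mulrC -bbE; apply: le_mean => // w.
  by have := pt w; rewrite ler_norml => /andP[_ h]; lra.
- apply: mean_le => // w; apply: le_trans (ler_norm _) _.
  apply: le_trans (ge_Re_normc _) _; rewrite Normc.normcM -[leRHS]mul1r.
  by apply: ler_pM; rewrite ?normc_ge0.
- move=> b b0.
  have bb2 : bounded_measurable (fun w => - (b + b^-1 * Normc.normc (1 - k w i) ^+ 2)).
    by apply: bmeasN; apply: bmeasD; [exact: bmeas_cst|exact: bM].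
  have -> : - (b + q i / b) = mean P (fun w => - (b + b^-1 * Normc.normc (1 - k w i) ^+ 2)).
    rewrite meanN; last by apply: bmeasD; [exact: bmeas_cst|exact: bM].
    by rewrite meanD ?mean_cst ?meanZ ?[b^-1 * _]mulrC//; [exact: bmeas_cst|exact: bM].
  apply: le_mean => // w.
  have h1 : - Normc.normc (1 - k w i) <= complex.Re (k w i * k w j).
    have -> : complex.Re (k w i * k w j) = complex.Re (k w j) - complex.Re ((1 - k w i) * k w j).
      by case: (k w i) => ? ?; case: (k w j) => ? ? /=; ring.
    have : complex.Re ((1 - k w i) * k w j) <= Normc.normc (1 - k w i).
      apply: le_trans (ler_norm _) _; apply: le_trans (ge_Re_normc _) _.
      by rewrite Normc.normcM ler_piMr// normc_ge0.
    have : 0 <= complex.Re (k w j) by apply: le_trans (normc_k2 w j); rewrite sqr_ge0.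
    by lra.
  apply: le_trans h1; rewrite lerN2; set y := Normc.normc _.
  have : 0 <= b^-1 * ((b - y / 2) ^+ 2 + 3 / 4 * y ^+ 2).
    by rewrite mulr_ge0 ?invr_ge0 ?(ltW b0)// addr_ge0 ?sqr_ge0// mulr_ge0 ?sqr_ge0.
  have -> : b^-1 * ((b - y / 2) ^+ 2 + 3 / 4 * y ^+ 2) = b + b^-1 * y ^+ 2 - y.
    by field; rewrite gt_eqF.
  by lra.
Qed.

End Defect.

(** * Row sums of the variances *)

Section RowSums.
Context (R : realType) (N : nat).
Variables (s2 : 'I_N -> 'I_N -> R) (K : R).
Hypothesis s2_ge0 : forall i j, 0 <= s2 i j.
Hypothesis s2C : forall i j, s2 i j = s2 j i.
Hypothesis K_ge1 : 1 <= K.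

Definition row_sum i := \sum_j s2 i j.
Definition good := [pred i | row_sum i <= K].
(** Large columns are discarded as well, so that the quadratic estimates only involve pairs with
    both row sums at most [K]. *)
Definition good_row_sum i := \sum_(j | good j) s2 i j.

Let S := \sum_i row_sum i.
Let B := \sum_(i | ~~ good i) row_sum i.

Lemma row_sum_ge0 i : 0 <= row_sum i.
Proof. by apply: sumr_ge0. Qed.

Lemma good_row_sum_ge0 i : 0 <= good_row_sum i.
Proof. by apply: sumr_ge0. Qed.

Lemma good_row_sum_le i : good_row_sum i <= row_sum i.
Proof. by rewrite /row_sum (bigID good)/= lerDl sumr_ge0. Qed.

(** By symmetry the mass lying in large columns is part of the mass lying in large rows. *)
Lemma bad_columns_le (Q : pred 'I_N) :
  \sum_(i | Q i) \sum_(j | ~~ good j) s2 i j <= B.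
Proof.
rewrite exchange_big /=; apply: ler_sum => j _.
under eq_bigr do rewrite s2C.
by rewrite /row_sum [leRHS](bigID Q) /= lerDl sumr_ge0.
Qed.

Lemma sum_good_row_sum : S - 2 * B <= \sum_(i | good i) good_row_sum i.
Proof.
have -> : S = \sum_(i | good i) good_row_sum i +
    \sum_(i | good i) \sum_(j | ~~ good j) s2 i j + B.
  rewrite /S (bigID good) /= -big_split /=; congr (_ + _); apply: eq_bigr => i _.
  by rewrite /row_sum (bigID good).
by have := bad_columns_le good; lra.
Qed.

(** On good rows |x| <= g + x^2 / g is applied to x = [good_row_sum] - 1, and expanding the square
    leaves the second moment and the total mass; on bad rows 1 <= K bounds the deviation by the row
    sum itself. *)
Lemma row_sum_deviation g : 0 < g ->
  \sum_i `|row_sum i - 1| <= g * N%:R +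
    g^-1 * (\sum_(i | good i) good_row_sum i ^+ 2 - 2 * S + 4 * B + N%:R) + 3 * B.
Proof.
move=> g0; rewrite (bigID good) /=.
have bad : \sum_(i | ~~ good i) `|row_sum i - 1| <= 2 * B.
  rewrite mulr_sumr; apply: ler_sum => i; rewrite -ltNge => Ki.
  have r1 : 1 <= row_sum i by apply: le_trans K_ge1 (ltW Ki).
  by rewrite ger0_norm ?subr_ge0//; lra.
have amgm (x : R) : `|x| <= g + g^-1 * x ^+ 2.
  rewrite -subr_ge0 -[x ^+ 2](real_normK (num_real x)); set y := `|x|.
  have -> : g + g^-1 * y ^+ 2 - y = g^-1 * ((g - y / 2) ^+ 2 + 3 / 4 * y ^+ 2).
    by field; rewrite gt_eqF.
  by rewrite mulr_ge0 ?invr_ge0 ?(ltW g0)// addr_ge0 ?sqr_ge0// mulr_ge0 ?sqr_ge0.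
have goodb : \sum_(i | good i) `|row_sum i - 1| <=
    \sum_(i | good i) (g + g^-1 * (good_row_sum i ^+ 2 - 2 * good_row_sum i + 1)) + B.
  apply: (@le_trans _ _ (\sum_(i | good i) (g + g^-1 * (good_row_sum i ^+ 2 - 2 * good_row_sum i + 1)) +
      \sum_(i | good i) \sum_(j | ~~ good j) s2 i j)); last first.
    by rewrite lerD2l; exact: bad_columns_le.
  rewrite -big_split /=; apply: ler_sum => i _.
  have -> : row_sum i - 1 = (good_row_sum i - 1) + \sum_(j | ~~ good j) s2 i j.
    by rewrite /row_sum (bigID good) /= addrAC.
  apply: le_trans (ler_normD _ _) _; rewrite [X in _ + X]ger0_norm ?sumr_ge0// lerD2r.
  by apply: le_trans (amgm _) _; rewrite sqrrB expr1n mulr1 [2 * _]mulr_natl.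
have card : (#|good|%:R : R) <= N%:R by rewrite ler_nat -[leqRHS]card_ord max_card.
have gi : 0 <= g^-1 by rewrite invr_ge0 ltW.
have E : \sum_(i | good i) (g + g^-1 * (good_row_sum i ^+ 2 - 2 * good_row_sum i + 1)) =
    g * #|good|%:R + g^-1 * (\sum_(i | good i) good_row_sum i ^+ 2 -
      2 * \sum_(i | good i) good_row_sum i + #|good|%:R).
  rewrite big_split sumr_const -mulr_sumr -[g *+ _]mulr_natr; congr (_ + _ * _).
  by rewrite !big_split sumrN -mulr_sumr sumr_const.
have h1 := ler_wpM2l (ltW g0) card.
have : g^-1 * (\sum_(i | good i) good_row_sum i ^+ 2 -
      2 * \sum_(i | good i) good_row_sum i + #|good|%:R) <=
    g^-1 * (\sum_(i | good i) good_row_sum i ^+ 2 - 2 * S + 4 * B + N%:R).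
  by apply: ler_wpM2l => //; have := sum_good_row_sum; lra.
by move: goodb; rewrite E; lra.
Qed.

(** Here r_i, q_i and e_ij stand for the means of Re (1 - k_i), |1 - k_i|^2 and Re (k_i k_j), and
    x_i, y_i for the moduli of the mean real parts of the defect tested against 1 and 1 - conj k_i.
    From here on only these inequalities are used. *)
Variables (r q x y : 'I_N -> R) (e : 'I_N -> 'I_N -> R) (eps : R).
Hypothesis eps_gt0 : 0 < eps.
Hypothesis rE : forall i, `|r i - eps * \sum_j s2 i j * e i j| <= x i.
Hypothesis qr : forall i, 0 <= q i /\ q i <= r i /\ r i <= 1.
Hypothesis qE : forall i, q i <= eps ^+ 2 * row_sum i ^+ 2 + 2 * y i.
Hypothesis e_ge : forall i j, 1 - r i - r j - (q i + q j) / 2 <= e i j.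
Hypothesis e_le1 : forall i j, e i j <= 1.
Hypothesis e_ge2 : forall i j b, 0 < b -> - (b + q i / b) <= e i j.

Let X := \sum_i x i.
Let Y := \sum_i y i.
Let T := \sum_i r i.

Let K_gt0 : 0 < K. Proof. exact: lt_le_trans K_ge1. Qed.

Let x_ge0 i : 0 <= x i.
Proof. by apply: le_trans (rE i). Qed.

Let E := \sum_i \sum_j s2 i j * e i j.

Let TE : `|T - eps * E| <= X.
Proof.
rewrite /T /E mulr_sumr -sumrB; apply: le_trans (ler_norm_sum _ _ _) _.
exact: ler_sum.
Qed.

Let SE : S - E = \sum_i \sum_j s2 i j * (1 - e i j).
Proof.
rewrite /S /E -sumrB; apply: eq_bigr => i _; rewrite /row_sum -sumrB.
by apply: eq_bigr => j _; rewrite mulrBr mulr1.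
Qed.

(** Summing the first order relation gives T ~ eps E, and E <= S because no e_ij exceeds 1. *)
Lemma total_variance_ge : T - X <= eps * S.
Proof.
have : 0 <= S - E.
  rewrite SE; apply: sumr_ge0 => i _; apply: sumr_ge0 => j _.
  by rewrite mulr_ge0// subr_ge0.
move=> h; have := ler_wpM2l (ltW eps_gt0) h.
by have := TE; rewrite ler_norml mulr0 => /andP[h1 h2]; lra.
Qed.

(** The loss is S - E = sum s_ij (1 - e_ij). On good pairs 1 - e_ij <= 3/2 (r_i + r_j), which the
    row bound [K] turns into a multiple of K T; on the other pairs 1 - e_ij <= 3 and the mass is
    controlled by B. *)
Lemma total_variance_le : eps * S <= T + X + eps * (3 * K * T + 8 * B).
Proof.
have e_ge_m2 i j : 1 - e i j <= 3.
  by have := e_ge2 i j (ltr01); have [q0 [qr0 r1]] := qr i; rewrite divr1; lra.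
have split2 (f : 'I_N -> 'I_N -> R) : \sum_i \sum_j f i j =
    \sum_(i | good i) \sum_(j | good j) f i j +
    \sum_(i | good i) \sum_(j | ~~ good j) f i j +
    \sum_(i | ~~ good i) \sum_j f i j.
  rewrite (bigID good) /= -big_split /=; congr (_ + _); apply: eq_bigr => i _.
  by rewrite (bigID good).
have g1 : \sum_(i | good i) \sum_(j | good j) s2 i j * (1 - e i j) <= 3 * K * T.
  apply: (@le_trans _ _ (\sum_(i | good i) \sum_(j | good j) s2 i j * (3 / 2 * (r i + r j)))).
    apply: ler_sum => i _; apply: ler_sum => j _; apply: ler_wpM2l => //.
    have := e_ge i j; have [q0 [qr0 r1]] := qr i; have [q0' [qr0' r1']] := qr j; lra.
  have -> : \sum_(i | good i) \sum_(j | good j) s2 i j * (3 / 2 * (r i + r j)) =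
      3 * \sum_(i | good i) good_row_sum i * r i.
    transitivity (3 / 2 * (\sum_(i | good i) \sum_(j | good j) s2 i j * r i) +
        3 / 2 * (\sum_(i | good i) \sum_(j | good j) s2 i j * r j)).
      rewrite !mulr_sumr -big_split /=; apply: eq_bigr => i _.
      by rewrite !mulr_sumr -big_split /=; apply: eq_bigr => j _; ring.
    rewrite [X in _ + _ * X]exchange_big /=.
    under [X in _ + _ * X]eq_bigr do under eq_bigr do rewrite s2C.
    under [X in _ * X + _]eq_bigr do rewrite -mulr_suml.
    under [X in _ + _ * X]eq_bigr do rewrite -mulr_suml.
    by rewrite /good_row_sum -mulrDl; congr (_ * _); field.
  rewrite -mulrA; apply: ler_wpM2l => //; rewrite /T mulr_sumr [leRHS](bigID good) /=.
  apply: (@le_trans _ _ (\sum_(i | good i) K * r i)).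
    apply: ler_sum => i gi; have [q0 [qr0 r1]] := qr i.
    by rewrite ler_wpM2r ?(le_trans q0)// (le_trans (good_row_sum_le i)).
  rewrite lerDl; apply: sumr_ge0 => i _; have [q0 [qr0 r1]] := qr i.
  by rewrite mulr_ge0 ?(ltW K_gt0)// (le_trans q0).
have g2 : \sum_(i | good i) \sum_(j | ~~ good j) s2 i j * (1 - e i j) <= 3 * B.
  apply: (@le_trans _ _ (3 * \sum_(i | good i) \sum_(j | ~~ good j) s2 i j)).
    rewrite mulr_sumr; apply: ler_sum => i _; rewrite mulr_sumr; apply: ler_sum => j _.
    by rewrite mulrC ler_wpM2r.
  by rewrite ler_wpM2l// bad_columns_le.
have g3 : \sum_(i | ~~ good i) \sum_j s2 i j * (1 - e i j) <= 3 * B.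
  rewrite /B mulr_sumr; apply: ler_sum => i _; rewrite /row_sum mulr_sumr; apply: ler_sum => j _.
  by rewrite mulrC ler_wpM2r.
have B0 : 0 <= B by apply: sumr_ge0 => i _; exact: row_sum_ge0.
have : S - E <= 3 * K * T + 8 * B by rewrite SE split2; lra.
move=> h; have := ler_wpM2l (ltW eps_gt0) h.
by have := TE; rewrite ler_norml => /andP[h1 h2]; lra.
Qed.

Hypothesis y_ge0 : forall i, 0 <= y i.
Hypothesis e_le : forall i j, e i j <= 1 - r i - r j + (q i + q j) / 2.

(** The loss S - E is estimated twice. From above it is S - (T - X) / eps. From below, good pairs
    contribute sum_i g_i (2 r_i - q_i) with g_i the good row sum, and r_i is at least eps g_i up to
    second order, so that 2 eps sum_i g_i^2 appears. What remains is of order eps^2 or is a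
    defect. *)
Lemma good_second_moment :
  2 * eps * \sum_(i | good i) good_row_sum i ^+ 2 <=
  S - (T - X) / eps + 11 * eps ^+ 2 * K ^+ 3 * N%:R +
  (6 * eps * K ^+ 2 + 2 * K) * X + 6 * K * Y.
Proof.
have ep0 := ltW eps_gt0; have K0 := ltW K_gt0.
pose m i := \sum_(j | good j) s2 i j * x j.
have m0 i : 0 <= m i by apply: sumr_ge0 => j _; rewrite mulr_ge0.
have r_ge0 i : 0 <= r i by have [q0 [qr0 _]] := qr i; apply: le_trans qr0.
have r_le i : good i -> r i <= eps * K + x i.
  move=> gi; have := rE i; rewrite ler_norml => /andP[_ h].
  suff : eps * \sum_j s2 i j * e i j <= eps * K by lra.
  apply: ler_wpM2l => //; apply: le_trans gi; apply: ler_sum => j _.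
  by rewrite ler_piMr.
have r_ge i : good i -> eps * (good_row_sum i - 3 / 2 * (good_row_sum i * (2 * eps * K + x i) + m i)) -
    (eps ^+ 2 * K ^+ 2 + q i) - x i <= r i.
  move=> gi; have := rE i; rewrite ler_norml => /andP[h _].
  suff : eps * (good_row_sum i - 3 / 2 * (good_row_sum i * (2 * eps * K + x i) + m i) -
    K * (eps * K + q i / (eps * K))) <= eps * \sum_j s2 i j * e i j.
    have -> : eps * (good_row_sum i - 3 / 2 * (good_row_sum i * (2 * eps * K + x i) + m i) -
        K * (eps * K + q i / (eps * K))) =
        eps * (good_row_sum i - 3 / 2 * (good_row_sum i * (2 * eps * K + x i) + m i)) -
        (eps ^+ 2 * K ^+ 2 + q i) by field; rewrite !gt_eqF.
    by lra.
  apply: ler_wpM2l => //; rewrite [leRHS](bigID good) /=.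
  (* This is the parameter at which [e_ge2] is applied to the large columns: with b = eps K, their
     contribution after multiplication by eps is at most eps^2 K^2 + q_i, of second order. *)
  have b0 : 0 < eps * K by rewrite mulr_gt0.
  have c0 : 0 <= eps * K + q i / (eps * K).
    by have [q0 _] := qr i; rewrite addr_ge0 ?divr_ge0 ?(ltW b0).
  apply: lerD.
    have -> : good_row_sum i - 3 / 2 * (good_row_sum i * (2 * eps * K + x i) + m i) =
        \sum_(j | good j) s2 i j * (1 - 3 / 2 * (2 * eps * K + x i + x j)).
      have -> : \sum_(j | good j) s2 i j * (1 - 3 / 2 * (2 * eps * K + x i + x j)) =
        \sum_(j | good j) (s2 i j * (1 - 3 / 2 * (2 * eps * K + x i)) + (- (3 / 2)) * (s2 i j * x j)).
        by apply: eq_bigr => j _; ring.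
      by rewrite big_split /= -mulr_suml -mulr_sumr -/(m i) -/(good_row_sum i); ring.
    apply: ler_sum => j gj; apply: ler_wpM2l => //.
    have := e_ge i j; have := r_le i gi; have := r_le j gj.
    have [q0 [qr0 r1]] := qr i; have [q0' [qr0' r1']] := qr j.
    by move=> *; lra.
  rewrite -mulNr mulNr -mulrN.
  apply: (@le_trans _ _ (\sum_(j | ~~ good j) s2 i j * (- (eps * K + q i / (eps * K))))).
    rewrite -mulr_suml ler_wnM2r ?oppr_le0//.
    by apply: le_trans gi; rewrite /row_sum [leRHS](bigID good) /= lerDr sumr_ge0.
  by apply: ler_sum => j _; apply: ler_wpM2l => //; exact: e_ge2.
have lowSE : \sum_(i | good i) good_row_sum i * (2 * r i - q i) <= S - E.
  rewrite SE.
  have -> : \sum_(i | good i) good_row_sum i * (2 * r i - q i) =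
     \sum_(i | good i) \sum_(j | good j) s2 i j * (r i + r j - (q i + q j) / 2).
    transitivity (2^-1 * (\sum_(i | good i) \sum_(j | good j) s2 i j * (2 * r i - q i)) +
        2^-1 * (\sum_(i | good i) \sum_(j | good j) s2 i j * (2 * r j - q j))); last first.
      rewrite !mulr_sumr -big_split /=; apply: eq_bigr => i _.
      by rewrite !mulr_sumr -big_split /=; apply: eq_bigr => j _; field.
    rewrite [X in _ + _ * X]exchange_big /=.
    under [X in _ + _ * X]eq_bigr do under eq_bigr do rewrite s2C.
    under [X in _ = _ * X + _]eq_bigr do rewrite -mulr_suml.
    under [X in _ = _ + _ * X]eq_bigr do rewrite -mulr_suml.
    by rewrite /good_row_sum; field.
  rewrite [leRHS](bigID good) /= -[leLHS]addr0; apply: lerD; last first.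
    apply: sumr_ge0 => i _; apply: sumr_ge0 => j _.
    by rewrite mulr_ge0// subr_ge0.
  apply: ler_sum => i _; rewrite [leRHS](bigID good) /= -[leLHS]addr0; apply: lerD; last first.
    by apply: sumr_ge0 => j _; rewrite mulr_ge0// subr_ge0.
  by apply: ler_sum => j _; apply: ler_wpM2l => //; have := e_le i j; lra.
(* Twice the lower bound for r_i is multiplied by g_i <= K: 8 is 6 + 2, from the good and the large
   columns, and 3 K q_i collects 2 K q_i lost in r_i and the K q_i already present. *)
have per i : good i -> 2 * eps * good_row_sum i ^+ 2 <= good_row_sum i * (2 * r i - q i) +
    8 * eps ^+ 2 * K ^+ 3 + (3 * eps * K ^+ 2 + 2 * K) * x i + 3 * eps * K * m i + 3 * K * q i.
  move=> gi; set g := good_row_sum i.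
  have g0 : 0 <= g by exact: good_row_sum_ge0.
  have gK : g <= K by apply: le_trans gi; exact: good_row_sum_le.
  have g2 : g ^+ 2 <= K ^+ 2 by rewrite ler_sqr ?nnegrE.
  have [q0 _] := qr i.
  have h := ler_wpM2l g0 (r_ge i gi); rewrite -/g in h.
  have a1 : g ^+ 2 * (eps ^+ 2 * K) <= K ^+ 2 * (eps ^+ 2 * K).
    by rewrite ler_wpM2r// mulr_ge0// sqr_ge0.
  have a2 : g ^+ 2 * (eps * x i) <= K ^+ 2 * (eps * x i).
    by rewrite ler_wpM2r// mulr_ge0.
  have a3 : g * (eps * m i) <= K * (eps * m i) by rewrite ler_wpM2r// mulr_ge0.
  have a4 : g * (eps ^+ 2 * K ^+ 2) <= K * (eps ^+ 2 * K ^+ 2).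
    by rewrite ler_wpM2r// mulr_ge0// sqr_ge0.
  have a5 : g * q i <= K * q i by rewrite ler_wpM2r.
  have a6 : g * x i <= K * x i by rewrite ler_wpM2r.
  by lra.
have sumx : \sum_(i | good i) x i <= X.
  by rewrite /X [leRHS](bigID good) /= lerDl sumr_ge0.
have summ : \sum_(i | good i) m i <= K * X.
  apply: (@le_trans _ _ (K * \sum_(i | good i) x i)); last by rewrite ler_wpM2l.
  rewrite exchange_big /= mulr_sumr; apply: ler_sum => j gj.
  under eq_bigr do rewrite s2C; rewrite -mulr_suml ler_wpM2r//.
  by apply: le_trans gj; exact: good_row_sum_le.
have sumq : \sum_(i | good i) q i <= eps ^+ 2 * K ^+ 2 * N%:R + 2 * Y.
  apply: (@le_trans _ _ (\sum_i (eps ^+ 2 * K ^+ 2 + 2 * y i))); last first.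
    by rewrite big_split /= sumr_const card_ord mulr_natr mulr_sumr.
  rewrite [leRHS](bigID good) /= -[leLHS]addr0; apply: lerD; last first.
    by apply: sumr_ge0 => i _; rewrite addr_ge0 ?mulr_ge0 ?sqr_ge0.
  apply: ler_sum => i gi; apply: le_trans (qE i) _; rewrite lerD2r ler_wpM2l ?sqr_ge0//.
  by rewrite ler_sqr ?nnegrE ?row_sum_ge0.
have Ebound : S - E <= S - (T - X) / eps.
  have := TE; rewrite ler_norml => /andP[_ h].
  by rewrite lerD2l lerN2 ler_pdivrMr// mulrC; lra.
have card : (#|good|%:R : R) <= N%:R by rewrite ler_nat -[leqRHS]card_ord max_card.
have total : 2 * eps * \sum_(i | good i) good_row_sum i ^+ 2 <=
    \sum_(i | good i) good_row_sum i * (2 * r i - q i) + 8 * eps ^+ 2 * K ^+ 3 * #|good|%:R +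
    (3 * eps * K ^+ 2 + 2 * K) * \sum_(i | good i) x i + 3 * eps * K * \sum_(i | good i) m i +
    3 * K * \sum_(i | good i) q i.
  rewrite mulr_sumr; apply: le_trans (ler_sum _ (fun i gi => per i gi)) _.
  by rewrite !big_split sumr_const -!mulr_sumr (mulr_natr (8 * eps ^+ 2 * K ^+ 3)).
have b1 : 8 * eps ^+ 2 * K ^+ 3 * #|good|%:R <= 8 * eps ^+ 2 * K ^+ 3 * N%:R.
  by rewrite ler_wpM2l// !(mulr_ge0, exprn_ge0).
have b2 : (3 * eps * K ^+ 2 + 2 * K) * \sum_(i | good i) x i <= (3 * eps * K ^+ 2 + 2 * K) * X.
  by rewrite ler_wpM2l// !(addr_ge0, mulr_ge0, exprn_ge0).
have b3 : 3 * eps * K * \sum_(i | good i) m i <= 3 * eps * K * (K * X).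
  by rewrite ler_wpM2l// !(mulr_ge0, exprn_ge0).
have b4 : 3 * K * \sum_(i | good i) q i <= 3 * K * (eps ^+ 2 * K ^+ 2 * N%:R + 2 * Y).
  by rewrite ler_wpM2l// mulr_ge0.
apply: le_trans total _.
apply: le_trans (lerD (lerD (lerD (lerD (le_trans lowSE Ebound) b1) b2) b3) b4) _.
by rewrite le_eqVlt; apply/orP; left; apply/eqP; ring.
Qed.

End RowSums.

(** * Functions generated by the Cauchy kernels *)

Section Bernstein.
Variable R : realType.

(* [bernstein f n a] at [x] is the mean of [f (a + S)] where [S] is a sum of [n]
   independent Bernoulli variables of parameter [x]. *)
Fixpoint bernstein (f : nat -> R) n a : {poly R} :=
  if n is m.+1 then 'X * bernstein f m a.+1 + (1 - 'X) * bernstein f m a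
  else (f a)%:P.

(** For S binomial with parameters n and x, the mean of (a + S - b)^2 is (a + n x - b)^2 + n x (1 -
    x). The recursion on n reproduces this identity, so no binomial coefficient appears. *)
Lemma bernstein_approx (f : nat -> R) (c e m b x : R) n a :
  0 <= m -> 0 <= x -> x <= 1 ->
  (forall k, `|f k - c| <= e + m * (k%:R - b) ^+ 2) ->
  `|(bernstein f n a).[x] - c| <=
    e + m * ((a%:R + n%:R * x - b) ^+ 2 + n%:R * x * (1 - x)).
Proof.
move=> m_ge0 x_ge0 x_le1 fE; elim: n a => [|n IH] a /=.
  by rewrite hornerC !mul0r !addr0; exact: fE.
have := IH a.+1; have := IH a.
rewrite !hornerE -![_.+1%:R]natr1.
set p := (bernstein f n a).[x]; set q := (bernstein f n a.+1).[x].
move=> hp hq.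
have -> : x * q + (1 - x) * p - c = x * (q - c) + (1 - x) * (p - c) by ring.
apply: (le_trans (ler_normD _ _)); rewrite !normrM (ger0_norm x_ge0).
rewrite [`|1 - x|]ger0_norm ?subr_ge0//.
apply: (le_trans (lerD (ler_wpM2l x_ge0 hq) (ler_wpM2l _ hp))); first by rewrite subr_ge0.
by rewrite le_eqVlt; apply/orP; left; apply/eqP; ring.
Qed.

(** Uniform continuity in a form that can be averaged over a binomial variable. Close points are
    handled by e alone; for distant points m is taken so large that the quadratic term exceeds 2
    M. *)
Lemma quadratic_modulus (g : R -> R) (M e : R) :
  continuous g -> (forall x, 0 <= x <= 1 -> `|g x| <= M) -> 0 < e ->
  exists2 m, 0 < m & forall x y, 0 <= x <= 1 -> 0 <= y <= 1 ->
    `|g y - g x| <= e + m * (y - x) ^+ 2.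
Proof.
move=> gc gM e_gt0.
have M_ge0 : 0 <= M by apply: le_trans (gM 0 _) => //; rewrite lexx ler01.
have := @segment_compact R 0 1; move/compact_near_coveringP.
move=> /(_ R (+oo) (fun m x => 0 <= x <= 1 -> forall y, 0 <= y <= 1 ->
  `|g y - g x| <= e + m * (y - x) ^+ 2)).
case=> [x0|]; last first.
  move=> m [mr H]; exists (`|m| + 1); first by rewrite ltr_wpDl.
  move=> x y xI yI; apply: (H _ _ x _ xI y yI); last by rewrite /= in_itv.
  by apply: le_lt_trans (ler_norm m) _; rewrite ltrDl.
rewrite /= in_itv /= => x0I.
have /cvgrPdist_lt /(_ (e / 2)) := gc x0.
move=> /(_ ltac:(by rewrite divr_gt0)) [d /= d_gt0 H].
near=> x' m => /= x'I y yI.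
have m_gt : 8 * M / d ^+ 2 <= m.
  by near: m; apply: nbhs_pinfty_ge; rewrite num_real.
have x'd : `|x0 - x'| < d / 2.
  by near: x'; exists (d / 2) => //=; rewrite divr_gt0.
have [yx'|yx'] := ltP `|y - x'| (d / 2).
  have m_ge0 : 0 <= m by apply: le_trans m_gt; rewrite divr_ge0 ?sqr_ge0 ?mulr_ge0.
  have h1 : `|g x0 - g x'| < e / 2.
    by apply: H => /=; apply: lt_trans x'd _; rewrite gtr_pMr// invf_lt1 ?ltr1n.
  have h2 : `|g x0 - g y| < e / 2.
    apply: H => /=; rewrite (_ : x0 - y = (x0 - x') - (y - x')); last by ring.
    by apply: le_lt_trans (ler_normB _ _) _; rewrite [ltRHS](splitr d) ltrD.
  rewrite (_ : g y - g x' = (g x0 - g x') - (g x0 - g y)); last by ring.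
  apply: le_trans (ler_normB _ _) _; apply: (@le_trans _ _ e); last first.
    by rewrite lerDl mulr_ge0 ?sqr_ge0.
  by rewrite [leRHS](splitr e) lerD// ltW.
have sq : d ^+ 2 / 4 <= (y - x') ^+ 2.
  rewrite -(real_normK (num_real (y - x'))).
  have -> : d ^+ 2 / 4 = (d / 2) ^+ 2 by field.
  by rewrite ler_sqr ?nnegrE ?divr_ge0 ?(ltW d_gt0).
apply: (@le_trans _ _ (2 * M)).
  by rewrite mulr2n mulrDl !mul1r; apply: le_trans (ler_normB _ _) _; rewrite lerD ?gM.
apply: (@le_trans _ _ (m * (d ^+ 2 / 4))); last first.
  apply: ler_wpDl; first exact: ltW.
  by apply: ler_wpM2l => //; apply: le_trans m_gt; rewrite divr_ge0 ?sqr_ge0 ?mulr_ge0.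
have d2_gt0 : 0 < d ^+ 2 by rewrite exprn_gt0.
by move: m_gt; rewrite ler_pdivrMr//; lra.
Unshelve. all: by end_near.
Qed.

Lemma weierstrass (g : R -> R) (M e : R) :
  continuous g -> (forall x, 0 <= x <= 1 -> `|g x| <= M) -> 0 < e ->
  exists p : {poly R}, forall x, 0 <= x <= 1 -> `|g x - p.[x]| <= e.
Proof.
move=> gc gM e_gt0.
have [m m_gt0 H] := quadratic_modulus gc gM (divr_gt0 e_gt0 (ltr0n _ 2)).
pose n := (Num.truncn (2 * m / e)).+1.
have n_gt0 : 0 < n%:R :> R by rewrite ltr0n.
(* The minimum with 1 keeps the nodes in [0, 1] for every k, as [bernstein_approx] quantifies over
   all k. The number n is such that m / n <= e / 2. *)
exists (bernstein (fun k => g (Num.min (k%:R / n%:R) 1)) n 0) => x /andP[x_ge0 x_le1].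
rewrite distrC.
apply: le_trans (@bernstein_approx _ _ (e / 2) (m / n%:R ^+ 2) (n%:R * x) _ _ _ _ _ _ _) _ => //.
- by rewrite divr_ge0 ?sqr_ge0 ?ltW.
- move=> k; apply: (le_trans (H _ _ _ _)); rewrite ?x_ge0//.
    by rewrite le_min ler01 ge_min lexx orbT divr_ge0.
  rewrite lerD2l; apply: (@le_trans _ _ (m * (k%:R / n%:R - x) ^+ 2)); last first.
    by rewrite le_eqVlt; apply/orP; left; apply/eqP; field; exact: lt0r_neq0.
  apply: ler_wpM2l; first exact: ltW.
  rewrite /Num.min; case: ifPn => //; rewrite -leNgt => k_ge.
  by rewrite ler_sqr ?nnegrE ?subr_ge0 ?(le_trans x_le1)// lerB.
rewrite [leRHS](splitr e) lerD2l add0r subrr expr0n add0r.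
apply: (@le_trans _ _ (m / n%:R)).
  rewrite (_ : m / n%:R ^+ 2 * _ = m / n%:R * (x * (1 - x))); last first.
    by field; exact: lt0r_neq0.
  rewrite ler_piMr ?divr_ge0 ?ltW//; nra.
rewrite ler_pdivrMr// mulrC -ler_pdivrMr ?divr_gt0//.
have -> : m / (e / 2) = 2 * m / e by field; exact: lt0r_neq0.
by rewrite ltW// truncnS_gt.
Qed.

End Bernstein.

(** * Function classes closed under linear combinations and uniform limits *)

Section ResolventClass.
Variable R : realType.
Implicit Types (f g F : R -> R) (s t x : R).

Lemma continuousM' f g : continuous f -> continuous g -> continuous (fun x => f x * g x).
Proof. by move=> fc gc x; apply: cvgM; [exact: fc|exact: gc]. Qed.

Lemma continuousD' f g : continuous f -> continuous g -> continuous (fun x => f x + g x).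
Proof. by move=> fc gc x; apply: cvgD; [exact: fc|exact: gc]. Qed.

Lemma continuousV' f : continuous f -> (forall x, f x != 0) -> continuous (fun x => (f x)^-1).
Proof. by move=> fc f0 x; apply: cvgV; [exact: f0|exact: fc]. Qed.

Lemma continuous_cst' (c : R) : continuous (fun _ : R => c).
Proof. by move=> x; exact: cvg_cst. Qed.

Lemma continuousX' f n : continuous f -> continuous (fun x => f x ^+ n).
Proof. move=> fc; elim: n => [|n IH]; first by under eq_fun do rewrite expr0; exact: continuous_cst'.
by under eq_fun do rewrite exprS; exact: continuousM'.
Qed.

Lemma continuous_id' : continuous (fun x : R => x).
Proof. by move=> x; exact: cvg_id. Qed.

Lemma sqr_addr_gt0 s x : 0 < s -> 0 < x ^+ 2 + s.
Proof. by move=> s_gt0; rewrite ltr_wpDl ?sqr_ge0. Qed.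

Lemma continuous_sqr_addr s : continuous (fun x : R => x ^+ 2 + s).
Proof.
apply: continuousD'; last exact: continuous_cst'.
by move=> x; exact: exprn_continuous.
Qed.

Lemma continuous_cauchy s : 0 < s -> continuous (fun x : R => (x ^+ 2 + s)^-1).
Proof.
move=> s_gt0; apply: continuousV' => [|x]; first exact: continuous_sqr_addr.
by rewrite lt0r_neq0// sqr_addr_gt0.
Qed.

(** In the variable u = 1 / (x^2 + 4) the function becomes F (sqrt (1/u - 4)) u. The factor u makes
    it continuous at u = 0, which is infinity for x, since F is bounded; polynomial approximation on
    [0, 1] then applies. *)
Lemma even_approx F (M e : R) : continuous F -> (forall x, `|F x| <= M) -> 0 < e ->
  exists p : {poly R}, forall x,
    `|F `|x| * (x ^+ 2 + 4)^-1 - p.[(x ^+ 2 + 4)^-1]| <= e.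
Proof.
move=> Fc FM e_gt0; pose g (u : R) := F (Num.sqrt (u^-1 - 4)) * u.
have M_ge0 : 0 <= M := le_trans (normr_ge0 _) (FM 0).
have gM u : `|g u| <= M * `|u| by rewrite normrM ler_wpM2r.
have gc : continuous g.
  move=> u; have [->|u0] := eqVneq u 0.
    rewrite /continuous_at /g mulr0 -/(g _); apply/cvgr0Pnorm_le => eps eps_gt0.
    exists (eps / (M + 1)) => /=; first by rewrite divr_gt0// ltr_wpDl.
    move=> v /=; rewrite sub0r normrN => /ltW; rewrite ler_pdivlMr ?ltr_wpDl// => h.
    apply: le_trans (gM v) _; apply: le_trans h; rewrite mulrC ler_wpM2l//.
    by rewrite lerDl.
  apply: cvgM; last exact: cvg_id.
  apply: (@cvg_comp _ _ _ (fun v : R => Num.sqrt (v^-1 - 4)) F _ (nbhs (Num.sqrt (u^-1 - 4)))).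
    apply: (@cvg_comp _ _ _ (fun v : R => v^-1 - 4) Num.sqrt _ (nbhs (u^-1 - 4))).
      by apply: cvgB; [exact: inv_continuous|exact: cvg_cst].
    exact: sqrt_continuous.
  exact: Fc.
have gI x : 0 <= x <= 1 -> `|g x| <= M.
  move=> /andP[x_ge0 x_le1]; apply: le_trans (gM x) _.
  by rewrite ger0_norm// ler_piMr.
have [p pE] := weierstrass gc gI e_gt0.
exists p => x; have := pE (x ^+ 2 + 4)^-1.
rewrite /g invrK (_ : x ^+ 2 + 4 - 4 = x ^+ 2) ?sqrtr_sqr; last by ring.
apply; rewrite invr_ge0 invf_le1 ?sqr_addr_gt0// ltW ?sqr_addr_gt0//=.
by rewrite ler_wpDl ?sqr_ge0// ler1n.
Qed.

(** The class is abstract because it is used twice: for functions whose means converge, and for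
    functions f such that the sum of f over the eigenvalues is measurable. *)
Variable L : (R -> R) -> Prop.
Hypothesis LD : forall f g, L f -> L g -> L (fun x => f x + g x).
Hypothesis LZ : forall (a : R) f, L f -> L (fun x => a * f x).
Hypothesis L_uniform : forall f, continuous f ->
  (forall e, 0 < e -> exists2 g, L g & forall x, `|f x - g x| <= e) -> L f.
Hypothesis L_cauchy : forall (b : bool) s, 4 <= s -> L (fun x => x ^+ b * (x ^+ 2 + s)^-1).

Let eqL f g : f =1 g -> L g -> L f.
Proof. by move=> /funext->. Qed.

Let cauchy_le1 s x : 4 <= s -> 0 <= (x ^+ 2 + s)^-1 <= 1.
Proof.
move=> s_ge4; have s_gt0 : 0 < s by apply: lt_le_trans s_ge4.
rewrite invr_ge0 invf_le1 ?sqr_addr_gt0// ltW ?sqr_addr_gt0//=.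
by rewrite ler_wpDl ?sqr_ge0// (le_trans _ s_ge4)// ler1n.
Qed.

Let exp_cauchy_le1 (b : bool) s x : 4 <= s -> `|x ^+ b * (x ^+ 2 + s)^-1| <= 1.
Proof.
move=> s_ge4; have s_gt0 : 0 < x ^+ 2 + s by rewrite sqr_addr_gt0// (lt_le_trans _ s_ge4).
rewrite normrM normfV (gtr0_norm s_gt0) ler_pdivrMr// mul1r normrX.
rewrite -(real_normK (num_real x)); case: b => /=; last by rewrite expr0; nra.
by rewrite expr1; nra.
Qed.

(** A product of two kernels with distinct s and t is a multiple of their difference, by partial
    fractions. A further power of the same kernel is then the uniform limit of such products as t
    tends to s. *)
Let L_pow (b : bool) k s : 4 <= s -> L (fun x => x ^+ b * (x ^+ 2 + s)^-1 ^+ k.+1).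
Proof.
suff H : forall j, (j <= k)%N -> forall s, 4 <= s ->
  L (fun x => x ^+ b * (x ^+ 2 + s)^-1 ^+ j.+1) by exact: H.
elim: k {s} => [|k IH] j; first by rewrite leqn0 => /eqP-> s s4; exact: L_cauchy.
rewrite leq_eqVlt => /predU1P[->|]; last by rewrite ltnS; exact: IH.
have mix i : (i <= k.+1)%N -> forall s t, 4 <= s -> 4 <= t -> s != t ->
    L (fun x => x ^+ b * (x ^+ 2 + s)^-1 ^+ i * (x ^+ 2 + t)^-1).
  elim: i => [|i IHi] ik s t s4 t4 st.
    by apply: eqL (L_cauchy b t4) => x; rewrite expr0 mulr1.
  apply: (@eqL _ (fun x => (t - s)^-1 * (x ^+ b * (x ^+ 2 + s)^-1 ^+ i.+1 +
    -1 * (x ^+ b * (x ^+ 2 + s)^-1 ^+ i * (x ^+ 2 + t)^-1)))).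
    move=> x; have xs : x ^+ 2 + s != 0.
      by rewrite lt0r_neq0// sqr_addr_gt0// (lt_le_trans _ s4).
    have xt : x ^+ 2 + t != 0 by rewrite lt0r_neq0// sqr_addr_gt0// (lt_le_trans _ t4).
    have ts : t - s != 0 by rewrite subr_eq0 eq_sym.
    have key : (x ^+ 2 + s)^-1 * (x ^+ 2 + t)^-1 =
      (t - s)^-1 * ((x ^+ 2 + s)^-1 - (x ^+ 2 + t)^-1) by field; do ?[apply/andP; split].
    rewrite exprSr -!mulrA key; ring.
  apply: LZ; apply: LD; first exact: IH.
  by apply: LZ; apply: IHi => //; exact: ltnW.
move=> s s4; have s_gt0 : 0 < s by apply: lt_le_trans s4.
apply: L_uniform.
  apply: continuousM'; first exact: (continuousX' continuous_id').
  exact: (continuousX' (continuous_cauchy s_gt0)).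
move=> e e_gt0; have t4 : 4 <= s + e by rewrite (le_trans s4)// lerDl ltW.
exists (fun x => x ^+ b * (x ^+ 2 + s)^-1 ^+ k.+1 * (x ^+ 2 + (s + e))^-1).
  by apply: mix => //; rewrite lt_eqF// ltrDl.
move=> x; have xs : x ^+ 2 + s != 0 by rewrite lt0r_neq0// sqr_addr_gt0.
have xt : x ^+ 2 + (s + e) != 0 by rewrite lt0r_neq0// sqr_addr_gt0// addr_gt0.
rewrite exprSr mulrA -mulrBr.
have -> : (x ^+ 2 + s)^-1 - (x ^+ 2 + (s + e))^-1 =
  e * (x ^+ 2 + s)^-1 * (x ^+ 2 + (s + e))^-1 by field; apply/andP; split.
rewrite [X in `|X|](_ : _ = e * ((x ^+ 2 + s)^-1 ^+ k.+2 *
  (x ^+ b * (x ^+ 2 + (s + e))^-1))); last first.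
  by move: (x ^+ b) (_ + s)^-1 (_ + (s + e))^-1 => u y z; rewrite [y ^+ k.+2]exprSr; ring.
rewrite normrM (gtr0_norm e_gt0) ler_piMr ?(ltW e_gt0)// normrM.
have := exp_cauchy_le1 b x t4; rewrite normrM => H.
apply: (mulr_ile1 _ _ _ H); rewrite ?mulr_ge0// normrX exprn_ile1//.
by have /andP[h0 h1] := cauchy_le1 x s4; rewrite ger0_norm.
Qed.

Let L_poly (b : bool) k (p : {poly R}) :
  L (fun x => x ^+ b * (x ^+ 2 + 4)^-1 ^+ k.+1 * p.[(x ^+ 2 + 4)^-1]).
Proof.
elim/poly_ind: p k => [|p c IH] k.
  apply: eqL (LZ 0 (L_pow b 0 (lexx _))) => x.
  by rewrite horner0 mulr0 mul0r.
apply: eqL (LD (IH k.+1) (LZ c (L_pow b k (lexx _)))) => x.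
by move: (x ^+ b) (x ^+ 2 + 4)^-1 => u y; rewrite hornerMXaddC [y ^+ k.+2]exprSr; ring.
Qed.

(** The squared cutoff supplies two factors y = 1 / (x^2 + 4). One makes the function vanish at
    infinity, so that [even_approx] applies; the other stays in front of the polynomial, as members
    of the class must decay. Even and odd parts are treated separately. *)
Lemma resolvent_class f M s : continuous f -> (forall x, `|f x| <= M) -> 4 <= s ->
  L (fun x => f x * (s / (x ^+ 2 + s)) ^+ 2).
Proof.
move=> fc fM s4; have s_gt0 : 0 < s by apply: lt_le_trans s4.
have M_ge0 : 0 <= M := le_trans (normr_ge0 _) (fM 0).
have fNc : continuous (fun x => f (- x)).
  by move=> x; apply: (@continuous_comp _ _ _ (@GRing.opp R) f); [exact: opp_continuous|exact: fc].
(* The bounded function relating the cutoff at s to the kernel at 4: s / (x^2 + s) = c(x) y. *)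
pose c x := s * (x ^+ 2 + 4) / (x ^+ 2 + s).
have cc : continuous c.
  apply: continuousM'; last exact: continuous_cauchy.
  by apply: continuousM'; [exact: continuous_cst'|exact: continuous_sqr_addr].
have c_bound x : 0 <= c x <= s.
  rewrite /c ler_pdivrMr ?sqr_addr_gt0// ler_wpM2l ?lerD2l ?(ltW s_gt0)// andbT.
  by apply: ltW; rewrite divr_gt0 ?mulr_gt0 ?sqr_addr_gt0.
have c2_le x : `|c x ^+ 2| <= s ^+ 2.
  by have /andP[? ?] := c_bound x; rewrite ger0_norm ?sqr_ge0// ler_sqr ?nnegrE// ltW.
have cE x : s / (x ^+ 2 + s) = c x * (x ^+ 2 + 4)^-1.
  by rewrite /c; field; rewrite !lt0r_neq0 ?sqr_addr_gt0.
have cN x : c (- x) = c x by rewrite /c sqrrN.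
have cauchy_c := continuous_cauchy s_gt0.
have chic : continuous (fun x => (s / (x ^+ 2 + s)) ^+ 2).
  by apply: continuousX'; apply: continuousM' => //; exact: continuous_cst'.
pose fe x := (f x + f (- x)) / 2; pose fo x := (f x - f (- x)) / 2.
have fec : continuous fe.
  by apply: continuousM'; [exact: continuousD'|exact: continuous_cst'].
have foc : continuous fo.
  apply: continuousM'; last exact: continuous_cst'.
  by move=> x; apply: cvgB; [exact: fc|exact: fNc].
have feM x : `|fe x| <= M.
  rewrite normrM [`|2^-1|]gtr0_norm ?invr_gt0// ler_pdivrMr//.
  by apply: le_trans (ler_normD _ _) _; have := fM x; have := fM (- x); lra.
have foM x : `|fo x| <= M.
  rewrite normrM [`|2^-1|]gtr0_norm ?invr_gt0// ler_pdivrMr//.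
  by apply: le_trans (ler_normB _ _) _; have := fM x; have := fM (- x); lra.
have feN x : fe (- x) = fe x by rewrite /fe opprK addrC.
have foN x : fo (- x) = - fo x by rewrite /fo opprK -mulNr opprB.
have y_bound x : 0 <= (x ^+ 2 + 4)^-1 <= 1 := cauchy_le1 x (lexx _).
have Leven : L (fun x => fe x * (s / (x ^+ 2 + s)) ^+ 2).
  apply: L_uniform; first exact: continuousM'.
  move=> e e_gt0; pose F x := fe x * c x ^+ 2.
  have FM x : `|F x| <= M * s ^+ 2 by rewrite normrM ler_pM.
  have Fc : continuous F by apply: continuousM' => //; exact: continuousX'.
  have [p pE] := even_approx Fc FM e_gt0.
  exists (fun x => x ^+ false * (x ^+ 2 + 4)^-1 ^+ 1 * p.[(x ^+ 2 + 4)^-1]); first exact: L_poly.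
  move=> x; have := pE x; have -> : F `|x| = F x.
    by rewrite /F; case: (ger0P x) => // _; rewrite cN feN.
  rewrite cE /F expr0 expr1 mul1r (exprMn _ (c x)).
  move: (c x) (fe x) (y_bound x); set y := (x ^+ 2 + 4)^-1 => u v /andP[y0 y1] H.
  rewrite (_ : _ - _ = y * (v * u ^+ 2 * y - p.[y])); last by ring.
  by rewrite normrM (ger0_norm y0); apply: le_trans H; rewrite ler_piMl.
suff Lodd : L (fun x => fo x * (s / (x ^+ 2 + s)) ^+ 2).
  by apply: eqL (LD Leven Lodd) => x; rewrite /fe /fo; field; rewrite lt0r_neq0 ?sqr_addr_gt0.
apply: L_uniform; first exact: continuousM'.
move=> e e_gt0.
have /cvgrPdist_le /(_ (e / 2)) := foc 0.
move=> /(_ ltac:(by rewrite divr_gt0)) [r /= r_gt0 fo_small].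
have fo0 : fo 0 = 0 by rewrite /fo oppr0 subrr mul0r.
(* The odd part should be x times an even function, but fo(x) / x need not be continuous at 0. It is
   replaced by fo(x) x / (x^2 + dl), and the error fo(x) dl / (x^2 + dl) is uniformly small: near 0
   because fo(0) = 0, elsewhere because dl is small against r^2. *)
pose dl := e / 2 * r ^+ 2 / (M + 1).
have M1_gt0 : 0 < M + 1 by rewrite ltr_wpDl.
have dl_gt0 : 0 < dl by apply: divr_gt0 => //; rewrite mulr_gt0 ?exprn_gt0 ?divr_gt0.
have foE x : `|fo x * (dl / (x ^+ 2 + dl))| <= e / 2.
  have xd : 0 < x ^+ 2 + dl by rewrite sqr_addr_gt0.
  rewrite normrM [`|dl / _|]ger0_norm ?(divr_ge0 (ltW dl_gt0) (ltW xd))//.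
  have [xr|xr] := ltP `|x| r.
    have := fo_small x; rewrite /= fo0 !sub0r !normrN => /(_ xr) h.
    apply: le_trans h; rewrite ler_piMr// ler_pdivrMr// mul1r.
    by rewrite ler_wpDl ?sqr_ge0.
  have x2 : r ^+ 2 <= x ^+ 2.
    by rewrite -[leRHS](real_normK (num_real x)) ler_sqr ?nnegrE ?(ltW r_gt0).
  rewrite mulrA ler_pdivrMr//.
  apply: (@le_trans _ _ (e / 2 * r ^+ 2)).
    have er_ge0 : 0 <= e / 2 * r ^+ 2 by rewrite mulr_ge0 ?sqr_ge0 ?divr_ge0 ?(ltW e_gt0).
    rewrite /dl mulrCA ler_piMr// ler_pdivrMr// mul1r.
    by apply: le_trans (foM x) _; rewrite lerDl.
  by rewrite ler_wpM2l ?divr_ge0 ?(ltW e_gt0)// ler_wpDr ?(ltW dl_gt0).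
pose h x := x * (x ^+ 2 + dl)^-1.
have hc : continuous h.
  by apply: continuousM'; [exact: continuous_id'|exact: continuous_cauchy].
have hM x : `|h x| <= 1 + dl^-1.
  have xd : 0 < x ^+ 2 + dl by rewrite sqr_addr_gt0.
  rewrite normrM normfV (gtr0_norm xd) ler_pdivrMr//.
  rewrite -(real_normK (num_real x)) mulrDl mul1r mulrDr mulVf ?lt0r_neq0//.
  have : 0 <= dl^-1 * `|x| ^+ 2 by rewrite mulr_ge0 ?sqr_ge0 ?invr_ge0 ?(ltW dl_gt0).
  by have := ltW dl_gt0; nra.
pose F x := fo x * h x * c x ^+ 2.
have FM x : `|F x| <= M * (1 + dl^-1) * s ^+ 2 by rewrite normrM ler_pM// normrM ler_pM.
have Fc : continuous F.
  by apply: continuousM'; [exact: continuousM'|exact: continuousX'].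
have [p pE] := even_approx Fc FM (divr_gt0 e_gt0 (ltr0n _ 2)).
exists (fun x => x ^+ true * (x ^+ 2 + 4)^-1 ^+ 1 * p.[(x ^+ 2 + 4)^-1]); first exact: L_poly.
move=> x; have := pE x; have -> : F `|x| = F x.
  rewrite /F; case: (ger0P x) => // _.
  by rewrite cN foN /h sqrrN; ring.
move=> {pE} pE; have xd : x ^+ 2 + dl != 0 by rewrite lt0r_neq0 ?sqr_addr_gt0.
have chi_le : `|(s / (x ^+ 2 + s)) ^+ 2| <= 1.
  have /andP[c0 c1] : 0 <= s / (x ^+ 2 + s) <= 1.
    have xs_gt0 : 0 < x ^+ 2 + s by rewrite sqr_addr_gt0.
    by rewrite (divr_ge0 (ltW s_gt0) (ltW xs_gt0))/= ler_pdivrMr// mul1r ler_wpDl ?sqr_ge0.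
  by rewrite ger0_norm ?sqr_ge0// expr_le1.
have xy_le := exp_cauchy_le1 true x (lexx (4 : R)).
rewrite (_ : _ - _ = fo x * (dl / (x ^+ 2 + dl)) * (s / (x ^+ 2 + s)) ^+ 2 +
   x ^+ true * (x ^+ 2 + 4)^-1 * (F x * (x ^+ 2 + 4)^-1 - p.[(x ^+ 2 + 4)^-1])); last first.
  by rewrite cE /F /h expr1; field; rewrite xd lt0r_neq0 ?sqr_addr_gt0.
apply: le_trans (ler_normD _ _) _; rewrite [leRHS](splitr e); apply: lerD.
  by rewrite normrM; apply: le_trans (foE x); rewrite ler_piMr.
by rewrite normrM; apply: le_trans pE; rewrite ler_piMl.
Qed.

End ResolventClass.

(** * Weak convergence from the Cauchy kernels *)

Section WeakConvergence.
Variable R : realType.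
Implicit Types f g : R -> R.

Lemma bmeas_continuous f M : continuous f -> (forall x, `|f x| <= M) -> bounded_measurable f.
Proof. by move=> fc fM; split; [exact: continuous_measurable_fun|exists M]. Qed.

Lemma cauchy_le1 (s x : R) : 4 <= s -> 0 <= s / (x ^+ 2 + s) <= 1.
Proof.
move=> s4; have s_gt0 : 0 < s by apply: lt_le_trans s4.
have xs_gt0 : 0 < x ^+ 2 + s by rewrite sqr_addr_gt0.
by rewrite (divr_ge0 (ltW s_gt0) (ltW xs_gt0))/= ler_pdivrMr// mul1r ler_wpDl ?sqr_ge0.
Qed.

Lemma bmeas_cauchy (b : bool) (s : R) : 4 <= s ->
  bounded_measurable (fun x : R => x ^+ b * (x ^+ 2 + s)^-1).
Proof.
move=> s4; have s_gt0 : 0 < s by apply: lt_le_trans s4.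
apply: (@bmeas_continuous _ 1).
  apply: continuousM'; last exact: continuous_cauchy.
  exact: (continuousX' (@continuous_id' R)).
move=> x; have xs : 0 < x ^+ 2 + s by rewrite sqr_addr_gt0.
rewrite normrM normfV (gtr0_norm xs) ler_pdivrMr// mul1r normrX.
rewrite -(real_normK (num_real x)); case: b => /=; last by rewrite expr0; nra.
by rewrite expr1; nra.
Qed.

(** Only the limit is assumed tight. The function 1 - s / (x^2 + s) measures the mass far out and
    belongs to the class, so its mean under [nu n] is eventually small as well; this controls the
    difference between f and f times the cutoff. *)
Lemma cvg_mean_cauchy (nu : nat -> probability R R) (mu : probability R R) :
  (forall (b : bool) (s : R), 4 <= s ->
    mean (nu n) (fun x => x ^+ b * (x ^+ 2 + s)^-1) @[n --> \oo] -->
    mean mu (fun x => x ^+ b * (x ^+ 2 + s)^-1)) ->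
  (forall e : R, 0 < e -> exists2 s, 4 <= s & mean mu (fun x => 1 - s / (x ^+ 2 + s)) <= e) ->
  forall f, continuous f -> bounded_fun f -> mean (nu n) f @[n --> \oo] --> mean mu f.
Proof.
move=> cauchyE tight f fc [M0 [_ /(_ (M0 + 1)) fM]].
pose M := `|M0 + 1|; have {}fM x : `|f x| <= M.
  by apply: le_trans (fM _ x I) (ler_norm _); rewrite ltrDl.
have M_ge0 : 0 <= M by exact: normr_ge0.
pose L g := bounded_measurable g /\ mean (nu n) g @[n --> \oo] --> mean mu g.
have LD g h : L g -> L h -> L (fun x => g x + h x).
  move=> [bg cg] [bh ch]; split; first exact: bmeasD.
  under eq_fun do rewrite meanD//.
  by rewrite meanD//; apply: cvgD.
have LZ a g : L g -> L (fun x => a * g x).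
  move=> [bg cg]; split; first by apply: bmeasM => //; exact: bmeas_cst.
  under eq_fun do rewrite meanZ//.
  by rewrite meanZ//; apply: cvgMr.
have bf : bounded_measurable f by exact: bmeas_continuous fc fM.
have close (p : probability R R) g h e : bounded_measurable g -> bounded_measurable h ->
    (forall x, `|g x - h x| <= e) -> `|mean p g - mean p h| <= e.
  move=> bg bh ghe; rewrite -meanB//; apply: le_trans (ler_norm_mean p (bmeasB bg bh)) _.
  by apply: mean_le => //; apply: bmeas_norm; exact: bmeasB.
have L_uniform g : continuous g ->
    (forall e, 0 < e -> exists2 h, L h & forall x, `|g x - h x| <= e) -> L g.
  move=> gc gL.
  have bg : bounded_measurable g.
    have [h [[_ [K hK]] _] gh] := gL 1 ltr01.
    apply: (@bmeas_continuous _ (1 + K)) => // x.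
    rewrite -(subrK (h x) (g x)); apply: le_trans (ler_normD _ _) _.
    by apply: lerD.
  split=> //; apply/cvgrPdist_le => e e_gt0.
  have [h [bh hE] gh] := gL (e / 3) (divr_gt0 e_gt0 (ltr0n _ 3)).
  move/cvgrPdist_le : hE => /(_ (e / 3) (divr_gt0 e_gt0 (ltr0n _ 3))).
  apply: filterS => n hn.
  have h1 := close mu _ _ _ bg bh gh; have h2 := close (nu n) _ _ _ bg bh gh.
  rewrite (_ : _ - _ = (mean mu g - mean mu h) + (mean mu h - mean (nu n) h) -
    (mean (nu n) g - mean (nu n) h)); last by ring.
  apply: le_trans (ler_normB _ _) _; apply: le_trans (lerD (ler_normD _ _) h2) _.
  by have := lerD h1 hn; lra.
have L_cauchy (b : bool) s : 4 <= s -> L (fun x => x ^+ b * (x ^+ 2 + s)^-1).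
  by move=> s4; split; [exact: bmeas_cauchy|exact: cauchyE].
have L1B s : 4 <= s -> L (fun x => 1 - s / (x ^+ 2 + s)).
  move=> s4; have [bl cl] := LZ (- s) _ (L_cauchy false s s4).
  have -> : (fun x => 1 - s / (x ^+ 2 + s)) =
      (fun x => (- s) * (x ^+ false * (x ^+ 2 + s)^-1) + 1).
    by apply/funext => x; rewrite expr0 mul1r mulNr addrC.
  apply: LD; first by split.
  split; first exact: bmeas_cst.
  by under eq_fun do rewrite mean_cst; rewrite mean_cst; exact: cvg_cst.
apply/cvgrPdist_le => e e_gt0.
have [s s4 tight_s] := tight (e / (8 * (M + 1))) ltac:(by rewrite divr_gt0// mulr_gt0// ltr_wpDl).
have [bg /cvgrPdist_le gE] := resolvent_class LD LZ L_uniform L_cauchy fc fM s4.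
set g := (fun x => f x * _) in bg gE.
have [bk /cvgrPdist_le kE] := L1B s s4.
set k := (fun x => 1 - _) in bk kE tight_s.
have k_ge0 x : 0 <= k x by rewrite subr_ge0; have /andP[] := cauchy_le1 x s4.
(* With c the cutoff, 1 - c^2 = (1 - c)(1 + c) <= 2 (1 - c). *)
have fgk x : `|f x - g x| <= 2 * M * k x.
  have /andP[c0 c1] := cauchy_le1 x s4; rewrite /g /k.
  move: (s / _) c0 c1 => c c0 c1.
  rewrite (_ : f x - _ = f x * (1 - c ^+ 2)); last by ring.
  rewrite normrM [2 * M]mulrC -mulrA ler_pM// ger0_norm; nra.
have fg (p : probability R R) : `|mean p f - mean p g| <= 2 * M * mean p k.
  rewrite -meanB//; apply: le_trans (ler_norm_mean p (bmeasB bf bg)) _.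
  rewrite -meanZ//; apply: le_mean => //; first by apply: bmeas_norm; exact: bmeasB.
  by apply: bmeasM => //; exact: bmeas_cst.
have M1_gt0 : 0 < 8 * (M + 1) by rewrite mulr_gt0// ltr_wpDl.
near=> n.
have h1 : `|mean mu g - mean (nu n) g| <= e / 8 by near: n; apply: gE; rewrite divr_gt0.
have h2 : `|mean mu k - mean (nu n) k| <= e / (8 * (M + 1)).
  by near: n; apply: kE; rewrite divr_gt0.
have fgmu := fg mu; have fgnu := fg (nu n).
rewrite (_ : _ - _ = (mean mu f - mean mu g) + (mean mu g - mean (nu n) g) -
    (mean (nu n) f - mean (nu n) g)); last by ring.
apply: le_trans (ler_normB _ _) _; apply: le_trans (lerD (ler_normD _ _) fgnu) _.
have {}h2 : mean (nu n) k <= 2 * (e / (8 * (M + 1))).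
  by move: h2; rewrite ler_norml => /andP[]; lra.
have Me : M * (e / (8 * (M + 1))) <= e / 8.
  rewrite mulrA ler_pdivrMr//; rewrite (_ : e / 8 * (8 * (M + 1)) = e * (M + 1)); last by field.
  by nra.
have a1 := ler_wpM2l M_ge0 h2; have a2 := ler_wpM2l M_ge0 tight_s.
by lra.
Unshelve. all: by end_near.
Qed.

End WeakConvergence.

(** * The expected empirical measure *)

Section EmpiricalMean.
Variables (R : realType) (N : nat) (A : 'M[R[i]]_N.+1).
Local Notation lam i := (complex.Re (spectral_diag A 0 i)).
Implicit Types f : R -> R.

Lemma sum_eigenvalues (V : nmodType) (F : R -> V) :
  \sum_(k < N.+1) F (nth 0 (eigenvalues A) k) = \sum_i F (lam i).
Proof.
have sE : size (eigenvalues A) = N.+1.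
  by rewrite /eigenvalues size_sort size_map -cardE card_ord.
transitivity (\sum_(x <- eigenvalues A) F x).
  by rewrite [RHS](big_nth 0) sE big_mkord.
by rewrite (perm_big _ (permEl (perm_sort _ _))) big_map big_enum.
Qed.

Lemma empirical_spectral_measureE (B : set R) :
  empirical_spectral_measure A B = (N.+1%:R^-1 * \sum_i \1_B (lam i))%:E.
Proof.
rewrite /empirical_spectral_measure /mscale /= /msum EFinM -sumEFin.
by rewrite -(sum_eigenvalues (fun x => (\1_B x)%:E)).
Qed.

Lemma mean_empirical f : bounded_measurable f ->
  mean (empirical_spectral_measure A) f = N.+1%:R^-1 * \sum_i f (lam i).
Proof.
have ge0 (g : R -> R) : measurable_fun [set: R] g -> (forall x, 0 <= g x) ->
    mean (empirical_spectral_measure A) g = N.+1%:R^-1 * \sum_i g (lam i).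
  move=> mg g_ge0; rewrite /mean /Rintegral.
  have mg' : measurable_fun [set: R] (EFin \o g) by exact/measurable_EFinP.
  rewrite (_ : (\int[_]_x _)%E = (N.+1%:R^-1 * \sum_i g (lam i))%:E)//.
  rewrite ge0_integral_mscale//=; last by move=> x _; rewrite lee_fin.
  rewrite ge0_integral_measure_sum//; last by move=> x _; rewrite lee_fin.
  rewrite EFinM; congr (_ * _)%E.
  rewrite -(sum_eigenvalues g) -sumEFin; apply: eq_bigr => k _.
  by rewrite integral_dirac//= diracT mul1e.
move=> bf; have [mf [M fM]] := bf.
have bM : bounded_measurable (fun _ : R => M : R) by exact: bmeas_cst.
have bfM := bmeasD bf bM.
have fM_ge0 x : 0 <= f x + M by have := fM x; rewrite ler_norml => /andP[]; lra.
have -> : f = (fun x => (f x + M) - M) by apply/funext => x; rewrite addrK.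
rewrite (meanB _ bfM bM) mean_cst ge0//; last by case: bfM.
rewrite [in RHS](eq_bigr (fun i => f (lam i))); last by move=> i _; rewrite addrK.
rewrite big_split /= sumr_const card_ord -[M *+ _]mulr_natr.
by rewrite mulrDr mulrCA mulVf ?pnatr_eq0// mulr1 addrK.
Qed.

End EmpiricalMean.

Section ExpectedMean.
Context d (T : measurableType d) (R : realType) (P : probability T R).
Variable nu : T -> probability R R.
Hypothesis mnu : forall B, measurable B -> measurable_fun [set: T] (nu ^~ B).

Lemma bmeas_mean (f : R -> R) : bounded_measurable f ->
  bounded_measurable (fun w => mean (nu w) f).
Proof.
move=> bf; have [mf [M fM]] := bf.
have bM : bounded_measurable (fun _ : R => M : R) by exact: bmeas_cst.
have bfM := bmeasD bf bM.
have fM_ge0 x : 0 <= f x + M by have := fM x; rewrite ler_norml => /andP[]; lra.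
split; last first.
  exists M => w; apply: le_trans (ler_norm_mean (nu w) bf) _.
  by apply: mean_le => //; exact: bmeas_norm.
have -> : (fun w => mean (nu w) f) = (fun w => mean (nu w) (fun x => f x + M) - M).
  by apply/funext => w; rewrite meanD// mean_cst addrK.
apply: measurable_funB => //; rewrite /mean /Rintegral.
pose k w : giry R R := nu w.
have mk : measurable_fun [set: T] k by exact: measurable_giry_codensity.
have mint : measurable_fun [set: giry R R] (giry_int ^~ (EFin \o (fun x => f x + M))).
  apply: measurable_giry_int; first by apply/measurable_EFinP; case: bfM.
  by move=> x; rewrite lee_fin.
exact: (measurableT_comp (fine_measurable measurableT) (measurableT_comp mint mk)).
Qed.

(** On measurable sets the expected measure is the bind of the Giry monad, whose integral formula
    covers nonnegative functions; a bounded f is reduced to this case by adding a constant. *)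
Lemma mean_expected_measure (f : R -> R) : bounded_measurable f ->
  mean (expected_measure P nu) f = mean P (fun w => mean (nu w) f).
Proof.
move=> bf; pose k w : giry R R := nu w.
have mk : measurable_fun [set: T] k by exact: measurable_giry_codensity.
have bindE B : measurable B -> giry_bind (P : giry T R) mk B = expected_measure P nu B.
  move=> mB; rewrite expected_measureE//.
  transitivity (giry_int (giry_bind (P : giry T R) mk) (EFin \o \1_B)).
    by rewrite /giry_int [RHS]integral_indic// setIT.
  rewrite giry_int_bind; last 2 first.
  - by apply/measurable_EFinP; exact: measurable_indic.
  - by move=> x; rewrite lee_fin.
  by apply: eq_integral => w _; rewrite /giry_int [LHS]integral_indic// setIT.
have ge0 (g : R -> R) : bounded_measurable g -> (forall x, 0 <= g x) ->
    mean (expected_measure P nu) g = mean P (fun w => mean (nu w) g).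
  move=> bg g_ge0; have [mg _] := bg.
  have mg' : measurable_fun [set: R] (EFin \o g) by exact/measurable_EFinP.
  rewrite /mean /Rintegral; congr fine.
  transitivity (\int[giry_bind (P : giry T R) mk]_x (g x)%:E)%E.
    by apply/esym/eq_measure_integral => B mB _; exact: bindE.
  have := @giry_int_bind _ _ _ _ _ (P : giry T R) k mk (EFin \o g) mg'.
  rewrite /giry_int => ->; last by move=> x; rewrite lee_fin.
  apply: eq_integral => w _; rewrite fineK//.
  exact: integrable_fin_num (bmeas_integrable (nu w) bg).
have [mf [M fM]] := bf.
have bM : bounded_measurable (fun _ : R => M : R) by exact: bmeas_cst.
have bfM := bmeasD bf bM.
have fM_ge0 x : 0 <= f x + M by have := fM x; rewrite ler_norml => /andP[]; lra.
have -> : f = (fun x => (f x + M) - M) by apply/funext => x; rewrite addrK.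
rewrite (meanB _ bfM bM) mean_cst ge0//.
under [in RHS]eq_fun do rewrite (meanB _ bfM bM) mean_cst.
rewrite meanB ?mean_cst//; last exact: bmeas_cst.
exact: bmeas_mean.
Qed.

End ExpectedMean.

Lemma cvg_sumr (R : realType) (I : Type) (r : seq I) (Q : pred I) (F : nat -> I -> R) (l : I -> R) :
  (forall i, F n i @[n --> \oo] --> l i) ->
  \sum_(i <- r | Q i) F n i @[n --> \oo] --> \sum_(i <- r | Q i) l i.
Proof.
move=> Fl; elim: r => [|i r IH].
  by under eq_fun do rewrite big_nil; rewrite big_nil; exact: cvg_cst.
rewrite big_cons; under eq_fun do rewrite big_cons.
by case: ifP => // _; apply: cvgD.
Qed.

(** * Measurability of the empirical spectral measure *)

Section EigenvalueMeasurability.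
Context d (T : measurableType d) (R : realType).
Variables (N : nat) (A : T -> 'M[R[i]]_N).
Hypothesis hermA : forall w, A w \is hermsymmx.
Hypothesis mA : forall i j, cmeas (fun w => A w i j).
Local Notation lam w i := (complex.Re (spectral_diag (A w) 0 i)).

(** The list of eigenvalues comes from a choice with no evident measurability. The trace of the
    resolvent is measurable, and its two parts are the Cauchy kernels summed over the eigenvalues:
    from these every symmetric statistic needed is reached. *)
Lemma eigen_cauchy (eta : R) w : 0 < eta ->
  \tr (resolvent eta (A w)) =
  (\sum_i lam w i * (lam w i ^+ 2 + eta ^+ 2)^-1) +i*
  (eta * \sum_i (lam w i ^+ 2 + eta ^+ 2)^-1).
Proof.
move=> eta_gt0; rewrite (tr_resolvent eta_gt0 (hermA w)).
apply/eqP; rewrite eq_complex Re_sum Im_sum /=.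
apply/andP; split; apply/eqP.
  apply: eq_bigr => i _; rewrite /= !expr2; congr (_ / _); ring.
rewrite mulr_sumr; apply: eq_bigr => i _ /=; rewrite subr0 sub0r sqrrN mulNr opprK.
by [].
Qed.

Let cmeas_tr (eta : R) : 0 < eta -> cmeas (fun w => \tr (resolvent eta (A w))).
Proof. move=> eta_gt0.
have H i : cmeas (fun w => resolvent eta (A w) i i) by exact: cmeas_resolvent.
exact: cmeas_sum. Qed.

Let meas_eigen (f : R -> R) := measurable_fun [set: T] (fun w => \sum_i f (lam w i)).

Let meas_eigen_cvg (g : nat -> R -> R) f :
  (forall n, meas_eigen (g n)) -> (forall x, g n x @[n --> \oo] --> f x) -> meas_eigen f.
Proof.
move=> mg gf; apply: (measurable_fun_cvg (h := fun n w => \sum_i g n (lam w i))) => // w _.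
exact: cvg_sumr.
Qed.

Let meas_eigenD f g : meas_eigen f -> meas_eigen g -> meas_eigen (fun x => f x + g x).
Proof.
move=> mf mg; rewrite /meas_eigen; under eq_fun do rewrite big_split.
exact: measurable_funD.
Qed.

Let meas_eigenZ (a : R) f : meas_eigen f -> meas_eigen (fun x => a * f x).
Proof.
move=> mf; rewrite /meas_eigen; under eq_fun do rewrite -mulr_sumr.
exact: measurable_funM.
Qed.

Let meas_eigen_continuous f : continuous f -> (forall x, `|f x| <= 1) -> meas_eigen f.
Proof.
move=> fc f1.
have L_uniform g : continuous g ->
    (forall e, 0 < e -> exists2 h, meas_eigen h & forall x, `|g x - h x| <= e) -> meas_eigen g.
  move=> gc gL.
  have /choice[h hE] : forall n : nat, exists h, meas_eigen h /\ forall x, `|g x - h x| <= n.+1%:R^-1.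
    by move=> n; have [h mh gh] := gL n.+1%:R^-1 ltac:(by rewrite invr_gt0); exists h.
  apply: (@meas_eigen_cvg h) => [n|x]; first by have [] := hE n.
  apply/cvgrPdist_le => e e_gt0.
  have /cvgr0Pnorm_le /(_ e e_gt0) := @cvg_harmonic R.
  apply: filterS => n; rewrite /harmonic/= => ne.
  by move: ne; rewrite ger0_norm// => ne; apply: le_trans ne; have [_] := hE n; apply.
have L_cauchy (b : bool) s : 4 <= s -> meas_eigen (fun x => x ^+ b * (x ^+ 2 + s)^-1).
  move=> s4; have s_gt0 : 0 < s by apply: lt_le_trans s4.
  have sq_gt0 : 0 < Num.sqrt s by rewrite sqrtr_gt0.
  have sqE : Num.sqrt s ^+ 2 = s by rewrite sqr_sqrtr// ltW.
  have [mRe mIm] := cmeas_tr sq_gt0; rewrite /meas_eigen; case: b => /=.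
    apply: eq_measurable_fun mRe => w _; rewrite eigen_cauchy//= sqE.
    by apply: eq_bigr => i _; rewrite expr1.
  apply: (eq_measurable_fun (fun w => (Num.sqrt s)^-1 * complex.Im (\tr (resolvent (Num.sqrt s) (A w))))).
    move=> w _; rewrite eigen_cauchy//= sqE mulKf ?lt0r_neq0//.
    by apply: eq_bigr => i _; rewrite expr0 mul1r.
  exact: measurable_funM.
(* The cutoffs tend to 1 pointwise; the shift by 4 puts every parameter in the range s >= 4. *)
apply: (@meas_eigen_cvg (fun n x => f x * (n.+4%:R / (x ^+ 2 + n.+4%:R)) ^+ 2)).
  by move=> n; apply: (resolvent_class meas_eigenD meas_eigenZ L_uniform L_cauchy fc f1); rewrite ler_nat.
move=> x; rewrite -[X in _ --> X]mulr1; apply: cvgMr.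
have cv : n.+4%:R / (x ^+ 2 + n.+4%:R) @[n --> \oo] --> (1 : R).
  apply/cvgrPdist_le => e e_gt0; near=> n.
  have n0 : 0 < n.+4%:R :> R by rewrite ltr0n.
  have xn : 0 < x ^+ 2 + n.+4%:R by rewrite sqr_addr_gt0.
  rewrite -{1}(divff (lt0r_neq0 xn)) -mulrBl addrK.
  rewrite ger0_norm ?divr_ge0 ?sqr_ge0 ?(ltW xn)// ler_pdivrMr//.
  have : x ^+ 2 / e <= n%:R by near: n; exact: nbhs_infty_ger.
  rewrite ler_pdivrMr// mulrC => h; apply: le_trans h _; rewrite ler_wpM2l ?(ltW e_gt0)//.
  by rewrite ler_wpDl ?sqr_ge0// ler_nat; do 4!apply: leqW.
by rewrite -[X in _ --> X](mulr1 1); under eq_fun do rewrite expr2; exact: cvgM.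
Unshelve. all: by end_near.
Qed.

(** The indicator of a closed half-line is the pointwise limit of continuous functions bounded by 1,
    equal to 1 on it and decreasing faster and faster to its right. *)
Let meas_eigen_itv (a : R) : meas_eigen \1_(`]-oo, a]%classic).
Proof.
pose g (n : nat) x : R := (1 + n%:R * Num.max (x - a) 0)^-1.
have g_gt0 n x : 1 <= 1 + n%:R * Num.max (x - a) 0.
  by rewrite lerDl mulr_ge0// le_max lexx orbT.
apply: (@meas_eigen_cvg g) => [n|x].
  apply: meas_eigen_continuous => [|x]; last first.
    by rewrite ger0_norm ?invr_ge0 ?invf_le1 ?(lt_le_trans ltr01 (g_gt0 _ _)) ?(le_trans ler01).
  apply: continuousV' => [|x]; last by rewrite lt0r_neq0// (lt_le_trans ltr01).
  apply: continuousD'; first exact: continuous_cst'.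
  apply: continuousM'; first exact: continuous_cst'.
  move=> x; apply: (@continuous_max _ _ (fun x => x - a) (fun=> 0)); last exact: cvg_cst.
  by apply: cvgB; [exact: cvg_id|exact: cvg_cst].
rewrite indicE /g; have [xa|ax] := leP x a.
  rewrite mem_set/= ?in_itv//= max_r ?subr_le0//.
  by under eq_fun do rewrite mulr0 addr0 invr1; exact: cvg_cst.
rewrite memNset/=; last by rewrite in_itv /= => /(lt_le_trans ax); rewrite ltxx.
rewrite max_l ?subr_ge0 ?(ltW ax)//.
apply/cvgrPdist_le => e e_gt0; near=> n.
have xa : 0 < x - a by rewrite subr_gt0.
have h0 : 0 < 1 + n%:R * (x - a) by rewrite ltr_pwDl// mulr_ge0// ltW.
rewrite sub0r normrN gtr0_norm ?invr_gt0// -[leRHS]invrK lef_pV2 ?posrE ?invr_gt0//.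
apply: (@le_trans _ _ (n%:R * (x - a))); last by rewrite lerDr.
by rewrite -ler_pdivrMr//; near: n; exact: nbhs_infty_ger.
Unshelve. all: by end_near.
Qed.

Lemma measurable_count_eigenvalues (B : set R) : measurable B ->
  measurable_fun [set: T] (fun w => \sum_i (\1_B (lam w i) : R)).
Proof.
rewrite -/(meas_eigen \1_B); move: B.
have sigE := RGenOInfty.measurableE R.
have meas_cst : meas_eigen (fun=> 1) by exact: measurable_cst.
have measC S : meas_eigen \1_S -> meas_eigen \1_(~` S).
  move=> mS; have -> : \1_(~` S) = (fun x => 1 + (-1) * \1_S x) :> (R -> R).
    by apply/funext => x; rewrite !indicE in_setC mulN1r; case: (x \in S); rewrite ?subrr ?subr0.
  exact: (meas_eigenD meas_cst (meas_eigenZ (-1) mS)).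
suff H : forall S, <<s @RGenOInfty.G R >> S -> meas_eigen \1_S.
  by move=> B mB; apply: H; rewrite -[X in X B]sigE.
apply: (dynkin_induction sigE) => //.
- move=> _ _ [x ->] [y ->]; exists (Num.max x y).
  by apply/seteqP; split=> z /=; rewrite !in_itv /= !andbT gt_max => /andP.
- by rewrite indicT.
- by move=> _ [x ->]; rewrite -setCitvl; apply: measC; exact: meas_eigen_itv.
- by move=> S _; exact: measC.
move=> F mF tF HF.
(* For a disjoint union the partial sums of the indicators converge at each x; this is
   sigma-additivity of the Dirac mass at x. *)
apply: (@meas_eigen_cvg (fun n x => \sum_(0 <= k < n) \1_(F k) x)).
  move=> n; elim: n => [|n IH].
    rewrite (_ : (fun x : R => _) = (fun x => 0 * 1)); first exact: meas_eigenZ.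
    by apply/funext => x; rewrite big_nil mul0r.
  rewrite (_ : (fun x : R => _) = (fun x => \sum_(0 <= k < n) \1_(F k) x + \1_(F n) x)).
    exact: meas_eigenD.
  by apply/funext => x; rewrite big_nat_recr.
move=> x; have mU : measurable (\bigcup_n F n) by exact: bigcup_measurable.
have sa : semi_sigma_additive (\d_x : set R -> \bar R) by exact: measure_semi_sigma_additive.
have := sa F mF tF mU.
rewrite /= diracE -indicE.
under eq_fun do under eq_bigr do rewrite diracE.
under eq_fun do rewrite sumEFin.
move/fine_cvg.
exact.
Qed.

End EigenvalueMeasurability.

Section ExpectedSpectralMean.
Context d (T : measurableType d) (R : realType) (P : probability T R).
Variables (N : nat) (A : T -> 'M[R[i]]_N.+1).
Hypothesis hermA : forall w, A w \is hermsymmx.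
Hypothesis mA : forall i j, cmeas (fun w => A w i j).
Local Notation mu := (expected_measure P (fun w => empirical_spectral_measure (A w))).

Lemma measurable_empirical_spectral_measure (B : set R) : measurable B ->
  measurable_fun [set: T] (fun w => empirical_spectral_measure (A w) B).
Proof.
move=> mB; under eq_fun do rewrite empirical_spectral_measureE.
apply/measurable_EFinP; apply: measurable_funM => //.
exact: measurable_count_eigenvalues.
Qed.

Lemma mean_expected_cauchy (b : bool) (eta : R) : 2 <= eta ->
  mean mu (fun x => x ^+ b * (x ^+ 2 + eta ^+ 2)^-1) =
  mean P (fun w => N.+1%:R^-1 * ((if b then - eta^-1 else (eta^-1) ^+ 2) *
    (if b then complex.Im (\sum_i diag_resolvent eta (A w) i)
     else complex.Re (\sum_i diag_resolvent eta (A w) i)))).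
Proof.
move=> eta_ge2; have eta_gt0 : 0 < eta by apply: lt_le_trans eta_ge2.
have eta2 : 4 <= eta ^+ 2 by rewrite expr2; nra.
rewrite mean_expected_measure; last 2 first.
- exact: measurable_empirical_spectral_measure.
- exact: bmeas_cauchy.
congr mean; apply/funext => w; rewrite mean_empirical; last exact: bmeas_cauchy.
congr (_ * _).
have -> : \sum_i diag_resolvent eta (A w) i = (0 +i* - eta) * \tr (resolvent eta (A w)).
  by rewrite mulr_sumr.
rewrite eigen_cauchy//.
case: b => /=.
  under eq_bigr do rewrite expr1.
  by field; exact: lt0r_neq0.
under eq_bigr do rewrite expr0 mul1r.
by field; exact: lt0r_neq0.
Qed.

End ExpectedSpectralMean.

(** * The semicircle distribution *)

Section SemicircleIntegrals.
Variable R : realType.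
Implicit Types (f g : R -> R) (x s w a b : R).
Local Notation leb := (@lebesgue_measure R).

Let drvD f g x a b : is_derive x 1 f a -> is_derive x 1 g b ->
  is_derive x 1 (fun y => f y + g y) (a + b).
Proof. exact: is_deriveD. Qed.

Let drvM f g x a b : is_derive x 1 f a -> is_derive x 1 g b ->
  is_derive x 1 (fun y => f y * g y) (f x * b + g x * a).
Proof. exact: is_deriveM. Qed.

Let drv_cst x a : is_derive x 1 (fun _ : R => a) 0.
Proof. exact: is_derive_cst. Qed.

Let drv_id x : is_derive x 1 (fun y : R => y) 1.
Proof. exact: is_derive_id. Qed.

Let drvZ f x a b : is_derive x 1 f b -> is_derive x 1 (fun y => a * f y) (a * b).
Proof.
move=> df; apply: (is_derive_eq (drvM (drv_cst x a) df)).
by rewrite mulr0 addr0.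
Qed.

Let drvV f x a : f x != 0 -> is_derive x 1 f a ->
  is_derive x 1 (fun y => (f y)^-1) (- a / f x ^+ 2).
Proof.
move=> fx df; apply: (is_derive_eq (is_deriveV fx df)).
by rewrite /GRing.scale/= mulNr mulNr mulrC.
Qed.

Let drv_sqr x : is_derive x 1 (fun y : R => y ^+ 2) (2 * x).
Proof.
apply: (is_derive_eq (drvM (drv_id x) (drv_id x))).
by ring.
Qed.

Let drv_sqrt f x a : 0 < f x -> is_derive x 1 f a ->
  is_derive x 1 (fun y => Num.sqrt (f y)) (a / (2 * Num.sqrt (f x))).
Proof.
move=> fx df; apply: (is_derive_eq (is_derive1_comp (is_derive1_sqrt fx) df)).
by rewrite mulrC.
Qed.

(* This is the arcsine on [[-1, 1]], in a form that is continuous everywhere. *)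
Definition half_angle w : R := 2 * atan (w / (1 + Num.sqrt (1 - w ^+ 2))).

Lemma half_angleN w : half_angle (- w) = - half_angle w.
Proof. by rewrite /half_angle sqrrN mulNr atanN mulrN. Qed.

Lemma half_angle1 : half_angle 1 = pi / 2.
Proof.
rewrite /half_angle expr1n subrr sqrtr0 addr0 divr1 atan1; by field.
Qed.

Lemma continuous_sqrt_comp f : continuous f -> continuous (fun x => Num.sqrt (f x)).
Proof. by move=> fc x; apply: (@cvg_comp _ _ _ f); [exact: fc|exact: sqrt_continuous]. Qed.

Lemma continuous_half_angle : continuous half_angle.
Proof.
apply: continuousM'; first exact: continuous_cst'.
move=> x; apply: (@continuous_comp _ _ _ (fun w => w / (1 + Num.sqrt (1 - w ^+ 2))) atan); last first.
  exact: continuous_atan.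
apply: continuousM'; first exact: continuous_id'.
apply: continuousV' => [|y]; last by rewrite lt0r_neq0// ltr_pwDl ?sqrtr_ge0.
apply: continuousD'; first exact: continuous_cst'.
apply: continuous_sqrt_comp => y; apply: cvgB; first exact: cvg_cst.
exact: exprn_continuous.
Qed.

Let drv_half_angle w : -1 < w < 1 -> is_derive w 1 half_angle (Num.sqrt (1 - w ^+ 2))^-1.
Proof.
move=> /andP[w_gt w_lt].
have w2 : 0 < 1 - w ^+ 2 by nra.
set c := Num.sqrt (1 - w ^+ 2); have c_gt0 : 0 < c by rewrite sqrtr_gt0.
have c2 : c ^+ 2 = 1 - w ^+ 2 by rewrite sqr_sqrtr// ltW.
have dsub : is_derive w 1 (fun y : R => 1 - y ^+ 2) (- (2 * w)).
  apply: (is_derive_eq (is_deriveB (drv_cst w 1) (drv_sqr w))).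
  by rewrite sub0r.
have dden := drvD (drv_cst w 1) (drv_sqrt (f := fun y => 1 - y ^+ 2) w2 dsub).
have den0 : 1 + Num.sqrt (1 - w ^+ 2) != 0 by rewrite lt0r_neq0// addr_gt0.
have dq := drvM (drv_id w) (drvV (f := fun y => 1 + Num.sqrt (1 - y ^+ 2)) den0 dden).
apply: (is_derive_eq (drvZ 2 (is_derive1_comp (is_derive1_atan _) dq))).
rewrite -/c; have c1 : 0 < 1 + c by rewrite addr_gt0.
have w2E : w ^+ 2 = 1 - c ^+ 2 by rewrite c2; ring.
have -> : w * (- (0 + - (2 * w) / (2 * c)) / (1 + c) ^+ 2) + (1 + c)^-1 * 1 =
    (c * (1 + c))^-1.
  transitivity (w ^+ 2 / (c * (1 + c) ^+ 2) + (1 + c)^-1); last rewrite w2E.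
    by field; rewrite !lt0r_neq0.
  by field; rewrite !lt0r_neq0.
have -> : 1 + (w / (1 + c)) ^+ 2 = 2 / (1 + c).
  by rewrite expr_div_n w2E; field; rewrite !lt0r_neq0.
by field; rewrite !lt0r_neq0.
Qed.

Let FTC f F : continuous f -> continuous F ->
  (forall x, -2 < x < 2 -> is_derive x 1 F (f x)) ->
  (\int[leb]_(x in `[(-2)%R, 2%R]) (f x)%:E = (F 2 - F (-2))%:E)%E.
Proof.
move=> fc Fc dF; rewrite EFinB; apply: continuous_FTC2.
- lra.
- by apply: continuous_subspaceT.
- split.
  + by move=> x; rewrite in_itv/= => xI; have [] := dF x xI.
  + by apply: cvg_at_right_filter; exact: Fc.
  + by apply: cvg_at_left_filter; exact: Fc.
- by move=> x; rewrite in_itv/= derive1E => xI; have dFx := dF x xI; rewrite derive_val.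
Qed.

Let continuous_sqrt4 : continuous (fun x : R => Num.sqrt (4 - x ^+ 2)).
Proof.
apply: continuous_sqrt_comp => y; apply: cvgB; first exact: cvg_cst.
exact: exprn_continuous.
Qed.

Let drv_sqrt4 x : -2 < x < 2 ->
  is_derive x 1 (fun y : R => Num.sqrt (4 - y ^+ 2)) (- x / Num.sqrt (4 - x ^+ 2)).
Proof.
move=> /andP[x_gt x_lt]; have x2 : 0 < 4 - x ^+ 2 by nra.
have dsub : is_derive x 1 (fun y : R => 4 - y ^+ 2) (- (2 * x)).
  apply: (is_derive_eq (is_deriveB (drv_cst x 4) (drv_sqr x))).
  by rewrite sub0r.
apply: (is_derive_eq (drv_sqrt (f := fun y => 4 - y ^+ 2) x2 dsub)).
by field; rewrite lt0r_neq0// sqrtr_gt0.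
Qed.

Let drv_half_angle2 x : -2 < x < 2 ->
  is_derive x 1 (fun y => half_angle (y / 2)) (Num.sqrt (4 - x ^+ 2))^-1.
Proof.
move=> /andP[x_gt x_lt]; have xI : -1 < x / 2 < 1 by apply/andP; split; lra.
have dh : is_derive x 1 (fun y : R => y / 2) (2^-1).
  apply: (is_derive_eq (drvM (drv_id x) (drv_cst x 2^-1))); rewrite mulr0 mulr1 add0r//.
apply: (is_derive_eq (is_derive1_comp (f := half_angle) (g := fun y => y / 2) (drv_half_angle xI) dh)).
have x2 : 0 < 4 - x ^+ 2 by nra.
have -> : 1 - (x / 2) ^+ 2 = (4 - x ^+ 2) / 2 ^+ 2 by field.
rewrite sqrtrM ?(ltW x2)// sqrtrV ?sqr_ge0// sqrtr_sqr ger0_norm//.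
by field; rewrite lt0r_neq0// sqrtr_gt0.
Qed.

Let continuous_half_angle2 : continuous (fun x : R => half_angle (x / 2)).
Proof.
move=> x; apply: (@continuous_comp _ _ _ (fun y : R => y / 2) half_angle).
  by apply: cvgM; [exact: cvg_id|exact: cvg_cst].
exact: continuous_half_angle.
Qed.

Let half2 : half_angle (2 / 2) = pi / 2.
Proof. by rewrite divff// half_angle1. Qed.

Let halfN2 : half_angle (- 2 / 2) = - (pi / 2).
Proof. by rewrite mulNr half_angleN half2. Qed.

Lemma integral_sqrt4 : (\int[leb]_(x in `[(-2)%R, 2%R]) (Num.sqrt (4 - x ^+ 2))%:E = (2 * pi)%:E)%E.
Proof.
pose F x := x * (Num.sqrt (4 - x ^+ 2) / 2) + 2 * half_angle (x / 2).
transitivity (F 2 - F (-2))%:E; last first.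
  rewrite /F sqrrN (_ : 4 - 2 ^+ 2 = 0) ?sqrtr0; last by ring.
  by rewrite half2 halfN2; congr EFin; field.
apply: FTC => //.
- apply: continuousD'.
    apply: continuousM'; first exact: continuous_id'.
    by apply: continuousM'; [exact: continuous_sqrt4|exact: continuous_cst'].
  by apply: continuousM'; [exact: continuous_cst'|exact: continuous_half_angle2].
- move=> x xI; have x2 : 0 < 4 - x ^+ 2 by nra.
  have d1 := drvM (drv_sqrt4 xI) (drv_cst x 2^-1).
  apply: (is_derive_eq (drvD (drvM (drv_id x) d1) (drvZ 2 (drv_half_angle2 xI)))).
  set c := Num.sqrt (4 - x ^+ 2); have c_gt0 : 0 < c by rewrite sqrtr_gt0.
  have x2E : x ^+ 2 = 4 - c ^+ 2 by rewrite sqr_sqrtr ?(ltW x2)//; ring.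
  transitivity (- x ^+ 2 / (2 * c) + c / 2 + 2 / c); last rewrite x2E.
    by field; rewrite lt0r_neq0.
  by field; rewrite lt0r_neq0.
Qed.

(** With c = sqrt (4 - x^2), the integrand is ((4 + s) / (x^2 + s) - 1) / c. The second part
    integrates to the arcsine of x / 2. The first is the derivative of an arcsine of u(x) times sqrt
    (4 + s) / sqrt s, because 1 - u^2 = s (4 - x^2) / (4 (x^2 + s)). *)
Lemma integral_sqrt4_cauchy s : 0 < s ->
  (\int[leb]_(x in `[(-2)%R, 2%R]) (Num.sqrt (4 - x ^+ 2) / (x ^+ 2 + s))%:E =
   (pi * (Num.sqrt (4 + s) / Num.sqrt s - 1))%:E)%E.
Proof.
move=> s_gt0; set A := _ / Num.sqrt s.
set p := Num.sqrt s; set q := Num.sqrt (4 + s).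
have s4_gt0 : 0 < 4 + s by rewrite addr_gt0.
have p_gt0 : 0 < p by rewrite sqrtr_gt0.
have q_gt0 : 0 < q by rewrite sqrtr_gt0.
have p2 : p ^+ 2 = s by rewrite sqr_sqrtr// ltW.
have q2 : q ^+ 2 = 4 + s by rewrite sqr_sqrtr// ltW.
pose u x := x * (q / 2) / Num.sqrt (x ^+ 2 + s).
have r_gt0 x : 0 < Num.sqrt (x ^+ 2 + s) by rewrite sqrtr_gt0 sqr_addr_gt0.
have uc : continuous u.
  apply: continuousM'.
    by apply: continuousM'; [exact: continuous_id'|exact: continuous_cst'].
  apply: continuousV' => [|x]; last by rewrite lt0r_neq0.
  by apply: continuous_sqrt_comp; exact: continuous_sqr_addr.
have u2 : u 2 = 1.
  rewrite /u (_ : 2 ^+ 2 + s = 4 + s); last by rewrite -natrX.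
  by rewrite -/q; field; rewrite lt0r_neq0.
have uN x : u (- x) = - u x by rewrite /u sqrrN !mulNr.
pose F x := A * half_angle (u x) + -1 * half_angle (x / 2).
transitivity (F 2 - F (-2))%:E; last first.
  by rewrite /F uN u2 half2 halfN2 half_angleN half_angle1; congr EFin; field.
apply: FTC.
- by apply: continuousM'; [exact: continuous_sqrt4|exact: continuous_cauchy].
- apply: continuousD'.
    apply: continuousM'; first exact: continuous_cst'.
    move=> x; apply: (@continuous_comp _ _ _ u half_angle); first exact: uc.
    exact: continuous_half_angle.
  by apply: continuousM'; [exact: continuous_cst'|exact: continuous_half_angle2].
- move=> x xI; have x2 : 0 < 4 - x ^+ 2 by nra.
  have xs_gt0 := sqr_addr_gt0 x s_gt0.
  set r := Num.sqrt (x ^+ 2 + s); have r0 : 0 < r := r_gt0 x.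
  have r2 : r ^+ 2 = x ^+ 2 + s by rewrite sqr_sqrtr// ltW.
  set c := Num.sqrt (4 - x ^+ 2); have c_gt0 : 0 < c by rewrite sqrtr_gt0.
  have c2 : c ^+ 2 = 4 - x ^+ 2 by rewrite sqr_sqrtr ?(ltW x2).
  have uE : 1 - u x ^+ 2 = (p * c / (2 * r)) ^+ 2.
    rewrite /u -/r; rewrite !(exprMn, exprVn) p2 q2 c2 r2.
    by field; rewrite lt0r_neq0.
  have pcr : 0 < p * c / (2 * r) by rewrite divr_gt0// mulr_gt0.
  have uI : -1 < u x < 1.
    by rewrite -ltr_norml -ltr_sqr ?nnegrE// real_normK ?num_real// expr1n -subr_gt0 uE exprn_gt0.
  have dr := drv_sqrt (f := fun y => y ^+ 2 + s) xs_gt0 (drvD (drv_sqr x) (drv_cst x s)).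
  have dV := drvV (f := fun y => Num.sqrt (y ^+ 2 + s)) (lt0r_neq0 r0) dr.
  have du := drvM (drvM (drv_id x) (drv_cst x (q / 2))) dV.
  have dh := drvZ A (is_derive1_comp (f := half_angle) (g := u) (drv_half_angle uI) du).
  apply: (is_derive_eq (drvD dh (drvZ (-1) (drv_half_angle2 xI)))).
  rewrite uE sqrtr_sqr gtr0_norm// -/r -/c -r2 /A -/p -/q.
  have -> : x * (q / 2) * (- ((2 * x + 0) / (2 * r)) / r ^+ 2) +
      r^-1 * (x * 0 + q / 2 * 1) = q * p ^+ 2 / (2 * r ^+ 3).
    have -> : p ^+ 2 = r ^+ 2 - x ^+ 2 by rewrite p2 r2; ring.
    by field; rewrite lt0r_neq0.
  have cE : c ^+ 2 = q ^+ 2 - r ^+ 2 by rewrite c2 q2 r2; ring.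
  transitivity ((q ^+ 2 - r ^+ 2) / (c * r ^+ 2)); last rewrite -cE.
    by field; rewrite !lt0r_neq0.
  by field; rewrite !lt0r_neq0.
Qed.

End SemicircleIntegrals.

Section SemicircleMean.
Variable R : realType.
Local Notation leb := (@lebesgue_measure R).
Local Notation sc := (@semicircle R).

Lemma semicircle_pdfE (x : R) : semicircle_pdf x = (2 * pi)^-1 * Num.sqrt (4 - x ^+ 2).
Proof.
rewrite /semicircle_pdf; congr (_ * _).
by case: leP => // h; rewrite sqrtr0 ler0_sqrtr.
Qed.

Lemma semicircle_pdf_out (x : R) : ~ `[(-2)%R, 2%R]%classic x -> semicircle_pdf x = 0.
Proof.
move=> /= /negP; rewrite in_itv/= => xI; rewrite semicircle_pdfE ler0_sqrtr ?mulr0//.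
move: xI; rewrite negb_and -!ltNge => /orP[] h; nra.
Qed.

Lemma integral_semicircle_itv (g : R -> R) :
  (\int[leb]_x (g x * semicircle_pdf x)%:E =
   \int[leb]_(x in `[(-2)%R, 2%R]) (g x * semicircle_pdf x)%:E)%E.
Proof.
rewrite [RHS]integral_mkcond; apply: eq_integral => x _.
rewrite patchE; case: ifPn => //; rewrite notin_setE => xI.
by rewrite semicircle_pdf_out// mulr0.
Qed.

Let continuous_pdf : continuous (@semicircle_pdf R).
Proof.
rewrite (_ : @semicircle_pdf R = fun x => (2 * pi)^-1 * Num.sqrt (4 - x ^+ 2)); last first.
  by apply/funext => x; exact: semicircle_pdfE.
apply: continuousM'; first exact: continuous_cst'.
apply: continuous_sqrt_comp => y; apply: cvgB; first exact: cvg_cst.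
exact: exprn_continuous.
Qed.

Let pi_gt0' : 0 < 2 * pi :> R.
Proof. by rewrite mulr_gt0// pi_gt0. Qed.

Let semicircle_setT : sc [set: R] = 1%E.
Proof.
rewrite /semicircle; under eq_integral do rewrite -[semicircle_pdf _]mul1r.
rewrite (integral_semicircle_itv (fun=> 1)).
under eq_integral do rewrite mul1r semicircle_pdfE EFinM.
rewrite ge0_integralZl//; last 2 first.
- apply: measurable_funTS; apply/measurable_EFinP; apply: continuous_measurable_fun.
  by apply: continuous_sqrt_comp => y; apply: cvgB; [exact: cvg_cst|exact: exprn_continuous].
- by rewrite lee_fin invr_ge0 ltW.
by rewrite integral_sqrt4 -EFinM mulVf// lt0r_neq0.
Qed.

HB.instance Definition _ := Measure_isProbability.Build _ _ R
  (@semicircle R) semicircle_setT.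

(* [lebesgue_measure] lives on [measurableTypeR R], whose display is not that of [R]. *)
Let nu (B : set (measurableTypeR R)) : \bar R := sc B.

Let nu0 : nu set0 = 0%E. Proof. exact: (measure0 sc). Qed.
Let nu_ge0 B : (0 <= nu B)%E. Proof. exact: (measure_ge0 sc). Qed.
Let nu_sigma_additive : semi_sigma_additive nu.
Proof. exact: (@measure_semi_sigma_additive _ _ _ sc). Qed.

#[local] HB.instance Definition _ := isMeasure.Build _ _ _ nu nu0 nu_ge0 nu_sigma_additive.
#[local] HB.instance Definition _ := Measure_isProbability.Build _ _ R nu semicircle_setT.

Let nu_dom : nu `<< leb.
Proof.
apply/null_content_dominatesP => B mB B0.
apply: null_set_integral => //; apply: measurable_funTS; apply/measurable_EFinP.
exact: measurable_semicircle_pdf.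
Qed.

(** The Radon-Nikodym derivative equals the density almost everywhere, both having the same integral
    over every measurable set. *)
Let integral_nu (g : measurableTypeR R -> \bar R) : nu.-integrable [set: measurableTypeR R] g ->
  (\int[nu]_x g x = \int[leb]_x (g x * (semicircle_pdf x)%:E))%E.
Proof.
move=> ig; rewrite -(Radon_Nikodym_change_of_variables nu_dom)//=.
apply: ae_eq_integral => //.
- apply: emeasurable_funM; first exact: measurable_int ig.
  apply: (measurable_int leb).
  by apply: Radon_Nikodym_integrable; exact: nu_dom.
- apply: emeasurable_funM; first exact: measurable_int ig.
  by apply/measurable_EFinP; exact: measurable_semicircle_pdf.
- apply: ae_eqe_mul2l => /=.
  rewrite Radon_NikodymE//=; case: cid => /= h [h1 h2 h3].
  apply: integral_ae_eq => //=.
  + by apply/measurable_EFinP; exact: measurable_semicircle_pdf.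
  + by move=> E E01 mE; rewrite -h3.
Qed.

Lemma integral_semicircle (g : R -> R) : bounded_measurable g ->
  (\int[sc]_x (g x)%:E = \int[leb]_x (g x * semicircle_pdf x)%:E)%E.
Proof.
move=> [mg [M gM]].
have mid : measurable_fun [set: measurableTypeR R] (id : measurableTypeR R -> R).
  by move=> _ B mB; rewrite setTI.
transitivity (\int[pushforward nu (id : measurableTypeR R -> R)]_x (g x)%:E)%E.
  by apply: eq_measure_integral => B mB _.
have ig : nu.-integrable [set: measurableTypeR R] (EFin \o (g : measurableTypeR R -> R)).
  by apply: bmeas_integrable; split; [exact: mg|exists M].
rewrite integral_pushforward//; last exact/measurable_EFinP.
rewrite integral_nu//.
Qed.

Lemma mean_semicircle (g : R -> R) : bounded_measurable g ->
  mean sc g = fine (\int[leb]_(x in `[(-2)%R, 2%R]) (g x * semicircle_pdf x)%:E)%E.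
Proof.
move=> bg; rewrite /mean /Rintegral; congr fine.
by rewrite integral_semicircle// integral_semicircle_itv.
Qed.

Lemma mean_semicircle_cauchy (s : R) : 4 <= s ->
  mean sc (fun x => x ^+ false * (x ^+ 2 + s)^-1) =
  (Num.sqrt (4 + s) / Num.sqrt s - 1) / 2.
Proof.
move=> s4; have s_gt0 : 0 < s by apply: lt_le_trans s4.
rewrite mean_semicircle; last exact: bmeas_cauchy.
under eq_integral do rewrite expr0 mul1r mulrC semicircle_pdfE -mulrA EFinM.
rewrite ge0_integralZl//; last 3 first.
- apply: measurable_funTS; apply/measurable_EFinP; apply: continuous_measurable_fun.
  apply: continuousM'; last exact: continuous_cauchy.
  by apply: continuous_sqrt_comp => y; apply: cvgB; [exact: cvg_cst|exact: exprn_continuous].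
- by move=> x _; rewrite lee_fin divr_ge0 ?sqrtr_ge0// ltW// sqr_addr_gt0.
- by rewrite lee_fin invr_ge0 ltW.
rewrite integral_sqrt4_cauchy//=.
have pi0 : pi != 0 :> R by rewrite lt0r_neq0// pi_gt0.
have sq0 : Num.sqrt s != 0 by rewrite lt0r_neq0// sqrtr_gt0.
by rewrite invfM -mulrA [pi^-1 * _]mulrA mulVf// mul1r mulrC.
Qed.

Lemma mean_semicircle_odd (s : R) : 4 <= s ->
  mean sc (fun x => x ^+ true * (x ^+ 2 + s)^-1) = 0.
Proof.
move=> s4; have s_gt0 : 0 < s by apply: lt_le_trans s4.
rewrite mean_semicircle; last exact: bmeas_cauchy.
pose h x : R := x ^+ true * (x ^+ 2 + s)^-1 * semicircle_pdf x.
have hc : continuous h.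
  apply: continuousM' => //; apply: continuousM'; last exact: continuous_cauchy.
  exact: (continuousX' (@continuous_id' R)).
have hN x : h (- x) = - h x.
  by rewrite /h !expr1 sqrrN !semicircle_pdfE sqrrN !mulNr.
have := @integration_by_substitution_oppr R h (-2) 2 ltac:(lra).
rewrite opprK => /(_ ltac:(by apply: continuous_subspaceT)).
move=> /(congr1 fine); rewrite -/(Rintegral _ _ _) -[RHS]/(Rintegral _ _ _) => II.
rewrite -/(Rintegral _ _ h).
have : Rintegral leb `[(-2)%R, 2%R] h = - Rintegral leb `[(-2)%R, 2%R] h.
  rewrite -[RHS]mulN1r -(@RintegralZl _ _ _ leb)//; last first.
    by apply: continuous_compact_integrable; [exact: segment_compact|exact: continuous_subspaceT].
  rewrite [LHS]II; congr fine; apply: eq_integral => x _ /=.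
  by rewrite hN mulN1r.
lra.
Qed.

End SemicircleMean.

(** * Truncation *)

Section TruncationComparison.
Context d (T : measurableType d) (R : realType) (P : probability T R).
Context (N : nat) (W : T -> 'M[R[i]]_N).
Hypothesis wignerW : hermitian_wigner P W.

Definition tail_prob (t : R) i j := fine (P [set w | t < Normc.normc (W w i j)]).

Lemma measurable_tail (t : R) i j : measurable [set w | t < Normc.normc (W w i j)].
Proof.
have mW := measurable_normc (cmeas_wigner wignerW i j).
rewrite (_ : [set w | _] = (fun w => Normc.normc (W w i j)) @^-1` `]t, +oo[%classic).
  by rewrite -[X in measurable X]setTI; exact: mW.
by apply/seteqP; split=> w /=; rewrite in_itv/= andbT.
Qed.

Lemma tail_prob_ge0 (t : R) i j : 0 <= tail_prob t i j.
Proof. exact: fine_ge0. Qed.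

Lemma tail_prob_le1 (t : R) i j : tail_prob t i j <= 1.
Proof.
rewrite /tail_prob -(mean_indic P (measurable_tail t i j)); apply: mean_le => [|w].
  by apply: bmeas_indic; exact: measurable_tail.
by rewrite indicE; case: (_ \in _).
Qed.

Lemma expectation_on_trunc_var i j :
  expectation_on P (fun w => Normc.normc (W w i j) ^+ 2) [set w | Normc.normc (W w i j) <= 1] =
  trunc_var P W 1 i j.
Proof.
rewrite /expectation_on expectation.unlock /trunc_var /mean /Rintegral; congr fine.
apply: eq_integral => w _; congr EFin; rewrite mxE /truncc indicE.
case: ifPn => h; first by rewrite mem_set// mulr1.
by rewrite memNset ?Normc.normc0 ?expr0n ?mulr0//=; exact/negP.
Qed.

Lemma complex_expectation_on_trunc_mean i j :
  Normc.normc (complex_expectation_on P (fun w => W w i j)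
    [set w | Normc.normc (W w i j) <= 1]) = trunc_mean P W 1 i j.
Proof.
rewrite /trunc_mean /complex_expectation_on /expectation_on !expectation.unlock.
have E (f : R[i] -> R) : f 0 = 0 ->
    fine (\int[P]_w (f (W w i j) * \1_[set w | Normc.normc (W w i j) <= 1] w)%:E)%E =
    mean P (fun w => f (truncmx 1 (W w) i j)).
  move=> f0; rewrite /mean /Rintegral; congr fine.
  apply: eq_integral => w _; congr EFin; rewrite mxE /truncc indicE.
  case: ifPn => h; first by rewrite mem_set// mulr1.
  by rewrite memNset ?f0 ?mulr0//=; exact/negP.
by rewrite (E (@complex.Re R)) ?(E (@complex.Im R)).
Qed.

Variable t : R.
Hypothesis t_gt0 : 0 < t.
Hypothesis t_le1 : t <= 1.
Local Notation tail i j := ([set w | t < Normc.normc (W w i j)]).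

Let bH (u : R) i j : 0 < u -> bcmeas (fun w => truncmx u (W w) i j).
Proof. by move=> u0; exact: (bcmeas_H wignerW u0). Qed.

Let btail i j : bounded_measurable (\1_(tail i j) : T -> R).
Proof. by apply: bmeas_indic; exact: measurable_tail. Qed.

Lemma trunc_var_le1 i j : trunc_var P W t i j <= trunc_var P W 1 i j.
Proof.
apply: le_mean => [||w]; [exact/bmeas_normc2/bH|exact/bmeas_normc2/bH|].
rewrite !mxE /truncc; case: ifP => h; first by rewrite (le_trans h).
by rewrite Normc.normc0 expr0n sqr_ge0.
Qed.

Lemma trunc_var1_le i j : trunc_var P W 1 i j <= trunc_var P W t i j + tail_prob t i j.
Proof.
rewrite /tail_prob -(mean_indic P (measurable_tail t i j)) -meanD//; last exact/bmeas_normc2/bH.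
apply: le_mean => [||w]; first exact/bmeas_normc2/bH.
  by apply: bmeasD => //; exact/bmeas_normc2/bH.
rewrite !mxE /truncc indicE; have [h|h] := leP (Normc.normc (W w i j)) t.
  by rewrite (le_trans h)//= lerDl; case: (_ \in _).
rewrite (mem_set (A := [set w0 | t < Normc.normc (W w0 i j)]) h) Normc.normc0 expr0n add0r.
by case: ifP => h1; rewrite ?Normc.normc0 ?expr0n// expr_le1// normc_ge0.
Qed.

Let proj_diff (f : R[i] -> R) i j : f 0 = 0 -> (forall x, `|f x| <= Normc.normc x) ->
  bounded_measurable (fun w => f (truncmx 1 (W w) i j)) ->
  bounded_measurable (fun w => f (truncmx t (W w) i j)) ->
  `|mean P (fun w => f (truncmx t (W w) i j)) - mean P (fun w => f (truncmx 1 (W w) i j))| <=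
  tail_prob t i j.
Proof.
move=> f0 fle b1 bt; rewrite -meanB// /tail_prob -(mean_indic P (measurable_tail t i j)).
apply: le_trans (ler_norm_mean P (bmeasB bt b1)) _.
apply: le_mean => // [|w]; first by apply: bmeas_norm; exact: bmeasB.
rewrite !mxE /truncc indicE; have [h|h] := leP (Normc.normc (W w i j)) t.
  by rewrite (le_trans h)//= subrr normr0; case: (_ \in _).
rewrite (mem_set (A := [set w0 | t < Normc.normc (W w0 i j)]) h) f0 sub0r normrN; case: ifP => h1; last by rewrite f0 normr0.
exact: le_trans (fle _) h1.
Qed.

(** Each of the real and imaginary parts moves by at most the tail probability p when the level
    changes. Since p <= 1, the square of this change is at most p, so the error is linear in p and
    its sum is covered by the tail hypothesis. *)
Lemma trunc_mean_sqr_le i j :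
  trunc_mean P W t i j ^+ 2 <= 2 * trunc_mean P W 1 i j ^+ 2 + 4 * tail_prob t i j.
Proof.
rewrite /trunc_mean !normc_sqr /=.
have p0 := tail_prob_ge0 t i j; have p1 := tail_prob_le1 t i j.
have [b1 bt] := (bH i j ltr01, bH i j t_gt0).
have := @proj_diff (@complex.Re R) i j erefl (@ge_Re_normc R) (bmeas_Re b1) (bmeas_Re bt).
have := @proj_diff (@complex.Im R) i j erefl (@ge_Im_normc R) (bmeas_Im b1) (bmeas_Im bt).
set a := mean _ _; set b := mean _ _; set c := mean _ _; set e := mean _ _.
move: p0 p1; set p := tail_prob _ _ _ => p0 p1.
have sq (x y : R) : `|x - y| <= p -> x ^+ 2 <= 2 * y ^+ 2 + 2 * p.
  rewrite ler_norml => /andP[h1 h2].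
  have : (x - y) ^+ 2 <= p by nra.
  by have := sqr_ge0 (x - 2 * y); nra.
by move=> /sq h1 /sq h2; lra.
Qed.

Lemma mean_changed_entries :
  let count w : R := #|[set ij : 'I_N * 'I_N | W w ij.1 ij.2 != truncmx t (W w) ij.1 ij.2]%SET|%:R in
  bounded_measurable count /\ mean P count <= \sum_i \sum_j tail_prob t i j.
Proof.
move=> count.
have countE : count = fun w => \sum_i \sum_j \1_(tail i j) w.
  apply/funext => w; rewrite /count pair_big/= -sum1_card natr_sum big_mkcond/=.
  apply: eq_bigr => -[i j] _ /=; rewrite inE /= mxE /truncc indicE.
  have [h|h] := leP (Normc.normc (W w i j)) t.
    by rewrite eqxx/= memNset//= ltNge h.
  rewrite (mem_set (A := [set w0 | t < Normc.normc (W w0 i j)]) h); case: eqP => // W0; move: h.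
  by rewrite W0 Normc.normc0 ltNge (ltW t_gt0).
split.
  rewrite countE; apply: bmeas_sum => i _; apply: bmeas_sum => j _; exact: btail.
rewrite countE mean_sum; last by move=> i _; apply: bmeas_sum => j _; exact: btail.
apply: ler_sum => i _; rewrite mean_sum; last by move=> j _; exact: btail.
by apply: ler_sum => j _; rewrite mean_indic//; exact: measurable_tail.
Qed.

(** The factor eta in [diag_resolvent] cancels the 1/eta per changed entry in [tr_resolvent_diff],
    so the bound is the mean number of changed entries, whatever eta is. *)
Lemma mean_tr_resolvent_trunc (eta : R) : 0 < eta -> forall f : R[i] -> R,
  (forall x y, f (x - y) = f x - f y) -> (forall x, `|f x| <= Normc.normc x) ->
  bounded_measurable (fun w => f (\sum_i diag_resolvent eta (W w) i)) ->
  bounded_measurable (fun w => f (\sum_i diag_resolvent eta (truncmx t (W w)) i)) ->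
  `|mean P (fun w => f (\sum_i diag_resolvent eta (W w) i)) -
    mean P (fun w => f (\sum_i diag_resolvent eta (truncmx t (W w)) i))| <=
  \sum_i \sum_j tail_prob t i j.
Proof.
move=> eta_gt0 f fB fle bW bH'; have [bc cle] := mean_changed_entries.
case: wignerW => hermW _ _.
rewrite -meanB//; apply: le_trans (ler_norm_mean P (bmeasB bW bH')) _.
apply: le_trans cle; apply: le_mean => // [|w]; first by apply: bmeas_norm; exact: bmeasB.
rewrite -fB; apply: le_trans (fle _) _.
rewrite /diag_resolvent -!mulr_sumr -mulrBr Normc.normcM.
have := tr_resolvent_diff eta_gt0 (hermW w) (hermsymmx_truncmx t (hermW w)).
rewrite mulrC ler_pdivlMr// mulrC; apply: le_trans.
rewrite ler_wpM2r ?normc_ge0// le_eqVlt; apply/orP; left.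
by rewrite /Normc.normc expr0n add0r sqrrN sqrtr_sqr ger0_norm// ltW.
Qed.

End TruncationComparison.

(** The flag is the exponent of x in the Cauchy kernel: up to scaling, the even kernel is the real
    part of the trace of - i eta G and the odd kernel its imaginary part. *)
Definition part (R : realType) (b : bool) (x : R[i]) : R :=
  if b then complex.Im x else complex.Re x.

Section Part.
Variables (R : realType) (b : bool).
Implicit Types x y : R[i].

Lemma partD x y : part b (x + y) = part b x + part b y.
Proof. by case: b; case: x; case: y. Qed.

Lemma partN x : part b (- x) = - part b x.
Proof. by case: b; case: x. Qed.

Lemma part0 : part b (0 : R[i]) = 0.
Proof. by case: b. Qed.

Lemma part_le x : `|part b x| <= Normc.normc x.
Proof. by case: b; [exact: ge_Im_normc|exact: ge_Re_normc]. Qed.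

Lemma bmeas_part d (T : measurableType d) (f : T -> R[i]) : bcmeas f ->
  bounded_measurable (fun w => part b (f w)).
Proof. by case: b => bf; [exact: bmeas_Im|exact: bmeas_Re]. Qed.

End Part.

(** * Estimates for a fixed matrix size *)

Section FiniteSize.
Context d (T : measurableType d) (R : realType) (P : probability T R).
Context (n : nat) (W : T -> 'M[R[i]]_n.+1) (eta t : R).
Hypothesis wignerW : hermitian_wigner P W.
Hypothesis eta_ge2 : 2 <= eta.
Hypothesis t_gt0 : 0 < t.
Hypothesis t_le1 : t <= 1.
Local Notation N := (n.+1%:R : R).
Local Notation k w i := (diag_resolvent eta (truncmx t (W w)) i).
Local Notation eps := (eta^-1 ^+ 2).

Definition avg_tail := N^-1 * \sum_i \sum_j tail_prob P W t i j.
Definition avg_var := N^-1 * \sum_i \sum_j trunc_var P W t i j.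
Definition avg_deviation := N^-1 * \sum_i `|\sum_j trunc_var P W t i j - 1|.

Let eta_gt0 : 0 < eta. Proof. exact: lt_le_trans eta_ge2. Qed.
Let N_gt0 : 0 < N. Proof. exact: ltr0Sn. Qed.
Let Nv_ge0 : 0 <= N^-1. Proof. by rewrite invr_ge0 ltW. Qed.
Let hermW w : W w \is hermsymmx. Proof. by case: wignerW. Qed.

Definition avg_defect (a b : R[i]) := N^-1 *
  \sum_i `|mean P (fun w => complex.Re (defect P W eta t w i * (a + b * (k w i)^*%C)))|.

(** Here v bounds the average row sum, m the averaged squared means at level 1, and p is the
    averaged tail. The first summand is small by the choice of t, the second for large n once t is
    fixed. *)
Definition defect_error (v m p : R) := t * (1 + v) + t^-1 * (2 * m + 4 * p).

Lemma avg_defect_le a b (v m : R) :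
  N^-1 * (\sum_i \sum_j trunc_var P W 1 i j) <= v ->
  N^-1 * (\sum_i \sum_j trunc_mean P W 1 i j ^+ 2) <= m ->
  avg_defect a b <= defect_cst eta a b * defect_error v m avg_tail.
Proof.
move=> hv hm.
have := ler_wpM2l Nv_ge0 (defect_bound wignerW eta_gt0 t_gt0 t_le1 a b).
rewrite -/(avg_defect a b); move/le_trans; apply; rewrite mulrCA.
apply: ler_wpM2l; first exact: defect_cst_ge0.
rewrite /defect_error.
have V : N^-1 * (\sum_i \sum_j trunc_var P W t i j) <= v.
  apply: le_trans hv; apply: ler_wpM2l => //.
  by apply: ler_sum => i _; apply: ler_sum => j _; exact: trunc_var_le1.
have M : N^-1 * (\sum_i \sum_j trunc_mean P W t i j ^+ 2) <= 2 * m + 4 * avg_tail.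
  apply: (@le_trans _ _ (2 * (N^-1 * (\sum_i \sum_j trunc_mean P W 1 i j ^+ 2)) + 4 * avg_tail)).
    rewrite /avg_tail -[2 * _]mulrCA -[4 * _]mulrCA -mulrDr; apply: ler_wpM2l => //.
    rewrite !mulr_sumr -big_split/=; apply: ler_sum => i _.
    rewrite !mulr_sumr -big_split/=; apply: ler_sum => j _.
    exact: trunc_mean_sqr_le.
  by rewrite lerD2r ler_wpM2l.
have t0 := ltW t_gt0; have tv0 : 0 <= t^-1 by rewrite invr_ge0.
have := ler_wpM2l t0 V; have := ler_wpM2l tv0 M.
move: (\sum_i \sum_j trunc_var _ _ _ _ _) (\sum_i \sum_j trunc_mean _ _ _ _ _ ^+ 2) => x y h1 h2.
rewrite (_ : N^-1 * _ = t + t * (N^-1 * x) + t^-1 * (N^-1 * y)); last first.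
  by rewrite !mulrDr ![N^-1 * (_ * _)]mulrCA mulVf ?mulr1// lt0r_neq0.
by rewrite mulrDr mulr1; apply: lerD => //; rewrite lerD2l.
Qed.

Lemma bmeas_sum_diag_resolvent (b : bool) (A : T -> 'M[R[i]]_n.+1) :
  (forall w, A w \is hermsymmx) -> (forall i j, cmeas (fun w => A w i j)) ->
  bounded_measurable (fun w => part b (\sum_i diag_resolvent eta (A w) i)).
Proof.
move=> hA mA; apply: (@bmeas_part _ b _ _ (fun w => \sum_i diag_resolvent eta (A w) i)).
apply: bcmeas_sum => i; apply: bcmeasM; first exact: bcmeas_cst.
split; first exact: cmeas_resolvent.
by exists eta^-1 => w; exact: normc_resolvent_le.
Qed.

Let bk i : bcmeas (fun w => k w i).
Proof. by apply: (bcmeas_diag (P := P)). Qed.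

Lemma avg_resolvent_trunc (b : bool) :
  `|mean P (fun w => N^-1 * part b (\sum_i diag_resolvent eta (W w) i)) -
    N^-1 * \sum_i mean P (fun w => part b (k w i))| <= avg_tail.
Proof.
have mW i j : cmeas (fun w => W w i j) by exact: (cmeas_wigner wignerW).
have mH i j : cmeas (fun w => truncmx t (W w) i j) by have [] := bcmeas_H wignerW t_gt0 i j.
have b1 := bmeas_sum_diag_resolvent b hermW mW.
have b2 := bmeas_sum_diag_resolvent b (hermH t wignerW) mH.
have -> : \sum_i mean P (fun w => part b (k w i)) = mean P (fun w => part b (\sum_i k w i)).
  rewrite -mean_sum; last by move=> i _; exact: bmeas_part.
  by congr mean; apply/funext => w; rewrite (big_morph (part b) (partD b) (part0 R b)).
rewrite meanZ// -mulrBr normrM ger0_norm//; apply: ler_wpM2l => //.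
apply: (mean_tr_resolvent_trunc wignerW t_gt0 eta_gt0 (f := part b)) => // [x y|x].
  by rewrite partD partN.
exact: part_le.
Qed.

Lemma avg_var_trunc :
  avg_var <= N^-1 * (\sum_i \sum_j trunc_var P W 1 i j) <= avg_var + avg_tail.
Proof.
apply/andP; split.
  apply: ler_wpM2l => //; apply: ler_sum => i _; apply: ler_sum => j _.
  exact: trunc_var_le1.
rewrite /avg_var /avg_tail -mulrDr; apply: ler_wpM2l => //.
rewrite -big_split/=; apply: ler_sum => i _.
rewrite -big_split/=; apply: ler_sum => j _; exact: trunc_var1_le.
Qed.

Lemma avg_deviation_trunc :
  `|avg_deviation - N^-1 * (\sum_i `|\sum_j trunc_var P W 1 i j - 1|)| <= avg_tail.
Proof.
rewrite /avg_deviation /avg_tail -mulrBr normrM ger0_norm//; apply: ler_wpM2l => //.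
rewrite -sumrB; apply: le_trans (ler_norm_sum _ _ _) _; apply: ler_sum => i _.
apply: le_trans (ler_dist_dist _ _) _.
rewrite opprB addrA subrK distrC ger0_norm; last first.
  by rewrite subr_ge0; apply: ler_sum => j _; exact: trunc_var_le1.
by rewrite lerBlDl -big_split/=; apply: ler_sum => j _; exact: trunc_var1_le.
Qed.

(** The first moment follows from |x| <= g + x^2 / g and [deviation_bound]; since eta >= 2 gives eps
    <= 1/4, dividing by 1 - eps costs less than a factor 2. *)
Lemma avg_diag_near (kappa g : R) (b : bool) :
  0 <= kappa -> kappa <= 1 -> kappa = 1 - eps * kappa ^+ 2 -> 0 < g ->
  `|N^-1 * \sum_i mean P (fun w => part b (k w i)) - part b kappa%:C| <=
  g + 2 * g^-1 * (avg_defect (- kappa%:C) 1 + 6 * avg_deviation).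
Proof.
move=> kap0 kap1 kapE g_gt0.
have epsE : eps <= 1 / 4.
  have e0 : 0 <= eta^-1 by rewrite invr_ge0 ltW.
  have e1 : eta^-1 <= 1 / 2.
    rewrite -[eta^-1]mul1r ler_pdivrMr//; move: eta_ge2 => h.
    lra.
  by nra.
have eps0 : 0 <= eps by rewrite sqr_ge0.
have bx i : bcmeas (fun w => k w i - kappa%:C) by apply: bcmeasB => //; exact: bcmeas_cst.
pose D := \sum_i mean P (fun w => Normc.normc (k w i - kappa%:C) ^+ 2).
have D0 : 0 <= D by apply: sumr_ge0 => i _; apply: mean_ge0 => w; exact: sqr_ge0.
have DE : N^-1 * D <= 2 * (avg_defect (- kappa%:C) 1 + 6 * avg_deviation).
  have := ler_wpM2l Nv_ge0 (deviation_bound wignerW eta_gt0 t_gt0 kap0 kap1 kapE).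
  rewrite mulrDr -/(avg_defect _ _) -/D.
  have : 0 <= N^-1 * D by rewrite mulr_ge0.
  have : 0 <= avg_deviation by rewrite mulr_ge0// sumr_ge0.
  rewrite (_ : N^-1 * (6 * eps * _) = 6 * eps * avg_deviation); last by rewrite /avg_deviation; ring.
  rewrite (_ : N^-1 * ((1 - eps) * D) = (1 - eps) * (N^-1 * D)); last by ring.
  have : 0 <= avg_defect (- kappa%:C) 1 by rewrite mulr_ge0// sumr_ge0.
  move: (avg_defect _ _) avg_deviation (N^-1 * D) => x y z x0 y0 z0 h.
  have : eps * y <= 1 / 4 * y by rewrite ler_wpM2r.
  have : eps * z <= 1 / 4 * z by rewrite ler_wpM2r.
  by lra.
rewrite (_ : N^-1 * _ - _ = N^-1 * \sum_i mean P (fun w => part b (k w i - kappa%:C))); last first.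
  rewrite [in RHS](eq_bigr (fun i => mean P (fun w => part b (k w i)) - part b kappa%:C)); last first.
    move=> i _; rewrite -[part b kappa%:C](mean_cst P) -meanB ?mean_cst//; last 2 first.
    - exact: bmeas_part.
    - exact: bmeas_cst.
    by congr mean; apply/funext => w; rewrite partD partN.
  rewrite sumrB sumr_const card_ord -[part b _ *+ _]mulr_natr mulrBr.
  by congr (_ - _); rewrite mulrCA mulVf ?mulr1// lt0r_neq0.
rewrite normrM ger0_norm//.
apply: (@le_trans _ _ (N^-1 * \sum_(i < n.+1) (g + g^-1 * mean P (fun w => Normc.normc (k w i - kappa%:C) ^+ 2)))).
  apply: ler_wpM2l => //; apply: le_trans (ler_norm_sum _ _ _) _; apply: ler_sum => i _.
  apply: le_trans (ler_norm_mean P (bmeas_part b (bx i))) _.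
  have b2 := bmeas_normc2 (bx i).
  rewrite -meanZ// -[X in X + _](mean_cst P g) -meanD//; last 2 first.
  - exact: bmeas_cst.
  - by apply: bmeasM => //; exact: bmeas_cst.
  apply: le_mean => [||w].
  - by apply: bmeas_norm; exact: bmeas_part.
  - by apply: bmeasD; [exact: bmeas_cst|apply: bmeasM => //; exact: bmeas_cst].
  apply: le_trans (part_le _ _) _; set x := Normc.normc _.
  rewrite -subr_ge0 (_ : _ - _ = g^-1 * ((g - x / 2) ^+ 2 + 3 / 4 * x ^+ 2)).
    by rewrite mulr_ge0 ?invr_ge0 ?(ltW g_gt0)// addr_ge0 ?sqr_ge0// mulr_ge0 ?sqr_ge0.
  by field; rewrite lt0r_neq0.
rewrite big_split/= -mulr_sumr sumr_const card_ord -[g *+ _]mulr_natr -/D.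
rewrite mulrDr mulrCA mulVf ?lt0r_neq0// mulr1 lerD2l mulrCA -[leRHS]mulrA [leRHS]mulrCA.
by apply: ler_wpM2l DE; rewrite invr_ge0 ltW.
Qed.

End FiniteSize.

Section Kappa.
Variables (R : realType) (eta : R).
Hypothesis eta_ge2 : 2 <= eta.
Local Notation eps := (eta^-1 ^+ 2).

(* [kappa eta = - i eta m(i eta)], where [m] is the Stieltjes transform of the
   semicircle distribution. *)
Definition kappa := eta * (Num.sqrt (4 + eta ^+ 2) - eta) / 2.

Let eta_gt0 : 0 < eta. Proof. exact: lt_le_trans eta_ge2. Qed.

Lemma kappaE : kappa = 1 - eps * kappa ^+ 2.
Proof.
have s2 : Num.sqrt (4 + eta ^+ 2) ^+ 2 = 4 + eta ^+ 2.
  by rewrite sqr_sqrtr// addr_ge0 ?sqr_ge0.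
rewrite /kappa; move: (Num.sqrt _) s2 => s s2.
have -> : eps * (eta * (s - eta) / 2) ^+ 2 = (s ^+ 2 - 2 * s * eta + eta ^+ 2) / 4.
  by field; rewrite lt0r_neq0.
by rewrite s2; field.
Qed.

Lemma kappa_ge0 : 0 <= kappa.
Proof.
rewrite divr_ge0// mulr_ge0 ?(ltW eta_gt0)// subr_ge0 -[leLHS]ger0_norm ?(ltW eta_gt0)//.
by rewrite -sqrtr_sqr ler_sqrt ?addr_ge0 ?sqr_ge0// lerDr.
Qed.

Lemma eps_range : 0 < eps <= 1 / 4.
Proof.
have e0 : 0 < eta^-1 by rewrite invr_gt0.
have e1 : eta^-1 <= 1 / 2.
  by rewrite -[eta^-1]mul1r ler_pdivrMr//; move: eta_ge2 => h; lra.
by rewrite exprn_gt0//=; nra.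
Qed.

Lemma kappa_le1 : kappa <= 1.
Proof.
rewrite kappaE gerBl mulr_ge0 ?sqr_ge0//.
Qed.

Lemma mean_semicircle_kappa :
  mean (@semicircle R) (fun x => x ^+ false * (x ^+ 2 + eta ^+ 2)^-1) = eps * kappa.
Proof.
rewrite mean_semicircle_cauchy; last by move: eta_ge2 => h; nra.
rewrite sqrtr_sqr gtr0_norm// /kappa; field; exact: lt0r_neq0.
Qed.

End Kappa.

Lemma exists_eta (R : realType) (c : R) : 0 < c -> exists2 eta : R, 2 <= eta & eta^-1 ^+ 2 <= c.
Proof.
move=> c_gt0; exists (2 + c^-1); first by rewrite lerDl invr_ge0 ltW.
have ci : 0 < c^-1 by rewrite invr_gt0.
have e_gt0 : 0 < 2 + c^-1 by rewrite addr_gt0.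
have h1 : (2 + c^-1)^-1 <= 1 by rewrite invf_le1//; lra.
have h2 : (2 + c^-1)^-1 <= c.
  by rewrite -[leRHS]invrK lef_pV2 ?posrE//; lra.
have h0 : 0 <= (2 + c^-1)^-1 by rewrite invr_ge0 ltW.
by rewrite expr2; apply: le_trans h2; rewrite ler_piMl.
Qed.

(** The normalised [total_variance_ge] and [total_variance_le] divided by [ep]. The defects become
    dl / ep, so dl has to be chosen after eta. *)
Lemma variance_arith (R : realFieldType) (ep k2 tr X B b v K dl : R) : 0 < ep -> 1 <= K ->
  1 - 2 * ep <= k2 -> k2 <= 1 -> `|tr - ep * k2| <= dl -> X <= dl -> 0 <= B -> B <= b ->
  tr - X <= ep * v -> ep * v <= tr + X + ep * (3 * K * tr + 8 * B) ->
  `|v - 1| <= 2 * ep + 3 * K * (ep + dl) + 8 * b + 2 * (dl / ep).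
Proof.
move=> ep_gt0 K1 kl ku; rewrite ler_norml => /andP[tl tu] Xd B0 Bb lo hi.
have dl0 : 0 <= dl by lra.
set c := dl / ep; have dlE : dl = ep * c by rewrite /c mulrCA divff ?mulr1// lt0r_neq0.
have h1 : k2 - 2 * c <= v by rewrite -(ler_pM2l ep_gt0) mulrBr; lra.
have ek : ep * k2 <= ep by rewrite ler_piMr// ltW.
have tr_le : tr <= ep + dl by lra.
have KT : 3 * K * tr <= 3 * K * (ep + dl) by rewrite ler_wpM2l//; lra.
have h2 : v <= k2 + 2 * c + (3 * K * (ep + dl) + 8 * b).
  rewrite -(ler_pM2l ep_gt0); apply: le_trans hi _.
  have : ep * (3 * K * tr + 8 * B) <= ep * (3 * K * (ep + dl) + 8 * b).
    by rewrite ler_pM2l//; lra.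
  by rewrite !mulrDr; lra.
have c0 : 0 <= c by rewrite divr_ge0// ltW.
have K0 : 0 <= 3 * K * (ep + dl) by rewrite mulr_ge0//; lra.
by rewrite ler_norml; apply/andP; split; lra.
Qed.

(** The essential cancellation: tr / ep is close to kappa^2 >= 1 - 2 ep and v is close to 1, so [hQ]
    gives Q <= 1 plus errors. An error [sg] of v is divided by 2 ep here, hence must be small
    compared with ep. *)
Lemma deviation_arith (R : realFieldType) (ep k2 tr X Y B b v K dl g sg Q dv : R) :
  0 < ep -> 1 <= K -> 0 < g -> 1 - 2 * ep <= k2 -> `|tr - ep * k2| <= dl ->
  X <= dl -> Y <= dl -> B <= b -> `|v - 1| <= sg ->
  2 * ep * Q <= v - (tr - X) / ep + 11 * ep ^+ 2 * K ^+ 3 +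
    (6 * ep * K ^+ 2 + 2 * K) * X + 6 * K * Y ->
  dv <= g + g^-1 * (Q - 2 * v + 4 * B + 1) + 3 * B ->
  dv <= g + g^-1 * (sg / (2 * ep) + 2 * sg + dl / ep ^+ 2 + 6 * ep * K ^+ 3 +
    (3 * K ^+ 2 + 4 * (K / ep)) * dl + 4 * b) + 3 * b.
Proof.
move=> ep_gt0 K1 g_gt0 kl; rewrite ler_norml => /andP[tl tu] Xd Yd Bb.
rewrite ler_norml => /andP[vl vu] hQ hd.
have K0 : 0 <= K by lra.
have c1 : (6 * ep * K ^+ 2 + 2 * K) * X <= (6 * ep * K ^+ 2 + 2 * K) * dl.
  by rewrite ler_wpM2l// addr_ge0 ?mulr_ge0 ?sqr_ge0// ltW.
have c2 : 6 * K * Y <= 6 * K * dl by rewrite ler_wpM2l// mulr_ge0.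
have c3 : k2 - 2 * (dl / ep) <= (tr - X) / ep.
  rewrite ler_pdivlMr// mulrBl -[2 * _ * ep]mulrA divfK ?lt0r_neq0//; lra.
have hQ2 : Q <= 1 + sg / (2 * ep) + dl / ep ^+ 2 + 6 * ep * K ^+ 3 +
    (3 * K ^+ 2 + 4 * (K / ep)) * dl.
  rewrite -(ler_pM2l (_ : 0 < 2 * ep)) ?mulr_gt0//; apply: le_trans hQ _.
  have -> : 2 * ep * (1 + sg / (2 * ep) + dl / ep ^+ 2 + 6 * ep * K ^+ 3 +
      (3 * K ^+ 2 + 4 * (K / ep)) * dl) =
    2 * ep + sg + 2 * (dl / ep) + 12 * ep ^+ 2 * K ^+ 3 + (6 * ep * K ^+ 2 + 2 * K) * dl + 6 * K * dl.
    by field; rewrite lt0r_neq0.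
  have : 11 * ep ^+ 2 * K ^+ 3 <= 12 * ep ^+ 2 * K ^+ 3.
    have : 0 <= ep ^+ 2 * K ^+ 3 by rewrite mulr_ge0 ?sqr_ge0 ?exprn_ge0.
    by lra.
  by lra.
apply: le_trans hd _; apply: lerD; last by lra.
by rewrite lerD2l; apply: ler_wpM2l; [rewrite invr_ge0 ltW|lra].
Qed.

(** * The row sums seen from the resolvent, for a fixed size *)

Section NecessityFiniteSize.
Context d (T : measurableType d) (R : realType) (P : probability T R).
Context (n : nat) (W : T -> 'M[R[i]]_n.+1) (eta t K b : R).
Hypothesis wignerW : hermitian_wigner P W.
Hypothesis eta_ge2 : 2 <= eta.
Hypothesis t_gt0 : 0 < t.
Hypothesis t_le1 : t <= 1.
Hypothesis K_ge1 : 1 <= K.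
Local Notation N := (n.+1%:R : R).
Local Notation k w i := (diag_resolvent eta (truncmx t (W w)) i).
Local Notation eps := (eta^-1 ^+ 2).
Local Notation s1 i := (\sum_j trunc_var P W 1 i j).
Local Notation V := (avg_var P W t).
Local Notation dev := (avg_deviation P W t).

Hypothesis bad_le : N^-1 * \sum_(i | ~~ (s1 i <= K)) s1 i <= b.
Variable dl : R.
Hypothesis diag_near : `|N^-1 * \sum_i mean P (fun w => part false (k w i)) - kappa eta| <= dl.
Hypothesis defect1 : avg_defect P W eta t 1 0 <= dl.
Hypothesis defect2 : avg_defect P W eta t 1 (- 1) <= dl.

Let eta_gt0 : 0 < eta. Proof. exact: lt_le_trans eta_ge2. Qed.
Let eps_gt0 : 0 < eps. Proof. by have /andP[] := eps_range eta_ge2. Qed.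
Let N_gt0 : 0 < N. Proof. exact: ltr0Sn. Qed.
Let Nv_ge0 : 0 <= N^-1. Proof. by rewrite invr_ge0 ltW. Qed.
Let K_gt0 : 0 < K. Proof. exact: lt_le_trans K_ge1. Qed.
Let K_ge0 : 0 <= K. Proof. exact: ltW. Qed.

Let s2 i j := trunc_var P W t i j.
Let s2_ge0 i j : 0 <= s2 i j. Proof. exact: (trunc_var_ge0 P W t i j). Qed.
Let s2C i j : s2 i j = s2 j i. Proof. exact: (trunc_varC t wignerW). Qed.
Let r i := mean P (fun w => complex.Re (1 - k w i)).
Let q i := mean P (fun w => Normc.normc (1 - k w i) ^+ 2).
Let x i := `|mean P (fun w => complex.Re (defect P W eta t w i * (1 + 0 * (k w i)^*%C)))|.
Let y i := `|mean P (fun w => complex.Re (defect P W eta t w i * (1 + - 1 * (k w i)^*%C)))|.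
Let e i j := mean P (fun w => complex.Re (k w i * k w j)).

Let rE i : `|r i - eps * \sum_j s2 i j * e i j| <= x i.
Proof.
rewrite /r (mean_theta wignerW eta_gt0 t_gt0).
by rewrite -/(s2 _ _) -/(e _ _) addrAC subrr add0r.
Qed.

Let qr i : 0 <= q i /\ q i <= r i /\ r i <= 1.
Proof. exact: (theta_range wignerW eta_gt0 t_gt0). Qed.

Let qE i : q i <= eps ^+ 2 * row_sum s2 i ^+ 2 + 2 * y i.
Proof. exact: (mean_theta_sqr wignerW eta_gt0 t_gt0). Qed.

Let kk i j := mean_kk_bounds wignerW eta_gt0 t_gt0 i j.
Let e_ge i j : 1 - r i - r j - (q i + q j) / 2 <= e i j. Proof. by have [] := kk i j. Qed.
Let e_le i j : e i j <= 1 - r i - r j + (q i + q j) / 2. Proof. by have [] := kk i j. Qed.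
Let e_le1 i j : e i j <= 1. Proof. by have [] := kk i j. Qed.
Let e_ge2 i j c : 0 < c -> - (c + q i / c) <= e i j. Proof. by have [_ _ _] := kk i j; apply. Qed.
Let y_ge0 i : 0 <= y i. Proof. exact: normr_ge0. Qed.

Let B := N^-1 * \sum_(i | ~~ (row_sum s2 i <= K)) row_sum s2 i.
Let Tr := N^-1 * \sum_i r i.

(** Row sums increase with the truncation level, so a row that is large at level t is large at level
    1, where uniform integrability is available. *)
Let B_le : B <= b.
Proof.
apply: le_trans bad_le; apply: ler_wpM2l => //.
have le1 i : row_sum s2 i <= s1 i by apply: ler_sum => j _; exact: trunc_var_le1.
apply: (@le_trans _ _ (\sum_(i | ~~ (row_sum s2 i <= K)) s1 i)); first exact: ler_sum.
rewrite [leRHS](bigID (fun i => ~~ (row_sum s2 i <= K)))/=.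
rewrite [X in _ <= X + _](eq_bigl (fun i => ~~ (row_sum s2 i <= K))); last first.
  move=> i; rewrite -!ltNge andb_idl// => h; exact: lt_le_trans h (le1 i).
rewrite lerDl; apply: sumr_ge0 => i _; apply: sumr_ge0 => j _; exact: trunc_var_ge0.
Qed.

Let B_ge0 : 0 <= B.
Proof. by rewrite mulr_ge0// sumr_ge0// => i _; apply: sumr_ge0. Qed.

Let Tr_near : `|Tr - eps * kappa eta ^+ 2| <= dl.
Proof.
have -> : Tr = 1 - N^-1 * \sum_i mean P (fun w => part false (k w i)).
  rewrite /Tr (eq_bigr (fun i => 1 - mean P (fun w => part false (k w i)))); last first.
    move=> i _; rewrite /r -[X in X - _](mean_cst P) -meanB; last 2 first.
    - exact: bmeas_cst.
    - exact: (bmeas_part false (bcmeas_diag wignerW eta_gt0 t_gt0 i)).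
    by congr mean; apply/funext => w /=; case: (k w i).
  rewrite sumrB sumr_const card_ord mulrBr mulVf//; exact: lt0r_neq0.
have := kappaE eta_ge2; set z := eps * _ => kE.
rewrite distrC (_ : _ - _ = N^-1 * \sum_i mean P (fun w => part false (k w i)) - (1 - z)).
  by rewrite -kE.
by ring.
Qed.

Let kap0 := kappa_ge0 eta_ge2.
Let kap1 := kappa_le1 eta_ge2.
Let kapE := kappaE eta_ge2.

Let kappa_sqr_ge : 1 - 2 * eps <= kappa eta ^+ 2.
Proof.
have h : 1 - eps <= kappa eta.
  rewrite kapE lerD2l lerN2 ler_piMr ?(ltW eps_gt0)//; exact: exprn_ile1.
by nra.
Qed.

Lemma avg_var_near1 : `|V - 1| <= 2 * eps + 3 * K * (eps + dl) + 8 * b + 2 * (dl / eps).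
Proof.
have lo := ler_wpM2l Nv_ge0 (total_variance_ge s2_ge0 eps_gt0 rE e_le1).
have hi := ler_wpM2l Nv_ge0 (total_variance_le s2_ge0 s2C K_ge1 eps_gt0 rE qr e_ge e_ge2).
have k2_le1 : kappa eta ^+ 2 <= 1 by rewrite exprn_ile1.
apply: (variance_arith eps_gt0 K_ge1 kappa_sqr_ge k2_le1 Tr_near defect1 B_ge0 B_le).
  by move: lo; rewrite mulrBr mulrCA.
move: hi; rewrite mulrCA; congr (_ <= _).
by rewrite /B /Tr /avg_defect; ring.
Qed.

Lemma avg_deviation_near0 g sg : 0 < g -> `|V - 1| <= sg ->
  dev <= g + g^-1 * (sg / (2 * eps) + 2 * sg + dl / eps ^+ 2 + 6 * eps * K ^+ 3 +
    (3 * K ^+ 2 + 4 * (K / eps)) * dl + 4 * b) + 3 * b.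
Proof.
move=> g_gt0 Vsg.
have h1 := ler_wpM2l Nv_ge0 (row_sum_deviation s2_ge0 s2C K_ge1 g_gt0).
have h2 := ler_wpM2l Nv_ge0 (good_second_moment s2_ge0 s2C K_ge1 eps_gt0 rE qr qE e_ge e_le1 e_ge2 y_ge0 e_le).
apply: (deviation_arith (Q := N^-1 * \sum_(i | good s2 K i) good_row_sum s2 K i ^+ 2)
  eps_gt0 K_ge1 g_gt0 kappa_sqr_ge Tr_near defect1 defect2 B_le Vsg).
  move: h2; rewrite mulrCA; congr (_ <= _).
  rewrite /Tr /avg_defect /avg_var -/(row_sum s2 _); field.
  by rewrite addrC natr1 pnatr_eq0 lt0r_neq0.
move: h1; congr (_ <= _).
rewrite /avg_var /B; field.
by rewrite addrC natr1 pnatr_eq0 lt0r_neq0.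
Qed.

End NecessityFiniteSize.

(** * Uniform integrability *)

Section UniformIntegrability.
Variable R : realType.
Variable s : forall n, 'I_n.+1 -> R.
Hypothesis s_to0 : forall J : forall n, {set 'I_n.+1},
  #|J n|%:R / n.+1%:R @[n --> \oo] --> (0 : R) ->
  n.+1%:R^-1 * (\sum_(i in J n) s i) @[n --> \oo] --> (0 : R).

Let bad (e : R) m n := exists J : {set 'I_n.+1},
  m.+1%:R * #|J|%:R <= n.+1%:R :> R /\ e < n.+1%:R^-1 * \sum_(i in J) s i.

(* Otherwise, sets of density at most 1/(m+1) that are bad for larger and
   larger m, placed along a strictly increasing sequence of indices, would
   contradict [s_to0]. *)
Lemma small_sets (e : R) : 0 < e -> exists2 m : nat, True &
  \forall n \near \oo, forall J : {set 'I_n.+1},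
    m.+1%:R * #|J|%:R <= n.+1%:R :> R -> n.+1%:R^-1 * \sum_(i in J) s i <= e.
Proof.
move=> e_gt0; apply: contrapT => H.
have badE m M : exists n, (M <= n)%N /\ bad e m n.
  apply: contrapT => HmM; apply: H; exists m => //; exists M => // n /= Mn J Jm.
  by rewrite leNgt; apply/negP => h; apply: HmM; exists n; split => //; exists J.
pose h m M := sval (cid (badE m M)).
have hM m M : (M <= h m M)%N by rewrite /h; case: cid => ? [].
have hbad m M : bad e m (h m M) by rewrite /h; case: cid => ? [].
pose g := fix g m := if m is k.+1 then h k.+1 (g k).+1 else h 0 0.
have gbad m : bad e m (g m) by case: m => [|m] /=; exact: hbad.
have g_lt m : (g m < g m.+1)%N by rewrite /=; exact: hM.
have g_mono : {homo g : m n / (m < n)%N} by apply: homo_ltn => //; exact: ltn_trans.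
have g_inj : injective g.
  move=> m n gmn; apply/eqP; rewrite eqn_leq; apply/andP; split; rewrite leqNgt;
  by apply/negP => /g_mono; rewrite gmn ltnn.
pose J n : {set 'I_n.+1} := if pselect (exists m, g m = n /\ bad e m n) is left E
  then sval (cid (proj2 (svalP (cid E)))) else finset.set0.
have J_small n : #|J n|%:R / n.+1%:R != 0 :> R ->
    exists m, g m = n /\ m.+1%:R * #|J n|%:R <= n.+1%:R :> R.
  rewrite /J; case: pselect => [E _|_]; last by rewrite cards0 mul0r eqxx.
  case: (cid E) => k [gk bk] /=; case: cid => J0 /= [J1 _].
  by exists k.
have J_large m : e < (g m).+1%:R^-1 * \sum_(i in J (g m)) s i.
  rewrite /J; case: pselect => [E|[]]; last by exists m.
  by case: (cid E) => k [gk bk] /=; case: cid => J0 /= [].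
have Jto0 : #|J n|%:R / n.+1%:R @[n --> \oo] --> (0 : R).
  apply/cvgr0Pnorm_le => eps eps_gt0; near=> n.
  have [->|/J_small[m [gm Jm]]] := eqVneq (#|J n|%:R / n.+1%:R : R) 0.
    by rewrite normr0 ltW.
  have m_large : (Num.truncn eps^-1 <= m)%N.
    rewrite leqNgt; apply/negP => /g_mono; rewrite gm ltnNge => /negP; apply.
    by near: n; exists (g (Num.truncn eps^-1)).
  rewrite ger0_norm ?divr_ge0// ler_pdivrMr// -(ler_pM2l (ltr0Sn R m)).
  apply: le_trans Jm _; rewrite mulrA ler_peMl//.
  rewrite -ler_pdivrMr// mul1r; apply: le_trans (ltW (truncnS_gt _)) _.
  by rewrite ler_nat.
have /cvgr0Pnorm_lt /(_ e e_gt0) [n0 _ Hn0] := s_to0 Jto0.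
have gn0 : (n0 <= g n0)%N.
  by elim: n0 {Hn0} => // k IH; exact: leq_ltn_trans IH (g_lt k).
have := Hn0 _ gn0; rewrite /= ltNge => /negP; apply.
by apply: le_trans (ler_norm _); exact: ltW.
Unshelve. all: by end_near.
Qed.

(** If the set of rows exceeding K were not small, it would contain a set of nearly maximal
    admissible size, on which the sum exceeds what [small_sets] allows. *)
Lemma uniform_integrability (e : R) : 0 < e -> exists2 K, 1 <= K &
  \forall n \near \oo, n.+1%:R^-1 * \sum_(i | ~~ (s i <= K)) @s n i <= e.
Proof.
move=> e_gt0; have [m _ Hm] := small_sets e_gt0.
(* With c the integer part of N / (m + 1), the inequality N <= 2 (m + 1) c gives c K > N e. *)
pose K := 1 + 2 * m.+1%:R * e; have K_ge1 : 1 <= K by rewrite lerDl !mulr_ge0// ltW.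
exists K => //; near=> n.
have small : forall J : {set 'I_n.+1},
    m.+1%:R * #|J|%:R <= n.+1%:R :> R -> n.+1%:R^-1 * \sum_(i in J) s i <= e.
  by near: n.
pose A : {set 'I_n.+1} := [set i | ~~ (s i <= K)]%SET.
rewrite (eq_bigl (mem A)); last by move=> i; rewrite !inE.
have [Am|Am] := leP (m.+1 * #|A|)%N n.+1; first by apply: small; rewrite -natrM ler_nat.
pose c := (n.+1 %/ m.+1)%N.
have c_le : (c <= #|A|)%N.
  by rewrite -ltnS ltn_divLR// mulnC (leq_trans Am)// mulnS leq_addl.
have [r [r_uniq r_size r_sub]] := card_geqP c_le.
pose J := [set x in r]%SET.
have cardJ : #|J| = c by rewrite cardsE; move/card_uniqP : r_uniq => ->.
have := small J; rewrite cardJ -natrM ler_nat mulnC leq_divM => /(_ isT).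
(* Positivity of c holds once n >= m; it makes rounding down lose at most a factor 2. *)
have c_gt0 : (0 < c)%N.
  by rewrite divn_gt0// ltnS; near: n; exists m.
have c_ge : (n.+1 <= 2 * m.+1 * c)%N.
  have := ltn_ceil n.+1 (ltn0Sn m); rewrite -/c => /ltnW/leq_trans; apply.
  by rewrite [leqRHS]mulnAC leq_mul2r mul2n -addnn -[c.+1]addn1 leq_add2l c_gt0 orbT.
rewrite ler_pdivrMl// leNgt => /negP; case.
apply: (@lt_le_trans _ _ (\sum_(i in J) K)); last first.
  apply: ler_sum => i; rewrite inE => /r_sub; rewrite inE -ltNge; exact: ltW.
rewrite sumr_const cardJ -[_ *+ c]mulr_natr /K mulrDl mul1r.
rewrite mulrAC -!natrM; apply: (@le_lt_trans _ _ ((2 * m.+1 * c)%:R * e)).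
  by rewrite ler_pM2r// ler_nat.
by rewrite ltrDr ltr0n.
Unshelve. all: by end_near.
Qed.

End UniformIntegrability.

(** * Limits *)

Section Limits.
Variables (R : realType) (d : nat -> measure_display).
Variable T : forall n, measurableType (d n).
Variable P : forall n, probability (T n) R.
Variable W : forall n, T n -> 'M[R[i]]_n.+1.
Hypothesis wignerW : forall n, hermitian_wigner (P n) (@W n).
Local Notation N n := (n.+1%:R : R).
Let s1 n (i : 'I_n.+1) := \sum_j trunc_var (P n) (@W n) 1 i j.
Let V1 n := (N n)^-1 * \sum_(i < n.+1) s1 i.
Let M1 n := (N n)^-1 * \sum_i \sum_j trunc_mean (P n) (@W n) 1 i j ^+ 2.
Let D1 n := (N n)^-1 * \sum_(i < n.+1) `|s1 i - 1|.
Let tail t n := avg_tail (P n) (@W n) t.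
Hypothesis M1_to0 : M1 n @[n --> \oo] --> (0 : R).
Hypothesis tail_to0 : forall t : R, 0 < t -> tail t n @[n --> \oo] --> (0 : R).
Local Notation mu n := (expected_measure (P n) (fun w => empirical_spectral_measure (@W n w))).
Local Notation resolvent_mean b eta n :=
  (mean (P n) (fun w => (N n)^-1 * part b (\sum_i diag_resolvent eta (@W n w) i))).

(** The level t is fixed first, with C t (1 + v) <= dl / 2; the terms carrying 1/t then tend to 0
    along n. *)
Lemma choose_truncation (v C dl : R) : 0 <= v -> 0 <= C -> 0 < dl ->
  exists t, [/\ 0 < t, t <= 1 &
    \forall n \near \oo, C * defect_error t v (M1 n) (tail t n) <= dl /\ tail t n <= dl].
Proof.
move=> v0 C0 dl0; pose X := 2 * (C * (1 + v) + 1).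
have X0 : 0 < X by rewrite mulr_gt0// ltr_wpDl// mulr_ge0// addr_ge0.
pose t := Num.min 1 (dl / X).
have t0 : 0 < t by rewrite lt_min ltr01 divr_gt0.
have t1 : t <= 1 by rewrite ge_min lexx.
have tX : t * X <= dl by rewrite -ler_pdivlMr// ge_min lexx orbT.
exists t; split => //.
pose a := Num.min dl (dl * t / (12 * (C + 1))).
have C1 : 0 < 12 * (C + 1) by rewrite mulr_gt0// ltr_wpDl.
have a0 : 0 < a by rewrite lt_min dl0 divr_gt0// mulr_gt0.
have ad : a <= dl by rewrite ge_min lexx.
have aC : a * (12 * (C + 1)) <= dl * t by rewrite -ler_pdivlMr// ge_min lexx orbT.
move/cvgr0Pnorm_le : M1_to0 => /(_ a a0).
move/cvgr0Pnorm_le : (tail_to0 t0) => /(_ a a0).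
apply: filterS2 => n hT hM.
have {}hM := le_trans (ler_norm _) hM; have {}hT := le_trans (ler_norm _) hT.
split; last exact: le_trans ad.
rewrite /defect_error mulrDr.
have h1 : C * (t * (1 + v)) <= dl / 2 by move: tX; rewrite /X; nra.
have h2 : C * (t^-1 * (2 * M1 n + 4 * tail t n)) <= dl / 2.
  rewrite mulrCA ler_pdivrMl//.
  have : C * (2 * M1 n + 4 * tail t n) <= C * (6 * a) by rewrite ler_wpM2l//; lra.
  by nra.
by rewrite [leRHS](splitr dl) lerD.
Qed.

Lemma mean_expected_resolvent (b : bool) (eta : R) n : 2 <= eta ->
  mean (mu n) (fun x => x ^+ b * (x ^+ 2 + eta ^+ 2)^-1) =
  (if b then - eta^-1 else eta^-1 ^+ 2) * resolvent_mean b eta n.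
Proof.
move=> eta_ge2; have eta_gt0 : 0 < eta by apply: lt_le_trans eta_ge2.
have hW w : @W n w \is hermsymmx by case: (wignerW n).
have mW i j : cmeas (fun w => @W n w i j) by exact: cmeas_wigner (wignerW n) i j.
rewrite mean_expected_cauchy// -meanZ; last first.
  apply: bmeasM; first exact: bmeas_cst.
  exact: bmeas_sum_diag_resolvent.
congr mean; apply/funext => w; rewrite mulrCA.
by case: b.
Qed.

(** * From the row sums to the semicircle law *)

Section Sufficiency.
Hypothesis D1_to0 : D1 n @[n --> \oo] --> (0 : R).

Lemma cvg_resolvent_mean (b : bool) (eta : R) : 2 <= eta ->
  resolvent_mean b eta n @[n --> \oo] --> part b (kappa eta)%:C.
Proof.
move=> eta_ge2; have eta_gt0 : 0 < eta by apply: lt_le_trans eta_ge2.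
set kap := kappa eta.
have [kap0 kap1 kapE] := And3 (kappa_ge0 eta_ge2) (kappa_le1 eta_ge2) (kappaE eta_ge2).
apply/cvgrPdist_le => e e_gt0; pose g := e / 4.
have g0 : 0 < g by rewrite divr_gt0.
pose dl := Num.min (e / 8) (e * g / 100).
have dl0 : 0 < dl by rewrite lt_min !divr_gt0// mulr_gt0.
have dle : dl <= e / 8 by rewrite ge_min lexx.
have dlg : dl <= e * g / 100 by rewrite ge_min lexx orbT.
have c0 := defect_cst_ge0 eta_gt0 (- kap%:C) 1.
have [t [t0 t1 tn]] := choose_truncation (ler0n _ 2) c0 dl0.
move/cvgr0Pnorm_le : D1_to0 => D1n.
near=> n.
have [hdef htail] : defect_cst eta (- kap%:C) 1 * defect_error t 2 (M1 n) (tail t n) <= dl /\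
  tail t n <= dl by near: n.
have hD : D1 n <= dl.
  by apply: le_trans (ler_norm _) _; near: n; exact: D1n.
have hD1 : D1 n <= 1.
  by apply: le_trans (ler_norm _) _; near: n; exact: D1n.
have N0 : 0 < N n by rewrite ltr0n.
(* The deviation bounds the average row sum by 1 + D1; this is the bound v = 2 used when choosing
   t. *)
have hV : V1 n <= 2.
  have : V1 n <= 1 + D1 n.
    apply: (@le_trans _ _ ((N n)^-1 * (N n + \sum_(i < n.+1) `|s1 i - 1|))); last first.
      by rewrite mulrDr mulVf// lt0r_neq0.
    rewrite /V1 ler_wpM2l ?invr_ge0 ?(ltW N0)//.
    have -> : N n = \sum_(i < n.+1) 1 by rewrite sumr_const card_ord.
    rewrite -big_split/=; apply: ler_sum => i _.
    by have := ler_norm (s1 i - 1); lra.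
  by lra.
have hdef2 := avg_defect_le (wignerW n) eta_ge2 t0 t1 (- kap%:C) 1 hV (lexx (M1 n)).
have near1 := avg_resolvent_trunc (wignerW n) eta_ge2 t0 b.
have near2 := avg_diag_near (wignerW n) eta_ge2 t0 b kap0 kap1 kapE g0.
have hdev := avg_deviation_trunc (wignerW n) t0 t1.
move: near1 near2; set rm := mean _ _; set dm := _ * \sum_i mean _ _ => near1 near2.
rewrite distrC (_ : _ - _ = (rm - dm) + (dm - part b kap%:C)); last by ring.
apply: le_trans (ler_normD _ _) _.
have a0 : avg_defect (P n) (@W n) eta t (- kap%:C) 1 + 6 * avg_deviation (P n) (@W n) t <= 13 * dl.
  have : avg_defect (P n) (@W n) eta t (- kap%:C) 1 <= dl by exact: le_trans hdef2 hdef.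
  have : avg_deviation (P n) (@W n) t <= D1 n + tail t n.
    by move: hdev; rewrite ler_norml => /andP[_]; rewrite -/(D1 n) -/(tail t n); lra.
  by lra.
have g2 : 0 <= 2 * g^-1 by rewrite mulr_ge0// invr_ge0 ltW.
have a1 := le_trans near2 (lerD (lexx g) (ler_wpM2l g2 a0)).
have a2 : 2 * g^-1 * (13 * dl) <= 26 / 100 * e.
  rewrite (_ : 2 * g^-1 * (13 * dl) = 26 * dl / g); last by ring.
  rewrite ler_pdivrMr// (_ : 26 / 100 * e * g = 26 * (e * g / 100)); last by field.
  by rewrite ler_pM2l.
have := le_trans near1 (le_trans (lexx _) htail); rewrite -/rm.
move=> h; rewrite -/kap in a1; have gE : g = e / 4 by [].
have {a1 near2} a1 := le_trans a1 (lerD (lexx g) a2).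
move: a1 h dle gE; move: (dl) (g) => dl' g' a1 h dle' gE.
by lra.
Unshelve. all: by end_near.
Qed.

Lemma deviation_weak_cvg (f : R -> R) : continuous f -> bounded_fun f ->
  mean (mu n) f @[n --> \oo] --> mean (@semicircle R) f.
Proof.
apply: cvg_mean_cauchy.
  move=> b s s4; have s0 : 0 < s by apply: lt_le_trans s4.
  pose eta := Num.sqrt s; have eta2 : eta ^+ 2 = s by rewrite sqr_sqrtr// ltW.
  have eta_ge2 : 2 <= eta.
    by rewrite -(ler_sqr (_ : 2 \in Num.nneg)) ?nnegrE ?sqrtr_ge0// eta2 -natrX.
  rewrite -eta2; under eq_fun do rewrite mean_expected_resolvent//.
  rewrite (_ : mean _ _ = (if b then - eta^-1 else eta^-1 ^+ 2) * part b (kappa eta)%:C).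
    by apply: cvgMr; exact: cvg_resolvent_mean.
  case: b; last exact: mean_semicircle_kappa.
  by rewrite /= mulr0 eta2 mean_semicircle_odd.
(* Tightness of the semicircle law in the required form: 1 - eta^2 times the mean of the kernel is 1
   - kappa = eps kappa^2 <= eps. *)
move=> e e_gt0; have [eta eta_ge2 eta_e] := exists_eta e_gt0.
have eta4 : 4 <= eta ^+ 2 by rewrite expr2; nra.
exists (eta ^+ 2) => //; have eta0 : 0 < eta by lra.
have bc := @bmeas_cauchy R false _ eta4.
rewrite (_ : (fun x => _) = fun x => 1 - eta ^+ 2 * (x ^+ false * (x ^+ 2 + eta ^+ 2)^-1)); last first.
  by apply/funext => x; rewrite expr0 mul1r.
rewrite meanB ?mean_cst; last 2 first.
- exact: bmeas_cst.
- by apply: bmeasM => //; exact: bmeas_cst.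
rewrite [X in _ - X](meanZ _ _ bc).
rewrite mean_semicircle_kappa// mulrA -exprMn divff ?expr1n ?mul1r ?lt0r_neq0//.
rewrite kappaE// subKr; apply: le_trans eta_e.
by rewrite ler_piMr ?sqr_ge0// exprn_ile1 ?kappa_ge0 ?kappa_le1.
Qed.

End Sufficiency.

(** * From the semicircle law to the row sums *)

Section Necessity.
Hypothesis weak : forall f : R -> R, continuous f -> bounded_fun f ->
  mean (mu n) f @[n --> \oo] --> mean (@semicircle R) f.
Hypothesis unif : forall e : R, 0 < e -> exists2 K, 1 <= K &
  \forall n \near \oo, (N n)^-1 * \sum_(i < n.+1 | ~~ (s1 i <= K)) s1 i <= e.

Let s1_ge0 n (i : 'I_n.+1) : 0 <= s1 i.
Proof. by apply: sumr_ge0 => j _; exact: trunc_var_ge0. Qed.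

Lemma weak_resolvent_mean (eta : R) : 2 <= eta ->
  resolvent_mean false eta n @[n --> \oo] --> kappa eta.
Proof.
move=> eta_ge2; have eta_gt0 : 0 < eta by apply: lt_le_trans eta_ge2.
have eta4 : 4 <= eta ^+ 2 by rewrite expr2; nra.
pose f (x : R) := x ^+ false * (x ^+ 2 + eta ^+ 2)^-1.
have eta2 : 0 < eta ^+ 2 by rewrite exprn_gt0.
have fc : continuous f.
  by apply: continuousM'; [exact: (continuousX' (@continuous_id' R))|exact: continuous_cauchy].
have fb : bounded_fun f.
  have [_ [M fM]] := bmeas_cauchy false eta4.
  exists M; split; first exact: num_real.
  by move=> y My x _ /=; apply: le_trans (fM x) (ltW My).
have := weak fc fb.
under eq_fun do rewrite mean_expected_resolvent//.
rewrite mean_semicircle_kappa// => /(cvgM (cvg_cst (eta ^+ 2))).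
have e2 : eta ^+ 2 * eta^-1 ^+ 2 = 1 by rewrite -exprMn divff ?expr1n// lt0r_neq0.
rewrite mulrA e2 mul1r.
by rewrite [X in X @ _ --> _](_ : _ = fun n => resolvent_mean false eta n)//; apply/funext => n /=; rewrite mulrA e2 mul1r.
Qed.

(** Convergence to the semicircle law is not yet exploited: uniform integrability alone bounds the
    average row sum, which is required before the defects can be made small. *)
Lemma variance_bounded : exists2 v, 0 <= v & \forall n \near \oo, V1 n <= v.
Proof.
have [K K1 Kn] := unif ltr01; exists (K + 1); first lra.
apply: filterS Kn => n Kn; have N0 : 0 < N n by rewrite ltr0n.
rewrite /V1 (bigID (fun i => s1 i <= K))/= mulrDr; apply: lerD => //.
rewrite ler_pdivrMl// mulr_natl -[X in _ *+ X]card_ord -sumr_const.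
apply: (@le_trans _ _ (\sum_(i < n.+1 | s1 i <= K) K)); first exact: ler_sum.
by rewrite [leRHS](bigID (fun i : 'I_n.+1 => s1 i <= K))/= lerDl sumr_ge0// => i _; lra.
Qed.

Lemma necessity_inputs (eta dl : R) : 2 <= eta -> 0 < dl -> exists t, [/\ 0 < t, t <= 1 &
  \forall n \near \oo,
    [/\ `|(N n)^-1 * \sum_(i < n.+1) mean (P n) (fun w => part false
          (diag_resolvent eta (truncmx t (@W n w)) i)) - kappa eta| <= dl,
      avg_defect (P n) (@W n) eta t 1 0 <= dl,
      avg_defect (P n) (@W n) eta t 1 (- 1) <= dl &
      tail t n <= dl]].
Proof.
move=> eta_ge2 dl0; have eta_gt0 : 0 < eta by apply: lt_le_trans eta_ge2.
have [v v0 Vn] := variance_bounded.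
have c1 := defect_cst_ge0 eta_gt0 1 0; have c2 := defect_cst_ge0 eta_gt0 1 (- 1).
have [t [t0 t1 tn]] := choose_truncation v0 (addr_ge0 c1 c2) (divr_gt0 dl0 (ltr0n _ 2)).
exists t; split=> //.
have dl2 : 0 < dl / 2 by rewrite divr_gt0.
move/cvgrPdist_le : (weak_resolvent_mean eta_ge2) => /(_ _ dl2) res.
near=> n.
have hV : V1 n <= v by near: n.
have hres : `|kappa eta - resolvent_mean false eta n| <= dl / 2 by near: n.
have [hdef htail] : (defect_cst eta 1 0 + defect_cst eta 1 (- 1)) *
    defect_error t v (M1 n) (tail t n) <= dl / 2 /\ tail t n <= dl / 2 by near: n.
have near1 := avg_resolvent_trunc (wignerW n) eta_ge2 t0 false.
have M0 : 0 <= M1 n.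
  rewrite mulr_ge0 ?invr_ge0 ?ler0n// sumr_ge0// => i _; apply: sumr_ge0 => j _.
  exact: sqr_ge0.
have T0 : 0 <= tail t n.
  rewrite mulr_ge0 ?invr_ge0 ?ler0n// sumr_ge0// => i _; apply: sumr_ge0 => j _.
  exact: tail_prob_ge0.
have err0 : 0 <= defect_error t v (M1 n) (tail t n).
  rewrite /defect_error addr_ge0// mulr_ge0 ?invr_ge0 ?(ltW t0)//; lra.
have err1 := mulr_ge0 c1 err0; have err2 := mulr_ge0 c2 err0.
have d1 := avg_defect_le (wignerW n) eta_ge2 t0 t1 1 0 hV (lexx (M1 n)).
have d2 := avg_defect_le (wignerW n) eta_ge2 t0 t1 1 (- 1) hV (lexx (M1 n)).
move: hdef; rewrite mulrDl => hdef.
split.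
- rewrite distrC.
  rewrite (_ : _ - _ = (kappa eta - resolvent_mean false eta n) +
    (resolvent_mean false eta n - (N n)^-1 * \sum_(i < n.+1) mean (P n) (fun w => part false
          (diag_resolvent eta (truncmx t (@W n w)) i)))); last by ring.
  apply: le_trans (ler_normD _ _) _; rewrite [leRHS](splitr dl); apply: lerD => //.
  exact: le_trans near1 htail.
- by apply: le_trans d1 _; lra.
- by apply: le_trans d2 _; lra.
- by lra.
Unshelve. all: by end_near.
Qed.

(** The bound of [avg_var_near1] is of order K eps, and K depends only on [sg]; eta is therefore
    chosen large after K, and dl small compared with eps. *)
Lemma variance_to1 (sg : R) : 0 < sg -> \forall n \near \oo, `|V1 n - 1| <= sg.
Proof.
move=> sg0.
have [K K1 Kn] := unif (divr_gt0 sg0 (ltr0n _ 64)).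
have K0 : 0 < 3 * K + 2 by lra.
have [eta eta_ge2 eta_le] := exists_eta (divr_gt0 sg0 (mulr_gt0 (ltr0n R 8) K0)).
have /andP[ep0 ep1] := eps_range eta_ge2.
move: eta_le ep0 ep1; set ep := eta^-1 ^+ 2 => eta_le ep0 ep1.
have epK : ep * (3 * K + 2) <= sg / 8 by move: eta_le; rewrite invfM mulrA ler_pdivlMr.
pose dl := sg * ep / (8 * (3 * K + 3)).
have K30 : 0 < 8 * (3 * K + 3) by lra.
have dl0 : 0 < dl by rewrite divr_gt0// mulr_gt0.
have dlE : dl * (8 * (3 * K + 3)) = sg * ep by rewrite divfK// lt0r_neq0.
have [t [t0 t1 tn]] := necessity_inputs eta_ge2 dl0.
near=> n.
have [h1 h2 h3 h4] : [/\ `|(N n)^-1 * \sum_(i < n.+1) mean (P n) (fun w => part false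
          (diag_resolvent eta (truncmx t (@W n w)) i)) - kappa eta| <= dl,
      avg_defect (P n) (@W n) eta t 1 0 <= dl,
      avg_defect (P n) (@W n) eta t 1 (- 1) <= dl &
      tail t n <= dl] by near: n.
have hK : (N n)^-1 * \sum_(i < n.+1 | ~~ (s1 i <= K)) s1 i <= sg / 64 by near: n.
have hV := avg_var_near1 (wignerW n) eta_ge2 t0 t1 K1 hK h1 h2.
have /andP[v1 v2] := avg_var_trunc (wignerW n) t0 t1.
move: hV v1 v2 h4; rewrite -/ep /tail -/(V1 n).
move: (avg_var _ _ _) (avg_tail _ _ _) => v p hV v1 v2 h4.
have dlep : dl / ep = sg / (8 * (3 * K + 3)).
  by rewrite /dl mulrAC mulfK// lt0r_neq0.
have dlep1 : dl / ep <= sg / 48.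
  rewrite dlep ler_pM2l// lef_pV2 ?posrE//; lra.
have dlK : dl * (3 * K + 3) <= sg / 32 by nra.
move: hV; rewrite !ler_norml => /andP[a1 a2].
have dl1 : 0 <= dl * K by rewrite mulr_ge0// ltW//; lra.
by apply/andP; split; lra.
Unshelve. all: by end_near.
Qed.

Lemma deviation_to0 : D1 n @[n --> \oo] --> (0 : R).
Proof.
apply/cvgr0Pnorm_le => e e0.
pose g := e / 8; have g0 : 0 < g by rewrite divr_gt0.
pose b := Num.min (g ^+ 2 / 32) (e / 24).
have b0 : 0 < b by rewrite lt_min !divr_gt0// exprn_gt0.
have bg : b <= g ^+ 2 / 32 by rewrite ge_min lexx.
have be : b <= e / 24 by rewrite ge_min lexx orbT.
have [K K1 Kn] := unif b0.
have K0 : 0 < K by lra.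
have K3 : 0 < 48 * K ^+ 3 by rewrite mulr_gt0// exprn_gt0.
have [eta eta_ge2 eta_le] := exists_eta (divr_gt0 (exprn_gt0 2 g0) K3).
have /andP[ep0 ep1] := eps_range eta_ge2.
move: eta_le ep0 ep1; set ep := eta^-1 ^+ 2 => eta_le ep0 ep1.
have epK : 6 * ep * K ^+ 3 <= g ^+ 2 / 8.
  by move: eta_le; rewrite ler_pdivlMr// => h; lra.
(* The precision demanded of the average row sum, at most proportional to [ep]. It is available
   because [variance_to1] selects its own eta and K. *)
pose sg := g ^+ 2 / 8 / ((2 * ep)^-1 + 2).
have q0 : 0 < (2 * ep)^-1 + 2 by rewrite addr_gt0// invr_gt0 mulr_gt0.
have sg0 : 0 < sg by rewrite !divr_gt0// exprn_gt0.
have sgE : sg / (2 * ep) + 2 * sg = g ^+ 2 / 8.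
  by rewrite [2 * sg]mulrC -mulrDr /sg divfK// lt0r_neq0.
pose c := (ep ^+ 2)^-1 + (3 * K ^+ 2 + 4 * (K / ep)).
have c0 : 0 < c.
  have ep2 : 0 < (ep ^+ 2)^-1 by rewrite invr_gt0; exact: (exprn_gt0 2 ep0).
  have K2 : 0 < K ^+ 2 by rewrite exprn_gt0.
  by have := divr_gt0 K0 ep0; rewrite /c; lra.
pose dl := Num.min (Num.min (sg / 2) (e / 8)) (g ^+ 2 / 8 / c).
have dl0 : 0 < dl by rewrite !lt_min !divr_gt0// exprn_gt0.
have dls : dl <= sg / 2 by rewrite !ge_min lexx.
have dle : dl <= e / 8 by rewrite !ge_min lexx orbT.
have dlc : dl / ep ^+ 2 + (3 * K ^+ 2 + 4 * (K / ep)) * dl <= g ^+ 2 / 8.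
  have : dl * c <= g ^+ 2 / 8 by rewrite -ler_pdivlMr// !ge_min lexx !orbT.
  by rewrite /c mulrDr [dl * (_ + _)]mulrC.
have [t [t0 t1 tn]] := necessity_inputs eta_ge2 dl0.
have sg2 : 0 < sg / 2 by rewrite divr_gt0.
near=> n.
have [h1 h2 h3 h4] : [/\ `|(N n)^-1 * \sum_(i < n.+1) mean (P n) (fun w => part false
          (diag_resolvent eta (truncmx t (@W n w)) i)) - kappa eta| <= dl,
      avg_defect (P n) (@W n) eta t 1 0 <= dl,
      avg_defect (P n) (@W n) eta t 1 (- 1) <= dl &
      tail t n <= dl] by near: n.
have hK : (N n)^-1 * \sum_(i < n.+1 | ~~ (s1 i <= K)) s1 i <= b by near: n.
have hV : `|V1 n - 1| <= sg / 2 by near: n; exact: variance_to1.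
have /andP[v1 v2] := avg_var_trunc (wignerW n) t0 t1.
have T0 : 0 <= tail t n.
  rewrite mulr_ge0 ?invr_ge0 ?ler0n// sumr_ge0// => i _; apply: sumr_ge0 => j _.
  exact: tail_prob_ge0.
have Vsg : `|avg_var (P n) (@W n) t - 1| <= sg.
  move: hV v1 v2 h4 T0; rewrite /tail -/(V1 n) !ler_norml => /andP[x1 x2] v1 v2 h4 T0.
  by apply/andP; split; lra.
have := avg_deviation_near0 (wignerW n) eta_ge2 t0 t1 K1 hK h1 h2 h3 g0 Vsg.
have hdev : D1 n <= avg_deviation (P n) (@W n) t + tail t n.
  by have := avg_deviation_trunc (wignerW n) t0 t1; rewrite ler_norml => /andP[+ _]; rewrite -/(D1 n) -/(tail t n); lra.
have D0 : 0 <= D1 n by rewrite mulr_ge0 ?invr_ge0 ?ler0n// sumr_ge0.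
rewrite ger0_norm// -/ep => H.
have {}H : avg_deviation (P n) (@W n) t <= g + g^-1 * (g ^+ 2 / 2) + 3 * b.
  apply: le_trans H _; rewrite lerD2r lerD2l ler_pM2l ?invr_gt0//; lra.
have gg : g^-1 * (g ^+ 2 / 2) = g / 2 by field; exact: lt0r_neq0.
rewrite gg in H.
apply: le_trans hdev _; have gE : g = e / 8 by [].
by clear -H gE be h4 dle e0; lra.
Unshelve. all: by end_near.
Qed.

End Necessity.

End Limits.

Unset Implicit Arguments.
Set Strict Implicit.
Set Printing Implicit Defensive.

Theorem theorem1p8 (R : realType) (d : nat -> measure_display)
    (T : forall n, measurableType (d n)) (P : forall n, probability (T n) R)
    (W : forall n, T n -> 'M[R[i]]_n.+1)
    (wignerW : forall n, hermitian_wigner (P n) (W n))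
    (mean_to0 :
      n.+1%:R^-1 * (\sum_(i < n.+1) \sum_(j < n.+1)
        Normc.normc (complex_expectation_on (P n) (fun w => W n w i j)
          [set w | Normc.normc (W n w i j) <= 1]) ^+ 2)
      @[n --> \oo] --> (0 : R))
    (tail_to0 : forall eps : R, 0 < eps ->
      n.+1%:R^-1 * (\sum_(i < n.+1) \sum_(j < n.+1)
        fine (P n [set w | eps < Normc.normc (W n w i j)]))
      @[n --> \oo] --> (0 : R))
    (var_to0 : forall J : forall n, {set 'I_n.+1},
      #|J n|%:R / n.+1%:R @[n --> \oo] --> (0 : R) ->
      n.+1%:R^-1 * (\sum_(i in J n) \sum_(j < n.+1)
        expectation_on (P n) (fun w => Normc.normc (W n w i j) ^+ 2)
          [set w | Normc.normc (W n w i j) <= 1])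
      @[n --> \oo] --> (0 : R)) :
  weakly_converges
    (fun n => expected_measure (P n)
      (fun w => empirical_spectral_measure (W n w)))
    (@semicircle R)
  <->
  n.+1%:R^-1 * (\sum_(i < n.+1)
    `|\sum_(j < n.+1)
        expectation_on (P n) (fun w => Normc.normc (W n w i j) ^+ 2)
          [set w | Normc.normc (W n w i j) <= 1] - 1|)
  @[n --> \oo] --> (0 : R).
Proof.
pose s1 n (i : 'I_n.+1) := \sum_j trunc_var (P n) (W n) 1 i j.
have s1E n (i : 'I_n.+1) : \sum_(j < n.+1)
    expectation_on (P n) (fun w => Normc.normc (W n w i j) ^+ 2)
      [set w | Normc.normc (W n w i j) <= 1] = s1 n i.
  by apply: eq_bigr => j _; exact: expectation_on_trunc_var.
have M1_to0 : n.+1%:R^-1 * (\sum_i \sum_j trunc_mean (P n) (W n) 1 i j ^+ 2)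
    @[n --> \oo] --> (0 : R).
  apply: cvg_trans mean_to0; apply: near_eq_cvg; apply: nearW => n /=; congr (_ * _).
  apply: eq_bigr => i _; apply: eq_bigr => j _.
  by rewrite -complex_expectation_on_trunc_mean.
have tail t : 0 < t -> avg_tail (P n) (W n) t @[n --> \oo] --> (0 : R) by exact: tail_to0.
have unif : forall e : R, 0 < e -> exists2 K, 1 <= K &
    \forall n \near \oo, n.+1%:R^-1 * (\sum_(i < n.+1 | ~~ (s1 n i <= K)) s1 n i) <= e.
  move=> e e_gt0; apply: (@uniform_integrability R s1) => // J /var_to0 J_to0.
  apply: cvg_trans J_to0; apply: near_eq_cvg; apply: nearW => n /=; congr (_ * _).
  by apply: eq_bigr => i _; rewrite s1E.
have devE : (fun n => n.+1%:R^-1 * (\sum_(i < n.+1)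
    `|\sum_(j < n.+1)
        expectation_on (P n) (fun w => Normc.normc (W n w i j) ^+ 2)
          [set w | Normc.normc (W n w i j) <= 1] - 1|)) =
    (fun n => n.+1%:R^-1 * (\sum_(i < n.+1) `|s1 n i - 1|)) :> (nat -> R).
  by apply/funext => n; congr (_ * _); apply: eq_bigr => i _; rewrite s1E.
rewrite devE; split => [weak|D1_to0].
  exact: (deviation_to0 wignerW M1_to0 tail weak unif).
exact: (deviation_weak_cvg wignerW M1_to0 tail D1_to0).
Qed.
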